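(* Let $u_1,\dots,u_d\in\mathbb Z^n$ be integral vectors spanning $\mathbb R^n$, let $N\leqslant T^d$ be the associated compact Abelian subgroup, let $\mu=(\mu_I,\mu_S,\mu_T)$ be the moment map for the action of $N$ on $\mathbb C^{d,d}$ determined by scalars $\lambda_k^{(j)}\in\mathbb R$ ($k=1,\dots,d$, $j=1,2,3$), and let $K=\bigcap_{k=1}^dK_k\subset\mathbb R^n\times\mathbb C^n$ be the associated convex set. If the combinatorial interior $$\operatorname{CInt}(K)=K\setminus\bigcup_{k=1}^dW_k$$ of $K$ is non-empty, then a dense open subset of $M=\mu^{-1}(0)/N$ carries a smooth hypersymplectic structure.
   Context: **Hypersymplectic.** A hypersymplectic structure on a manifold of dimension $4n$ consists of a pseudo-Riemannian metric $g$ of signature $(2n,2n)$ and endomorphisms $I,S,T$ of the tangent bundle with $I^2=-1$, $S^2=1=T^2$, $IS=T=-SI$, $g(I\cdot,I\cdot)=g$, $g(S\cdot,S\cdot)=-g=g(T\cdot,T\cdot)$, such that the two-forms $\omega_I=g(I\cdot,\cdot)$, $\omega_S=g(S\cdot,\cdot)$, $\omega_T=g(T\cdot,\cdot)$ are all closed. **The quotient.** $\mathbb C^{d,d}$ has coordinates $(z,w)=(z_1,\dots,z_d,w_1,\dots,w_d)$. It carries the flat hypersymplectic structure with metric $g=\operatorname{Re}\sum_k(dz_kd\bar z_k-dw_kd\bar w_k)$ and symplectic forms $\omega_I=\frac1{2i}\sum_k(dz_k\wedge d\bar z_k+dw_k\wedge d\bar w_k)$, $\omega_S+i\omega_T=\sum_k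 dw_k\wedge d\bar z_k$. The torus $T^d$ acts by $(z_k,w_k)\mapsto(e^{i\theta_k}z_k,e^{i\theta_k}w_k)$. Let $e_1,\dots,e_d$ be the standard basis of $\mathbb R^d$, the Lie algebra of $T^d$. Define the linear map $\beta\colon\mathbb R^d\to\mathbb R^n$ by $\beta(e_k)=u_k$, put $\mathfrak n=\ker\beta$, and let $N$ be the kernel of the homomorphism $\exp\circ\beta\circ\exp^{-1}\colon T^d\to T^n$ induced by $\beta$; $N$ has Lie algebra $\mathfrak n$. Let $\alpha_k$ be the orthogonal projection of $e_k$ to $\mathfrak n$ and $c_j=\sum_{k=1}^d\lambda^{(j)}_k\alpha_k$. The moment maps for $N$, with values in $\mathfrak n$, are $$\mu_I(z,w)=\sum_{k=1}^d\tfrac12(|z_k|^2+|w_k|^2)\alpha_k+c_1,\qquad (\mu_S+i\mu_T)(z,w)=\sum_{k=1}^d i\bar z_kw_k\alpha_k+c_2+ic_3 ,$$ and $\mu^{-1}(0)=\mu_I^{-1}(0)\cap\mu_S^{-1}(0)\cap\mu_T^{-1}(0)$. The quotient $M=\mu^{-1}(0)/N$ may be singular. **The convex set.** Put $\lambda_k^{(c)}=\lambda_k^{(2)}+i\lambda_k^{(3)}$. For $(a,b)\in\mathbb R^n\times\mathbb C^n$ put $a_k=\langle a,u_k\rangle-\lambda_k^{(1)}$ and $b_k=\langle b,u_k\rangle-\lambda_k^{(c)}$, where $\langle\cdot,\cdot\rangle$ is the standard inner product, extended complex linearly to $b\in\mathbb C^n$. Define $$K_k=\{(a,b):a_k\geqslant|b_k|\},\qquad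 W_k=\{(a,b):a_k=|b_k|\}.$$ *)

(* Defs.v *)
(* MathComp-Analysis, over an arbitrary [R : realType]. *)
From HB Require Import structures.
From mathcomp Require Import all_boot all_order all_algebra.
From mathcomp Require Import all_classical all_reals all_analysis.
From mathcomp Require Import complex.

Set Implicit Arguments.
Unset Strict Implicit.
Unset Printing Implicit Defensive.

Import Order.TTheory GRing.Theory Num.Theory.
Import numFieldNormedType.Exports.

Local Open Scope classical_set_scope.
Local Open Scope ring_scope.
Local Open Scope complex_scope.

(** * Smooth maps, charts and atlases *)

(* Only meant for an open set [A]; in finite dimension, differentiability plus
   [C^k] directional derivatives is the usual [C^(k+1)]. *)
Fixpoint Ck_on (R : realType) (V W : normedModType R) (k : nat) (A : set V)
    (f : V -> W) : Prop :=
  if k is k'.+1 then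
    (forall x, A x -> differentiable f x) /\
    (forall v, Ck_on k' A (fun x => 'D_v f x))
  else forall x, A x -> {for x, continuous f}.

Definition smooth_on (R : realType) (V W : normedModType R) (A : set V)
  (f : V -> W) : Prop := forall k, Ck_on k A f.

(* [chart_map] and [chart_inv] are total functions; their values outside
   [chart_dom] and [chart_cod] are irrelevant. *)
Record chart (R : realType) (X : topologicalType) (m : nat) := Chart {
  chart_dom : set X;
  chart_cod : set 'cV[R]_m;
  chart_map :> X -> 'cV[R]_m;
  chart_inv : 'cV[R]_m -> X;
  chart_dom_open : open chart_dom;
  chart_cod_open : open chart_cod;
  chart_map_cod : forall x, chart_dom x -> chart_cod (chart_map x);
  chart_inv_dom : forall y, chart_cod y -> chart_dom (chart_inv y);
  chart_mapK : forall x, chart_dom x -> chart_inv (chart_map x) = x;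
  chart_invK : forall y, chart_cod y -> chart_map (chart_inv y) = y;
  chart_map_continuous : forall x, chart_dom x -> {for x, continuous chart_map};
  chart_inv_continuous : forall y, chart_cod y -> {for y, continuous chart_inv}
}.

Section Transition.
Variables (R : realType) (X : topologicalType) (m : nat).
Implicit Types c : chart R X m.

Definition transition_dom c c' : set 'cV[R]_m :=
  [set y | chart_cod c y /\ chart_dom c' (chart_inv c y)].

Definition transition c c' (y : 'cV[R]_m) : 'cV[R]_m := c' (chart_inv c y).

End Transition.

Definition manifold_topology (X : topologicalType) : Prop :=
  hausdorff_space X /\ @second_countable X.

Record atlas (R : realType) (X : topologicalType) (m : nat) := Atlas {
  atlas_index : Type;
  atlas_chart :> atlas_index -> chart R X m;
  atlas_cover : forall x, exists j, chart_dom (atlas_chart j) x;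
  atlas_smooth : forall i j,
    smooth_on (transition_dom (atlas_chart i) (atlas_chart j))
              (transition (atlas_chart i) (atlas_chart j))
}.

(** * Hypersymplectic structures *)

Definition bform (R : realType) (m : nat) (G : 'M[R]_m) (v w : 'cV[R]_m) : R :=
  (v^T *m G *m w) 0 0.

(* [bform (two_form G J) v w = bform G (J *m v) w], i.e. [g(J., .)]. *)
Definition two_form (R : realType) (m : nat) (G J : 'M[R]_m) : 'M[R]_m :=
  J^T *m G.

Definition signature (R : realType) (p q : nat) (G : 'M[R]_(p + q)) : Prop :=
  exists2 P : 'M[R]_(p + q), P \in unitmx &
    P^T *m G *m P = block_mx 1%:M 0 0 (- 1%:M).

(* On constant vector fields, the exterior derivative of a two-form is the
   cyclic sum of directional derivatives. *)
Definition closed_two_form (R : realType) (m : nat) (A : set 'cV[R]_m)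
    (omega : 'cV[R]_m -> 'M[R]_m) : Prop :=
  forall y, A y -> forall v1 v2 v3 : 'cV[R]_m,
    'D_v1 (fun x => bform (omega x) v2 v3) y
    + 'D_v2 (fun x => bform (omega x) v3 v1) y
    + 'D_v3 (fun x => bform (omega x) v1 v2) y = 0.

(* A (0,2)-tensor field and an endomorphism field are given by their matrices
   in every chart of the atlas, subject to the tensor transformation law. *)
Section TensorFields.
Variables (R : realType) (X : topologicalType) (m : nat) (A : atlas R X m).

Definition field := atlas_index A -> 'cV[R]_m -> 'M[R]_m.

Definition smooth_field (F : field) : Prop :=
  forall j, smooth_on (chart_cod (A j)) (F j).

Definition bilinear_field (G : field) : Prop :=
  forall i j y, transition_dom (A i) (A j) y -> forall v w,
    bform (G i y) v w =
    bform (G j (transition (A i) (A j) y))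
      ('D_v (transition (A i) (A j)) y) ('D_w (transition (A i) (A j)) y).

Definition endomorphism_field (J : field) : Prop :=
  forall i j y, transition_dom (A i) (A j) y -> forall v,
    'D_(J i y *m v) (transition (A i) (A j)) y =
    J j (transition (A i) (A j) y) *m 'D_v (transition (A i) (A j)) y.

End TensorFields.

Record hypersymplectic (R : realType) (X : topologicalType) (n : nat)
    (A : atlas R X (2 * n + 2 * n)) := Hypersymplectic {
  hs_g : field A;
  hs_I : field A;
  hs_S : field A;
  hs_T : field A;
  hs_g_smooth : smooth_field hs_g;
  hs_I_smooth : smooth_field hs_I;
  hs_S_smooth : smooth_field hs_S;
  hs_T_smooth : smooth_field hs_T;
  hs_g_tensor : bilinear_field hs_g;
  hs_I_tensor : endomorphism_field hs_I;
  hs_S_tensor : endomorphism_field hs_S;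
  hs_T_tensor : endomorphism_field hs_T;
  hs_pointwise : forall j y, chart_cod (A j) y ->
    let g := hs_g j y in let I := hs_I j y in
    let S := hs_S j y in let T := hs_T j y in
    [/\ g^T = g /\ signature g,
        [/\ I *m I = - 1%:M, S *m S = 1%:M & T *m T = 1%:M],
        I *m S = T /\ T = - (S *m I) &
        [/\ forall v w, bform g (I *m v) (I *m w) = bform g v w,
            forall v w, bform g (S *m v) (S *m w) = - bform g v w &
            forall v w, bform g (T *m v) (T *m w) = - bform g v w]];
  hs_closed : forall j,
    [/\ closed_two_form (chart_cod (A j))
          (fun y => two_form (hs_g j y) (hs_I j y)),
        closed_two_form (chart_cod (A j))
          (fun y => two_form (hs_g j y) (hs_S j y)) &
        closed_two_form (chart_cod (A j))
          (fun y => two_form (hs_g j y) (hs_T j y))]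
}.

(** * The flat space [C^(d,d)] *)

(* Row [k] of [p : flat R d] is [(Re z_k, Im z_k, Re w_k, Im w_k)]; real
   coordinates are used because [R[i]] is not a normed module over [R]. *)
Notation flat R d := 'M[R]_(d, 4).

Section Flat.
Variables (R : realType) (d : nat).
Implicit Types (p q v w : flat R d) (k : 'I_d).

Definition zcoord p k : R[i] := p k 0 +i* p k 1.
Definition wcoord p k : R[i] := p k 2%:R +i* p k 3%:R.

Definition flat_point (z w : 'I_d -> R[i]) : flat R d :=
  \matrix_(k < d, j < 4)
    [:: complex.Re (z k); complex.Im (z k); complex.Re (w k); complex.Im (w k)]`_j.

Definition flat_g v w : R :=
  complex.Re (\sum_k (zcoord v k * (zcoord w k)^* - wcoord v k * (wcoord w k)^*)).

(* Convention: [(a /\ b)(v, w) = a v * b w - a w * b v]. *)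
Definition wedge2 (a b : flat R d -> R[i]) v w : R[i] := a v * b w - a w * b v.

Definition dz k v : R[i] := zcoord v k.
Definition dzbar k v : R[i] := (zcoord v k)^*.
Definition dw k v : R[i] := wcoord v k.
Definition dwbar k v : R[i] := (wcoord v k)^*.

Definition flat_omegaI v w : R[i] :=
  (2%:R * 'i)^-1 *
  \sum_k (wedge2 (dz k) (dzbar k) v w + wedge2 (dw k) (dwbar k) v w).

Definition flat_omegaST v w : R[i] := \sum_k wedge2 (dw k) (dzbar k) v w.

Definition torus_exp (m : nat) (theta : 'rV[R]_m) : 'rV[R[i]]_m :=
  \row_k (cos (theta 0 k) +i* sin (theta 0 k)).

Definition torus_act (t : 'rV[R[i]]_d) p : flat R d :=
  flat_point (fun k => t 0 k * zcoord p k) (fun k => t 0 k * wcoord p k).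

Definition fundamental_field (xi : 'rV[R]_d) p : flat R d :=
  flat_point (fun k => 'i * (xi 0 k)%:C * zcoord p k)
             (fun k => 'i * (xi 0 k)%:C * wcoord p k).

End Flat.

(** * The group [N], its moment map, and the convex set [K] *)

Section Quotient.
Variables (R : realType) (d n : nat) (u : 'I_d -> 'rV[int]_n).
Variables (lam1 lam2 lam3 : 'I_d -> R).

(* [beta] acts on row vectors, so row [k] of its matrix is [u_k]. *)
Definition beta_mx : 'M[R]_(d, n) := \matrix_(k, j) (u k 0 j)%:~R.
Definition beta (t : 'rV[R]_d) : 'rV[R]_n := t *m beta_mx.

Definition spanning : Prop := row_full beta_mx.

(* The row space of [kermx beta_mx] is [ker beta]. *)
Definition lie_n : 'M[R]_d := kermx beta_mx.

Definition group_N : set 'rV[R[i]]_d :=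
  [set t | exists2 theta : 'rV[R]_d,
     t = torus_exp theta & torus_exp (beta theta) = const_mx 1].

(* Orthogonal complement of the row space of [V]; [proj_mx V W] is the projection
   onto [V] along [W]. *)
Definition orthogonal_mx (V : 'M[R]_d) : 'M[R]_d := kermx V^T.

Definition alpha (k : 'I_d) : 'rV[R]_d :=
  delta_mx 0 k *m proj_mx lie_n (orthogonal_mx lie_n).

Definition constant_c (lam : 'I_d -> R) : 'rV[R]_d := \sum_k lam k *: alpha k.

Definition cplx (m : nat) (v : 'rV[R]_m) : 'rV[R[i]]_m :=
  map_mx (real_complex R) v.

Definition mu_I (p : flat R d) : 'rV[R]_d :=
  \sum_k (2%:R^-1 * (Normc.normc (zcoord p k) ^+ 2
                     + Normc.normc (wcoord p k) ^+ 2)) *: alpha k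
  + constant_c lam1.

Definition mu_ST (p : flat R d) : 'rV[R[i]]_d :=
  \sum_k ('i * (zcoord p k)^* * wcoord p k) *: cplx (alpha k)
  + cplx (constant_c lam2) + 'i *: cplx (constant_c lam3).

Definition mu_zero : set (flat R d) := [set p | mu_I p = 0 /\ mu_ST p = 0].

Definition coord_a (x : 'rV[R]_n * 'rV[R[i]]_n) (k : 'I_d) : R :=
  \sum_j x.1 0 j * (u k 0 j)%:~R - lam1 k.

Definition coord_b (x : 'rV[R]_n * 'rV[R[i]]_n) (k : 'I_d) : R[i] :=
  \sum_j x.2 0 j * (u k 0 j)%:~R - (lam2 k +i* lam3 k).

Definition cone_K (k : 'I_d) : set ('rV[R]_n * 'rV[R[i]]_n) :=
  [set x | Normc.normc (coord_b x k) <= coord_a x k].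

Definition wall_W (k : 'I_d) : set ('rV[R]_n * 'rV[R[i]]_n) :=
  [set x | coord_a x k = Normc.normc (coord_b x k)].

Definition convex_K : set ('rV[R]_n * 'rV[R[i]]_n) := \bigcap_k cone_K k.

Definition CInt : set ('rV[R]_n * 'rV[R[i]]_n) :=
  convex_K `\` \bigcup_k wall_W k.

Definition same_orbit (p q : mu_zero) : bool :=
  `[< exists2 t, group_N t & set_val q = torus_act t (set_val p) >].

Lemma torus_expD m (a b : 'rV[R]_m) k :
  torus_exp (a + b) 0 k = torus_exp a 0 k * torus_exp b 0 k.
Proof.
rewrite !mxE cosD sinD; apply/eqP; rewrite eq_complex /=.
by rewrite eqxx /= addrC eqxx.
Qed.

Lemma torus_exp0 m : torus_exp (0 : 'rV[R]_m) = const_mx 1.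
Proof. by apply/rowP => k; rewrite !mxE cos0 sin0. Qed.

Lemma torus_actE t (p : flat R d) k :
  zcoord (torus_act t p) k = t 0 k * zcoord p k /\
  wcoord (torus_act t p) k = t 0 k * wcoord p k.
Proof. by rewrite /zcoord /wcoord !mxE /=; split; case: (_ * _). Qed.

Lemma flat_point_coord (p : flat R d) :
  flat_point (zcoord p) (wcoord p) = p.
Proof.
apply/matrixP => k j; rewrite !mxE.
by case: j => -[|[|[|[|//]]]] Hj /=; congr (p k _); apply/val_inj.
Qed.

Lemma torus_act1 (p : flat R d) : torus_act (const_mx 1) p = p.
Proof.
rewrite /torus_act -[RHS]flat_point_coord; congr flat_point;
  by apply: funext => k; rewrite mxE mul1r.
Qed.

Lemma torus_actM a b (p : flat R d) :
  torus_act (torus_exp a) (torus_act (torus_exp b) p) =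
  torus_act (torus_exp (a + b)) p.
Proof.
rewrite {1 3}/torus_act; congr flat_point; apply: funext => k;
  by have [hz hw] := torus_actE (torus_exp b) p k;
     rewrite ?hz ?hw torus_expD mulrA.
Qed.

Lemma same_orbit_refl : reflexive same_orbit.
Proof.
move=> p; apply/asboolP; exists (torus_exp 0).
  by exists 0; rewrite // /beta mul0mx torus_exp0.
by rewrite torus_exp0 torus_act1.
Qed.

Lemma same_orbit_swap p q : same_orbit p q -> same_orbit q p.
Proof.
move=> /asboolP[_ [a -> ha] e]; apply/asboolP; exists (torus_exp (- a)).
  exists (- a) => //; rewrite {1}/beta mulNmx -/(beta a); apply/rowP => k.
  have := torus_expD (- beta a) (beta a) k.
  by rewrite addNr torus_exp0 ha [const_mx 1 0 k]mxE mulr1 => ->; rewrite mxE.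
by rewrite e torus_actM addNr torus_exp0 torus_act1.
Qed.

Lemma same_orbit_sym : symmetric same_orbit.
Proof. by move=> p q; apply/idP/idP; exact: same_orbit_swap. Qed.

Lemma same_orbit_trans : transitive same_orbit.
Proof.
move=> q p r /asboolP[_ [a -> ha] e] /asboolP[_ [b -> hb] e'].
apply/asboolP; exists (torus_exp (b + a)); last by rewrite e' e torus_actM.
exists (b + a) => //; rewrite /beta mulmxDl -/(beta a) -/(beta b).
by apply/rowP => k; rewrite torus_expD ha hb mxE mulr1.
Qed.

Definition orbit_equiv : equiv_rel mu_zero :=
  EquivRel same_orbit same_orbit_refl same_orbit_sym same_orbit_trans.

(* [mu_zero] carries the subspace topology and [hs_quotient] the quotient
   topology. *)
Definition hs_quotient := quotient_topology {eq_quot orbit_equiv}%qT.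
HB.instance Definition _ := Topological.on hs_quotient.

Definition quotient_pi (p : mu_zero) : hs_quotient :=
  (\pi_({eq_quot orbit_equiv}%qT) p)%qT.

(** * Structures on open subsets of the quotient *)

Section OnSubset.
Variable U : set hs_quotient.

(* [p] lies in the zero set of the moment map, over the point [x] of [U]. *)
Definition lies_over (p : flat R d) (x : U) : Prop :=
  exists2 q : mu_zero, set_val q = p & quotient_pi q = set_val x.

Variables (m : nat) (c : chart R U m).

(* [s] is a smooth local section, over the open set [O] of coordinates, of the
   projection of the zero set of the moment map onto the quotient. *)
Definition local_section (O : set 'cV[R]_m) (s : 'cV[R]_m -> flat R d) : Prop :=
  [/\ open O, O `<=` chart_cod c, smooth_on O s &
      forall y, O y -> lies_over (s y) (chart_inv c y)].

(* The chart belongs to the differentiable structure of the orbit space: the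
   coordinates, as functions on the zero set of the moment map, extend locally
   to smooth functions on the ambient space, and the projection has smooth
   local sections. *)
Definition quotient_chart : Prop :=
  (forall p x, lies_over p x -> chart_dom c x ->
     exists O : set (flat R d), exists F : flat R d -> 'cV[R]_m,
       [/\ open O, O p, smooth_on O F &
           forall p' x', O p' -> lies_over p' x' -> chart_dom c x' ->
             F p' = c x']) /\
  (forall y, chart_cod c y -> exists O s, O y /\ local_section O s).

End OnSubset.

(* The flat metric is non-degenerate on the tangent space of the [N]-orbit of
   [p], and the action is locally free there. *)
Definition nondegenerate_orbit (p : flat R d) : Prop :=
  forall xi : 'rV[R]_d, beta xi = 0 ->
    (forall eta : 'rV[R]_d, beta eta = 0 ->
       flat_g (fundamental_field xi p) (fundamental_field eta p) = 0) ->
    xi = 0.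

(* The structure is the one induced from the flat structure, at all points where
   hypersymplectic reduction applies: its two-forms pull back to the
   restrictions of the flat ones.  These forms determine [g], [I], [S], [T]. *)
Definition induced_structure (U : set hs_quotient)
    (A : atlas R U (2 * n + 2 * n)) (H : hypersymplectic A) : Prop :=
  forall j O s, local_section (A j) O s ->
  forall y, O y -> nondegenerate_orbit (s y) -> forall v w,
    let ds v := 'D_v s y in
    (bform (two_form (hs_g H j y) (hs_I H j y)) v w)%:C
      = flat_omegaI (ds v) (ds w) /\
    bform (two_form (hs_g H j y) (hs_S H j y)) v w
      +i* bform (two_form (hs_g H j y) (hs_T H j y)) v w
      = flat_omegaST (ds v) (ds w).

End Quotient.

(* Main.v *)
Require Import Defs.
From mathcomp Require Import all_boot all_order all_algebra.
From mathcomp Require Import all_classical all_reals all_analysis.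
Local Open Scope classical_set_scope.
From mathcomp Require Import complex ring lra.

Set Implicit Arguments.
Unset Strict Implicit.
Unset Printing Implicit Defensive.
Import Order.TTheory GRing.Theory Num.Theory.
Import numFieldNormedType.Exports.

(** Over the combinatorial interior of [K] the quotient is a bundle of tori, and
    the reduced structure is there a split-signature analogue of the
    Gibbons-Hawking metric that can be written down and checked by hand.

    A point of flat space has invariants [a_k = (|z_k|^2 + |w_k|^2) / 2] and
    [b_k + i c_k = i conj(z_k) w_k], and [a_k^2 - b_k^2 - c_k^2] is the square of
    half of [|z_k|^2 - |w_k|^2].  The moment map vanishes exactly when these
    invariants are the affine functions of the statement, evaluated at a point
    [(a, b, c)] of [K] ([mu_zeroP]).  Over the combinatorial interior
    [|z_k|] and [|w_k|] differ for every [k]; a point is then determined by the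
    signs [eps_k] of [|z_k|^2 - |w_k|^2], by [(a, b, c)], and by the arguments of
    the longer coordinates, which dividing by [N] reduces to their image [tau]
    under [beta], modulo [2 pi].  So [(a, b, c, tau)] are coordinates, and two
    systems of them differ by a translation ([toric_sec_inj],
    [transition_near]).

    Put [f_k = sqrt (a_k^2 - b_k^2 - c_k^2)], [V_k = eps_k / (2 f_k)] and
    [Q_k = V_k / (a_k + f_k)].  With [V = sum_k V_k u_k^T u_k],
    [A = sum_k Q_k (c_k db_k - b_k dc_k) u_k] and [Theta = dtau + A] the metric
    is [V (da^2 - db^2 - dc^2) + V^-1 Theta^2].  The algebraic identities of a
    hypersymplectic frame hold for any invertible symmetric [V] and any [A];
    closedness is linear in [(V, A)] and amounts to the monopole equations of
    the single faces ([closed_I], [bogomolny]).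

    The metric makes sense only where [V] is invertible, and [V] is invertible
    wherever the flat metric is non-degenerate along the orbit
    ([nondegenerate_orbit_nondeg]).  As the [V_k] have different signs, [V] can
    be singular on an open set; there the constant data [V = 1], [A = 0] give a
    flat structure, and nothing is to be compared.  The boundary of the set where
    [V] is singular is discarded, which leaves a set that is open, and dense in
    the part of the quotient over the combinatorial interior.  That part is
    dense in the whole quotient because a segment from a point of the convex set
    [K] to an interior point lifts, from any prescribed point above its origin,
    to the zero set of the moment map ([lift_segment]).

    For the comparison with the flat structure, the identity that a local
    section followed by the coordinates is the identity is differentiated
    ([section_derive]); on vectors tangent to the zero set of the moment map,
    the flat two-forms are the sums over [k] of the Gibbons-Hawking forms of
    [C^(1,1)] ([flat_gibbons_hawking], [reduced_forms]). *)

(** * Smooth functions *)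

Section SmoothCalculus.
Local Open Scope ring_scope.
Variable R : realType.

Lemma near_eq_continuous (V W : topologicalType) (f g : V -> W) x :
  {near x, f =1 g} -> {for x, continuous f} -> {for x, continuous g}.
Proof.
move=> fg cf; have e := nbhs_singleton fg.
move=> P Pg; apply: filterS2 (fg) (cf P _); first by move=> y /= <-.
by rewrite /= e.
Qed.

Lemma near_eq_differentiable (V W : normedModType R) (f g : V -> W) x :
  {near x, f =1 g} -> differentiable f x -> differentiable g x.
Proof.
move=> fg df; have e := nbhs_singleton fg.
have [cdf ef] := (diff_locallyP x f).1 df.
have eg : g \o shift x = cst (g x) + 'd f x +o_ (0 : V) id.
  apply/eqaddoP => _/posnumP[eps].
  have /eqaddoP/(_ _ [gt0 of eps%:num]) := ef.
  have : \forall y \near (0 : V), f (y + x) = g (y + x).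
    have := fg; rewrite (near_shift (0 : V)) /=.
    by apply: filterS => y /=; rewrite subr0.
  apply: filterS2 => y eq.
  by rewrite /= !fctE /= /shift /= eq e.
apply/diff_locallyP; have -> : 'd g x = 'd f x :> (V -> W) by apply: diff_unique.
by split.
Qed.

Section General.
Variables V W : normedModType R.
Implicit Types (A B : set V) (f g : V -> W).

Lemma Ck_subset k A B f : B `<=` A -> Ck_on k A f -> Ck_on k B f.
Proof.
elim: k f => [|k IH] f BA /=; first by move=> cf x /BA /cf.
by move=> [df cf]; split=> [x /BA /df //|v]; apply: IH.
Qed.

Lemma CkW k A f : Ck_on k.+1 A f -> Ck_on k A f.
Proof.
elim: k f => [|k IH] f /= [df cf].
  by move=> x /df; exact: differentiable_continuous.
by split=> // v; apply: IH; apply: cf.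
Qed.

Lemma Ck_ext k A f g : open A -> {in A, f =1 g} -> Ck_on k A f -> Ck_on k A g.
Proof.
move=> oA; elim: k f g => [|k IH] f g fg.
  move=> cf x Ax; apply: (near_eq_continuous _ (cf x Ax)).
  by apply: filterS (open_nbhs_nbhs (conj oA Ax)) => y Ay; apply/fg/mem_set.
have nfg x : A x -> \near x, f x = g x.
  move=> Ax.
  by apply: filterS (open_nbhs_nbhs (conj oA Ax)) => y Ay; apply/fg/mem_set.
move=> [df cf]; split=> [x Ax|v].
  exact: near_eq_differentiable (nfg x Ax) (df x Ax).
apply: (IH (fun x => 'D_v f x)); last exact: cf.
move=> x /set_mem Ax.
exact: near_eq_derive (nfg x Ax).
Qed.

Lemma Ck_local k A f :
  (forall x, A x -> exists2 B, B x & Ck_on k B f) -> Ck_on k A f.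
Proof.
elim: k f => [|k IH] f H; first by move=> x /H[B Bx]; exact.
split=> [x /H[B Bx [df _]]|v]; first exact: df.
by apply: IH => x /H[B Bx [_ cf]]; exists B => //; exact: cf.
Qed.

Lemma Ck_cst k A (w : W) : Ck_on k A (fun=> w).
Proof.
elim: k w => [|k IH] w; first by move=> x _; exact: (@cst_continuous V W w x).
split=> [x _|v]; first exact: differentiable_cst.
rewrite [X in Ck_on _ _ X](_ : _ = fun=> 0); first exact: IH.
by apply/funext => x; rewrite (derive_cst w).
Qed.

Lemma CkD k A f g : Ck_on k A f -> Ck_on k A g -> open A ->
  Ck_on k A (fun x => f x + g x).
Proof.
move=> + + oA; elim: k f g => [|k IH] f g.
  by move=> cf cg x Ax; apply: continuousD; [apply: cf|apply: cg].
move=> [df cf] [dg cg]; split=> [x Ax|v].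
  by apply: differentiableD; [apply: df|apply: dg].
apply: (@Ck_ext _ _ (fun x => 'D_v f x + 'D_v g x)) => //; last exact: (IH _ _ (cf v) (cg v)).
move=> x /set_mem Ax; rewrite -deriveD //; apply: diff_derivable.
  exact: df.
exact: dg.
Qed.

Lemma Ck_sum k A (I : Type) (r : seq I) (F : I -> V -> W) : open A ->
  (forall i, Ck_on k A (F i)) -> Ck_on k A (fun x => \sum_(i <- r) F i x).
Proof.
move=> oA cF; elim: r => [|i r IH].
  by under eq_fun do rewrite big_nil; apply: Ck_cst.
by under eq_fun do rewrite big_cons; apply: CkD.
Qed.

Lemma Ck_affine k A f (L : V -> W) :
  (forall x, differentiable f x) -> (forall x v, 'D_v f x = L v) ->
  Ck_on k A f.
Proof.
move=> df Df; case: k => [|k].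
  by move=> x _; apply: differentiable_continuous.
split=> [x _|v]; first exact: df.
rewrite [X in Ck_on _ _ X](_ : _ = fun=> L v); first exact: Ck_cst.
exact/funext.
Qed.

Lemma CkZl k A (h : V -> R) (w : W) : Ck_on k A h -> open A ->
  Ck_on k A (fun x => h x *: w).
Proof.
move=> + oA; elim: k h => [|k IH] h.
  by move=> ch x Ax; apply: (@continuousZl _ _ _ h w x (ch x Ax)).
move=> [dh ch]; split=> [x Ax|v].
  by apply: differentiableZl; apply: dh.
apply: (@Ck_ext _ _ (fun x => 'D_v h x *: w)) => //; last exact: (IH _ (ch v)).
move=> x /set_mem Ax; rewrite !deriveE ?diffZl //; try exact: dh.
by apply: differentiableZl; apply: dh.
Qed.

End General.

Section Scalar.
Variables (V : normedModType R) (A : set V).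
Hypothesis oA : open A.
Implicit Types f g : V -> R.

Lemma CkM k f g : Ck_on k A f -> Ck_on k A g -> Ck_on k A (fun x => f x * g x).
Proof.
elim: k f g => [|k IH] f g.
  by move=> cf cg x Ax; apply: continuousM; [apply: cf|apply: cg].
move=> Cf Cg; have [df cf] := Cf; have [dg cg] := Cg.
split=> [x Ax|v].
  by apply: differentiableM; [apply: df|apply: dg].
apply: (@Ck_ext _ _ _ _ (fun x => f x * 'D_v g x + g x * 'D_v f x)) => //.
  move=> x /set_mem Ax; rewrite -deriveM //; apply: diff_derivable.
    exact: df.
  exact: dg.
by apply: CkD => //; apply: IH; [exact: CkW|exact: cg|exact: CkW|exact: cf].
Qed.

Lemma derive_comp1 (f : V -> R) (g : R -> R) dg x v :
  differentiable f x -> is_derive (f x) 1 g dg ->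
  'D_v (fun y => g (f y)) x = dg * 'D_v f x.
Proof.
move=> df [Dg Eg].
have dgx : differentiable g (f x) by apply/derivable1_diffP.
rewrite deriveE; last exact: (differentiable_comp df dgx).
have -> : 'd (fun y => g (f y)) x v = 'd g (f x) ('d f x v).
  by rewrite (@diff_comp _ _ _ _ f g x).
have -> : 'd g (f x) = (fun h => h *: (derive1 g (f x))) :> (R -> R).
  exact: diff1E.
by rewrite derive1E Eg deriveE // mulrC.
Qed.

Lemma differentiable_comp1 (f : V -> R) (g : R -> R) x dg :
  differentiable f x -> is_derive (f x) 1 g dg ->
  differentiable (fun y => g (f y)) x.
Proof.
move=> df [Dg _]; apply: (@differentiable_comp _ _ _ _ f g) => //.
exact/derivable1_diffP.
Qed.

(** The derivative of [g] along [f] is only asked to be one order less smooth: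
    this is what lets induction on the order close for each elementary function. *)
Lemma Ck_comp1 k (f dg : V -> R) (g : R -> R) :
  (forall x, A x -> is_derive (f x) 1 g (dg x)) ->
  Ck_on k.+1 A f -> Ck_on k A dg -> Ck_on k.+1 A (fun x => g (f x)).
Proof.
move=> Dg [df cf] cdg; split=> [x Ax|v].
  exact: differentiable_comp1 (df x Ax) (Dg x Ax).
apply: (@Ck_ext _ _ _ _ (fun x => dg x * 'D_v f x)) => //; last first.
  by apply: CkM => //; exact: cf.
by move=> x /set_mem Ax; rewrite (derive_comp1 _ (df x Ax) (Dg x Ax)).
Qed.

Lemma Ck_comp0 (f dg : V -> R) (g : R -> R) :
  (forall x, A x -> is_derive (f x) 1 g (dg x)) ->
  Ck_on 0 A f -> Ck_on 0 A (fun x => g (f x)).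
Proof.
move=> Dg cf x Ax; apply: (continuous_comp (cf x Ax)).
have [d _] := Dg x Ax.
by apply: differentiable_continuous; apply/derivable1_diffP.
Qed.

Lemma CkN k f : Ck_on k A f -> Ck_on k A (fun x => - f x).
Proof.
move=> cf; under eq_fun do rewrite -mulN1r.
by apply: CkM => //; apply: Ck_cst.
Qed.

Lemma CkV k f : (forall x, A x -> f x != 0) -> Ck_on k A f ->
  Ck_on k A (fun x => (f x)^-1).
Proof.
move=> nz.
pose dg x := - ((f x)^-1 * (f x)^-1).
have D x : A x -> is_derive (f x) 1 (@GRing.inv R) (dg x).
  move=> Ax; apply: DeriveDef.
    exact: (@derivableV _ _ (fun t : R => t) (f x) 1 (nz x Ax)).
  rewrite (@deriveV _ _ (fun t : R => t) (f x) 1 (nz x Ax)) // derive_id.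
  by rewrite /dg -expr2 exprVn /GRing.scale /= mulr1.
elim: k => [|k IH] cf; first exact: Ck_comp0 D cf.
apply: (Ck_comp1 D) => //; apply: CkN; apply: CkM; apply: IH; exact: CkW.
Qed.

Lemma Ck_sqrt k f : (forall x, A x -> 0 < f x) -> Ck_on k A f ->
  Ck_on k A (fun x => Num.sqrt (f x)).
Proof.
move=> pos.
have D x : A x -> is_derive (f x) 1 Num.sqrt (2 * Num.sqrt (f x))^-1.
  by move=> /pos; exact: is_derive1_sqrt.
elim: k => [|k IH] cf; first exact: Ck_comp0 D cf.
apply: (Ck_comp1 D) => //; apply: CkV.
  by move=> x /pos fx; rewrite mulf_neq0 // gt_eqF // sqrtr_gt0.
by apply: CkM; [apply: Ck_cst|apply: IH; exact: CkW].
Qed.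

Lemma Ck_sincos k f : Ck_on k A f ->
  Ck_on k A (fun x => sin (f x)) /\ Ck_on k A (fun x => cos (f x)).
Proof.
have Ds x : A x -> is_derive (f x) 1 (@sin R) (cos (f x)).
  by move=> _; exact: is_derive_sin.
have mom_dc x : A x -> is_derive (f x) 1 (@cos R) (- sin (f x)).
  by move=> _; exact: is_derive_cos.
elim: k => [|k IH] cf.
  by split; [exact: Ck_comp0 Ds cf|exact: Ck_comp0 mom_dc cf].
have [cs cc] := IH (CkW cf).
by split; [apply: (Ck_comp1 Ds)|apply: (Ck_comp1 mom_dc) => //; exact: CkN].
Qed.

Lemma Ck_atan k f : Ck_on k A f -> Ck_on k A (fun x => atan (f x)).
Proof.
have D x : A x -> is_derive (f x) 1 (@atan R) (1 + f x * f x)^-1.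
  move=> _; rewrite -expr2; exact: is_derive1_atan.
elim: k => [|k IH] cf; first exact: Ck_comp0 D cf.
apply: (Ck_comp1 D) => //; apply: CkV.
  by move=> x _; rewrite gt_eqF // -expr2 ltr_pwDl // sqr_ge0.
by apply: CkD => //; [apply: Ck_cst|apply: CkM; exact: CkW].
Qed.

End Scalar.

Section Matrices.
Variables V : normedModType R.
Variables (m n : nat).

Lemma Ck_mx k (A : set V) (F : V -> 'M[R]_(m, n)) : open A ->
  (forall i j, Ck_on k A (fun x => F x i j)) -> Ck_on k A F.
Proof.
move=> oA cF.
rewrite (_ : F = fun x => \sum_i \sum_j F x i j *: delta_mx i j); last first.
  by apply/funext => x; exact: matrix_sum_delta.
by do 2![apply: Ck_sum => // ?]; apply: CkZl.
Qed.

Lemma derive_coord (F : V -> 'M[R]_(m, n)) x v i j : differentiable F x ->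
  'D_v (fun x => F x i j) x = ('D_v F x) i j.
Proof. by move=> dF; rewrite derive_mx ?mxE //; exact: diff_derivable. Qed.

Lemma Ck_coord k (A : set V) (F : V -> 'M[R]_(m, n)) i j : open A ->
  Ck_on k A F -> Ck_on k A (fun x => F x i j).
Proof.
move=> oA; elim: k F => [|k IH] F.
  move=> cF x Ax; apply: (@continuous_comp _ _ _ F (fun X : 'M[R]_(m, n) => X i j)).
    exact: cF.
  exact: coord_continuous.
move=> [dF cF]; split=> [x Ax|v].
  apply: (@differentiable_comp _ _ _ _ F (fun X : 'M[R]_(m, n) => X i j)).
    exact: dF.
  exact: differentiable_coord.
apply: (@Ck_ext _ _ _ _ (fun x => ('D_v F x) i j)) => //; last exact: (IH _ (cF v)).
by move=> x /set_mem Ax; rewrite derive_coord //; exact: dF.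
Qed.

End Matrices.

Lemma Ck_entry k m n (A : set 'M[R]_(m, n)) i j : Ck_on k A (fun x => x i j).
Proof.
apply: (@Ck_affine 'M[R]_(m, n) R _ _ _ (fun v => v i j)) => [x|x v].
  exact: differentiable_coord.
by rewrite (@derive_coord _ m n (fun x => x)) // derive_id.
Qed.

End SmoothCalculus.

Section MatrixCalculus.
Local Open Scope ring_scope.
Variables (R : realType) (U : normedModType R) (A : set U).
Hypothesis oA : open A.

Lemma Ck_mulmx l m n q (F : U -> 'M[R]_(m, n)) (G : U -> 'M[R]_(n, q)) :
  Ck_on l A F -> Ck_on l A G -> Ck_on l A (fun x => F x *m G x).
Proof.
move=> cF cG; apply: Ck_mx => // i j; under eq_fun do rewrite mxE.
by apply: Ck_sum => // k; apply: CkM => //; apply: Ck_coord.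
Qed.

Lemma Ck_trmx l m n (F : U -> 'M[R]_(m, n)) :
  Ck_on l A F -> Ck_on l A (fun x => (F x)^T).
Proof.
move=> cF; apply: Ck_mx => // i j; under eq_fun do rewrite mxE.
exact: Ck_coord.
Qed.

Lemma Ck_oppmx l m n (F : U -> 'M[R]_(m, n)) :
  Ck_on l A F -> Ck_on l A (fun x => - F x).
Proof.
move=> cF; apply: Ck_mx => // i j; under eq_fun do rewrite mxE.
by apply: CkN => //; apply: Ck_coord.
Qed.

Lemma Ck_prod l (I : Type) (r : seq I) (F : I -> U -> R) :
  (forall i, Ck_on l A (F i)) -> Ck_on l A (fun x => \prod_(i <- r) F i x).
Proof.
move=> cF; elim: r => [|i r IH].
  by under eq_fun do rewrite big_nil; apply: Ck_cst.
by under eq_fun do rewrite big_cons; apply: CkM.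
Qed.

Lemma Ck_det l n (F : U -> 'M[R]_n) :
  Ck_on l A F -> Ck_on l A (fun x => \det (F x)).
Proof.
move=> cF; rewrite /determinant; apply: Ck_sum => // s.
apply: CkM => //; first exact: Ck_cst.
by apply: Ck_prod => i; apply: Ck_coord.
Qed.

Lemma Ck_invmx l n (F : U -> 'M[R]_n) : (forall x, A x -> \det (F x) != 0) ->
  Ck_on l A F -> Ck_on l A (fun x => invmx (F x)).
Proof.
move=> nz cF.
apply: (@Ck_ext _ _ _ l A (fun x => (\det (F x))^-1 *: \adj (F x))) => //.
  by move=> x /set_mem /nz nx; rewrite /invmx unitmxE unitfE nx.
apply: Ck_mx => // i j; under eq_fun do rewrite mxE [in X in _ * X]mxE /cofactor.
apply: CkM => //; first by apply: CkV => //; exact: Ck_det.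
apply: CkM => //; first exact: Ck_cst.
apply: Ck_det; apply: Ck_mx => // i' j'; under eq_fun do rewrite !mxE.
exact: Ck_coord.
Qed.

Lemma Ck_diag l n (F : 'I_n -> U -> R) : (forall i, Ck_on l A (F i)) ->
  Ck_on l A (fun x => diag_mx (\row_i F i x)).
Proof.
move=> cF; apply: Ck_mx => // i j; under eq_fun do rewrite !mxE.
case: (i == j); first by under eq_fun do rewrite mulr1n; apply: cF.
by under eq_fun do rewrite mulr0n; apply: Ck_cst.
Qed.

End MatrixCalculus.

Section CosPeriod.
Local Open Scope ring_scope.
Variable R : realType.

Lemma cos_sin_int (x : R) (z : int) :
  cos (x + z%:~R * (2 * pi)) = cos x /\ sin (x + z%:~R * (2 * pi)) = sin x.
Proof.
have nat_case (t : R) (k : nat) :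
    cos (t + k%:R * (2 * pi)) = cos t /\ sin (t + k%:R * (2 * pi)) = sin t.
  elim: k => [|k [IHc IHs]]; first by rewrite mul0r addr0.
  have -> : t + k.+1%:R * (2 * pi) = t + k%:R * (2 * pi) + pi *+ 2.
    by rewrite -(natr1 k) -[pi *+ 2]mulr_natl; ring.
  move: IHc IHs; set T := t + _ => IHc IHs.
  by rewrite cosD sinD cos2pi sin2pi IHc IHs; split; ring.
case: z => k; first exact: nat_case.
rewrite NegzE mulrNz mulNr.
have [<- <-] := nat_case (x - k.+1%:~R * (2 * pi)) k.+1.
by rewrite -pmulrn subrK.
Qed.

Lemma cos_eq1 (x : R) : cos x = 1 -> exists z : int, x = z%:~R * (2 * pi).
Proof.
move=> cx; have p0 : 0 < 2 * pi :> R by rewrite mulr_gt0 // pi_gt0.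
pose z := Num.floor (x / (2 * pi)); exists z.
have [cz _] := cos_sin_int (x - z%:~R * (2 * pi)) z.
rewrite subrK cx in cz.
have := floor_itv (x / (2 * pi)); rewrite -/z.
rewrite ler_pdivlMr // ltr_pdivrMr // intrD (mulrDl z%:~R) mul1r => /andP[lo hi].
set r := x - _ in cz; have r0 : 0 <= r by rewrite subr_ge0.
have r2 : r < 2 * pi by rewrite ltrBlDl.
suff re0 : r = 0 by move/eqP: re0; rewrite subr_eq0 => /eqP.
have [rp|rp] := leP r pi.
  by rewrite -[r]cosK ?in_itv /= ?r0 // -cz acos1.
have s_itv : 2 * pi - r \in `[0, pi].
  by rewrite in_itv /=; apply/andP; split; [rewrite subr_ge0 ltW|move: rp; lra].
have : cos (2 * pi - r) = 1.
  by rewrite mulr_natl cosB cos2pi sin2pi mul1r mul0r addr0.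
move=> h; have := cosK s_itv; rewrite h acos1 => /eqP.
by rewrite eq_sym subr_eq0 => /eqP e; move: r2; rewrite e ltxx.
Qed.

End CosPeriod.

Section DeriveRules.
Local Open Scope ring_scope.
Variables (R : realType) (V : normedModType R) (y v : V).
Implicit Types (f g : V -> R) (df dg : R).

Lemma isD_cst (c : R) : is_derive y v (fun=> c) 0.
Proof. exact: is_derive_cst. Qed.

Lemma isD_add f g df dg : is_derive y v f df -> is_derive y v g dg ->
  is_derive y v (fun x => f x + g x) (df + dg).
Proof. by move=> hf hg; exact: is_deriveD. Qed.

Lemma isD_opp f df : is_derive y v f df -> is_derive y v (fun x => - f x) (- df).
Proof. by move=> hf; exact: is_deriveN. Qed.

Lemma isD_mul f g df dg : is_derive y v f df -> is_derive y v g dg ->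
  is_derive y v (fun x => f x * g x) (f y * dg + g y * df).
Proof. by move=> hf hg; exact: is_deriveM. Qed.

Lemma isD_comp f df (h : R -> R) dh : differentiable f y -> is_derive y v f df ->
  is_derive (f y) 1 h dh -> is_derive y v (fun x => h (f x)) (dh * df).
Proof.
move=> Df [_ <-] Dh; apply: DeriveDef.
  by apply: diff_derivable; exact: differentiable_comp1 Df Dh.
exact: derive_comp1.
Qed.

Lemma isD_inv f df : differentiable f y -> is_derive y v f df -> f y != 0 ->
  is_derive y v (fun x => (f x)^-1) (- (f y) ^- 2 * df).
Proof.
move=> Df hf nz; apply: isD_comp => //; apply: DeriveDef.
  exact: (@derivableV _ _ (fun t : R => t) (f y) 1 nz).
rewrite (@deriveV _ _ (fun t : R => t) (f y) 1 nz) // derive_id.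
by rewrite /GRing.scale /= mulr1.
Qed.

Lemma isD_sum (I : Type) (r : seq I) (F : I -> V -> R) (dF : I -> R) :
  (forall i, is_derive y v (F i) (dF i)) ->
  is_derive y v (fun x => \sum_(i <- r) F i x) (\sum_(i <- r) dF i).
Proof.
move=> h; elim: r => [|i r IH].
  rewrite big_nil (_ : (fun x => _) = fun=> 0); first exact: isD_cst.
  by apply/funext => x; rewrite big_nil.
rewrite big_cons (_ : (fun x => _) = fun x => F i x + \sum_(j <- r) F j x).
  exact: isD_add.
by apply/funext => x; rewrite big_cons.
Qed.

End DeriveRules.

(** * The algebra of hypersymplectic frames *)

Section Frame.
Local Open Scope ring_scope.
Variables (R : realType) (n m : nat) (e : n + n + (n + n) = m).

Definition pr_a : 'M[R]_(n, m) :=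
  castmx (erefl n, e) (row_mx (row_mx 1%:M 0) (row_mx 0 0)).
Definition pr_b : 'M[R]_(n, m) :=
  castmx (erefl n, e) (row_mx (row_mx 0 1%:M) (row_mx 0 0)).
Definition pr_c : 'M[R]_(n, m) :=
  castmx (erefl n, e) (row_mx (row_mx 0 0) (row_mx 1%:M 0)).
Definition pr_t : 'M[R]_(n, m) :=
  castmx (erefl n, e) (row_mx (row_mx 0 0) (row_mx 0 1%:M)).

Ltac split_blocks :=
  rewrite /pr_a /pr_b /pr_c /pr_t; case: _ / e;
  rewrite !castmx_id ?tr_row_mx ?trmx1 ?trmx0 ?mul_row_col ?mulmx1 ?mulmx0
    ?mul0mx ?addr0 ?add0r //.

Lemma pr_aa : pr_a *m pr_a^T = 1%:M. Proof. split_blocks. Qed.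
Lemma pr_ab : pr_a *m pr_b^T = 0. Proof. split_blocks. Qed.
Lemma pr_ac : pr_a *m pr_c^T = 0. Proof. split_blocks. Qed.
Lemma pr_at : pr_a *m pr_t^T = 0. Proof. split_blocks. Qed.
Lemma pr_ba : pr_b *m pr_a^T = 0. Proof. split_blocks. Qed.
Lemma pr_bb : pr_b *m pr_b^T = 1%:M. Proof. split_blocks. Qed.
Lemma pr_bc : pr_b *m pr_c^T = 0. Proof. split_blocks. Qed.
Lemma pr_bt : pr_b *m pr_t^T = 0. Proof. split_blocks. Qed.
Lemma pr_ca : pr_c *m pr_a^T = 0. Proof. split_blocks. Qed.
Lemma pr_cb : pr_c *m pr_b^T = 0. Proof. split_blocks. Qed.
Lemma pr_cc : pr_c *m pr_c^T = 1%:M. Proof. split_blocks. Qed.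
Lemma pr_ct : pr_c *m pr_t^T = 0. Proof. split_blocks. Qed.
Lemma pr_ta : pr_t *m pr_a^T = 0. Proof. split_blocks. Qed.
Lemma pr_tb : pr_t *m pr_b^T = 0. Proof. split_blocks. Qed.
Lemma pr_tc : pr_t *m pr_c^T = 0. Proof. split_blocks. Qed.
Lemma pr_tt : pr_t *m pr_t^T = 1%:M. Proof. split_blocks. Qed.

Definition prE := (pr_aa, pr_ab, pr_ac, pr_at, pr_ba, pr_bb, pr_bc, pr_bt,
  pr_ca, pr_cb, pr_cc, pr_ct, pr_ta, pr_tb, pr_tc, pr_tt).

Lemma pr_sum : pr_a^T *m pr_a + pr_b^T *m pr_b + pr_c^T *m pr_c
  + pr_t^T *m pr_t = 1%:M.
Proof.
rewrite /pr_a /pr_b /pr_c /pr_t; case: _ / e; rewrite !castmx_id.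
rewrite !tr_row_mx !trmx1 !trmx0 !mul_col_row !mulmx1 !mulmx0.
by rewrite !add_block_mx !addr0 !add0r -!scalar_mx_block block_mx0 -scalar_mx_block.
Qed.

Definition glue_coords (a b c t : 'cV[R]_n) : 'cV[R]_m :=
  pr_a^T *m a + pr_b^T *m b + pr_c^T *m c + pr_t^T *m t.

Lemma glue_coordsE a b c t : [/\ pr_a *m glue_coords a b c t = a, pr_b *m glue_coords a b c t
    = b,
  pr_c *m glue_coords a b c t = c & pr_t *m glue_coords a b c t = t].
Proof.
by rewrite /glue_coords !mulmxDr !mulmxA !prE !mul1mx !mul0mx !addr0 ?add0r.
Qed.

Variables (V W A1 A2 : 'M[R]_n).

(** Locked, so that rewriting with distributivity treats it as one term. *)
Definition connection : 'M[R]_(n, m) := locked (pr_t + A1 *m pr_b + A2 *m pr_c).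

Lemma connectionE : connection = pr_t + A1 *m pr_b + A2 *m pr_c.
Proof. by rewrite /connection -lock. Qed.

(** The dual frame: the tangent vector whose components in the coframe
    [(pr_a, pr_b, pr_c, connection)] are prescribed. *)
Definition assemble q (xa xb xc xt : 'M[R]_(n, q)) : 'M[R]_(m, q) :=
  pr_a^T *m xa + (pr_b^T - pr_t^T *m A1) *m xb + (pr_c^T - pr_t^T *m A2) *m xc
  + pr_t^T *m xt.

Lemma pr_assemble q (xa xb xc xt : 'M[R]_(n, q)) :
  [/\ pr_a *m assemble xa xb xc xt = xa, pr_b *m assemble xa xb xc xt = xb,
      pr_c *m assemble xa xb xc xt = xc & connection *m assemble xa xb xc xt = xt].
Proof.
have tt : pr_t *m assemble xa xb xc xt = xt - A1 *m xb - A2 *m xc.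
  rewrite /assemble !mulmxDr !mulmxDl !mulmxDr !mulNmx !mulmxN !mulmxA !prE.
  by rewrite !mul0mx !mul1mx !add0r addrC addrA.
have [ha hb hc] : [/\ pr_a *m assemble xa xb xc xt = xa,
    pr_b *m assemble xa xb xc xt = xb & pr_c *m assemble xa xb xc xt = xc].
  rewrite /assemble; split; rewrite !mulmxDr !mulmxDl !mulmxDr !mulNmx !mulmxN
    !mulmxA !prE !mul0mx !mul1mx !oppr0 !addr0 ?add0r //.
split=> //; rewrite connectionE !mulmxDl -!mulmxA tt hb hc.
by rewrite addrAC !subrK.
Qed.

(** With [Theta] for [connection], [g = V (da^2 - db^2 - dc^2) + W Theta^2],
    where [W] will be the inverse of [V]; [I], [S], [T] permute the coframe
    [(da, db, dc, W Theta)] up to sign as multiplication by the split quaternion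
    units does. *)
Definition hsG : 'M[R]_m := pr_a^T *m V *m pr_a - pr_b^T *m V *m pr_b
  - pr_c^T *m V *m pr_c + connection^T *m W *m connection.
Definition hsI : 'M[R]_m := assemble (W *m connection) (- pr_c) pr_b (- (V *m pr_a)).
Definition hsS : 'M[R]_m := assemble pr_c (- (W *m connection)) pr_a (- (V *m pr_b)).
Definition hsT : 'M[R]_m :=
  assemble (- pr_b) (- pr_a) (- (W *m connection)) (- (V *m pr_c)).

Lemma coframe_ext q (X Y : 'M[R]_(m, q)) : pr_a *m X = pr_a *m Y ->
  pr_b *m X = pr_b *m Y -> pr_c *m X = pr_c *m Y -> connection *m X = connection *m Y -> X = Y.
Proof.
move=> ha hb hc; rewrite connectionE !mulmxDl -!mulmxA hb hc => /addIr /addIr ht.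
rewrite -[X]mul1mx -[Y]mul1mx -pr_sum !mulmxDl -!mulmxA.
by rewrite ha hb hc ht.
Qed.

Lemma pr_hsI : [/\ pr_a *m hsI = W *m connection, pr_b *m hsI = - pr_c,
  pr_c *m hsI = pr_b & connection *m hsI = - (V *m pr_a)].
Proof. exact: pr_assemble. Qed.

Lemma pr_hsS : [/\ pr_a *m hsS = pr_c, pr_b *m hsS = - (W *m connection),
  pr_c *m hsS = pr_a & connection *m hsS = - (V *m pr_b)].
Proof. exact: pr_assemble. Qed.

Lemma pr_hsT : [/\ pr_a *m hsT = - pr_b, pr_b *m hsT = - pr_a,
  pr_c *m hsT = - (W *m connection) & connection *m hsT = - (V *m pr_c)].
Proof. exact: pr_assemble. Qed.

Let JE := (let: And4 a b c d := pr_hsI in (a, b, c, d),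
  let: And4 a b c d := pr_hsS in (a, b, c, d),
  let: And4 a b c d := pr_hsT in (a, b, c, d)).

Hypotheses (VW : V *m W = 1%:M) (WV : W *m V = 1%:M).

Ltac by_coords :=
  apply: coframe_ext; rewrite ?mulmxN ?mulmxA ?JE ?mulNmx -?mulmxA ?JE
    ?mulmxN ?mulmxA ?VW ?WV ?mul1mx ?mulmx1 ?opprK //.

Lemma hsII : hsI *m hsI = - 1%:M. Proof. by by_coords. Qed.
Lemma hsSS : hsS *m hsS = 1%:M. Proof. by by_coords. Qed.
Lemma hsTT : hsT *m hsT = 1%:M. Proof. by by_coords. Qed.
Lemma hsIS : hsI *m hsS = hsT. Proof. by by_coords. Qed.
Lemma hsSI : hsT = - (hsS *m hsI). Proof. by by_coords. Qed.

Hypothesis (VT : V^T = V).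

Lemma inv_sym : W^T = W.
Proof.
have h : W^T *m V = 1%:M by rewrite -[in LHS]VT -trmx_mul VW trmx1.
by rewrite -[LHS]mulmx1 -VW mulmxA h mul1mx.
Qed.

Let trD q r (X Y : 'M[R]_(q, r)) : (X + Y)^T = X^T + Y^T.
Proof. exact: linearD. Qed.
Let trN q r (X : 'M[R]_(q, r)) : (- X)^T = - X^T.
Proof. exact: linearN. Qed.
Let trmxZ q r (x : R) (X : 'M[R]_(q, r)) : (x *: X)^T = x *: X^T.
Proof. exact: linearZ. Qed.
Let tr_cong q (X : 'M[R]_n) (Y Z : 'M[R]_(n, q)) :
  (Y^T *m X *m Z)^T = Z^T *m X^T *m Y.
Proof. by rewrite !trmx_mul trmxK mulmxA. Qed.

Lemma hsG_sym : hsG^T = hsG.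
Proof. by rewrite /hsG !trD !trN !tr_cong VT inv_sym. Qed.

Lemma tr_mulG q (X : 'M[R]_(m, q)) : X^T *m hsG =
  (pr_a *m X)^T *m V *m pr_a - (pr_b *m X)^T *m V *m pr_b
  - (pr_c *m X)^T *m V *m pr_c + (connection *m X)^T *m W *m connection.
Proof. by rewrite /hsG !trmx_mul !mulmxDr !mulmxN !mulmxA. Qed.

Lemma formI : two_form hsG hsI = connection^T *m pr_a - pr_a^T *m connection
  + (pr_c^T *m V *m pr_b - pr_b^T *m V *m pr_c).
Proof.
rewrite /two_form tr_mulG !JE !trN !trmx_mul inv_sym VT !mulNmx.
rewrite -[_ *m W *m V]mulmxA WV mulmx1 -[_ *m V *m W]mulmxA VW mulmx1 opprK.
by rewrite addrAC [LHS](ACl ((1*3)*(2*4)))%AC.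
Qed.

Lemma formS : two_form hsG hsS = connection^T *m pr_b - pr_b^T *m connection
  + (pr_c^T *m V *m pr_a - pr_a^T *m V *m pr_c).
Proof.
rewrite /two_form tr_mulG !JE !trN !trmx_mul inv_sym VT !mulNmx.
rewrite -[_ *m W *m V]mulmxA WV mulmx1 -[_ *m V *m W]mulmxA VW mulmx1 opprK.
by rewrite [LHS](ACl ((2*4)*(1*3)))%AC.
Qed.

Lemma formT : two_form hsG hsT = connection^T *m pr_c - pr_c^T *m connection
  + (pr_a^T *m V *m pr_b - pr_b^T *m V *m pr_a).
Proof.
rewrite /two_form tr_mulG !JE !trN !trmx_mul inv_sym VT !mulNmx.
rewrite -[_ *m W *m V]mulmxA WV mulmx1 -[_ *m V *m W]mulmxA VW mulmx1 !opprK.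
by rewrite [LHS](ACl ((3*4)*(2*1)))%AC.
Qed.

Let bform_cong J (s : R) : J^T *m hsG *m J = s *: hsG ->
  forall v w, bform hsG (J *m v) (J *m w) = s * bform hsG v w.
Proof.
move=> h v w; rewrite /bform trmx_mul !mulmxA -[_ *m J^T *m hsG]mulmxA.
by rewrite -[_ *m (J^T *m hsG) *m J]mulmxA h -scalemxAr -scalemxAl mxE.
Qed.

Let VWK q (X : 'M[R]_(n, q)) : V *m (W *m X) = X.
Proof. by rewrite mulmxA VW mul1mx. Qed.
Let WVK q (X : 'M[R]_(n, q)) : W *m (V *m X) = X.
Proof. by rewrite mulmxA WV mul1mx. Qed.

Lemma bform_hsI v w : bform hsG (hsI *m v) (hsI *m w) = bform hsG v w.
Proof.
rewrite (@bform_cong hsI 1) ?mul1r // tr_mulG !JE !trN !trmx_mul inv_sym VT.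
rewrite !mulmxDl !mulNmx -!mulmxA !JE !mulmxN !opprK ?VWK ?WVK.
by rewrite scale1r /hsG -!mulmxA [LHS](ACl (4*3*2*1))%AC.
Qed.

Lemma bform_hsS v w : bform hsG (hsS *m v) (hsS *m w) = - bform hsG v w.
Proof.
rewrite (@bform_cong hsS (-1)) ?mulN1r // tr_mulG !JE !trN !trmx_mul inv_sym VT.
rewrite !mulmxDl !mulNmx -!mulmxA !JE !mulmxN !opprK ?VWK ?WVK.
by rewrite scaleN1r /hsG -!mulmxA !opprD !opprK [LHS](ACl (3*4*1*2))%AC.
Qed.

Lemma bform_hsT v w : bform hsG (hsT *m v) (hsT *m w) = - bform hsG v w.
Proof.
rewrite (@bform_cong hsT (-1)) ?mulN1r // tr_mulG !JE !trN !trmx_mul inv_sym VT.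
rewrite !mulmxDl !mulNmx -!mulmxA !JE !mulmxN !opprK ?VWK ?WVK.
by rewrite scaleN1r /hsG -!mulmxA !opprD !opprK [LHS](ACl (2*1*4*3))%AC.
Qed.

Let pu (X Y : 'M[R]_(n, m)) := 2^-1 *: ((X + Y) + W *m (X - Y)).
Let pv (X Y : 'M[R]_(n, m)) := 2^-1 *: ((X + Y) - W *m (X - Y)).

(** [V] minus a copy of itself is a neutral form, whatever the signature of [V]:
    [(pu, pv)] is a change of variables to the standard one. *)
Let neutral X Y : (pu X Y)^T *m V *m pu X Y - (pv X Y)^T *m V *m pv X Y
  = X^T *m X - Y^T *m Y.
Proof.
rewrite /pu /pv; set s := X + Y; set t := W *m (X - Y).
have st : s^T *m V *m t + t^T *m V *m s = 2 *: (X^T *m X - Y^T *m Y).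
  rewrite /t trmx_mul inv_sym -!mulmxA (mulmxA V W) (mulmxA W V) VW WV !mul1mx.
  rewrite /s !trD !trN !mulmxDl !mulmxDr !mulmxN !mulNmx scaler_nat mulr2n.
  by apply/matrixP => i j; move: (X^T *m X) (X^T *m Y) (Y^T *m X) (Y^T *m Y) => a b c d;
      rewrite !mxE; ring.
have -> : X^T *m X - Y^T *m Y = 2^-1 *: (s^T *m V *m t + t^T *m V *m s).
  by rewrite st scalerA mulVf ?scale1r // pnatr_eq0.
have sq (Z : 'M[R]_(n, m)) : (2^-1 *: Z)^T *m V *m (2^-1 *: Z)
    = 2^-1 *: (2^-1 *: (Z^T *m V *m Z)).
  by rewrite trmxZ -!scalemxAl -scalemxAr.
rewrite !sq !trD !trN !mulmxDl !mulmxDr !mulNmx !mulmxN ?opprD ?opprK.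
move: (s^T *m V *m s) (s^T *m V *m t) (t^T *m V *m s) (t^T *m V *m t) => a b c d.
by apply/matrixP => i j; rewrite !mxE; field.
Qed.

Definition sigP : 'M[R]_m :=
  assemble (pu pr_a pr_c) (- pv pr_a pr_c) (- pv pr_b pr_t) (V *m pu pr_b pr_t).

Lemma sigP_cong : sigP^T *m hsG *m sigP =
  pr_a^T *m pr_a + pr_b^T *m pr_b - (pr_c^T *m pr_c + pr_t^T *m pr_t).
Proof.
rewrite tr_mulG !mulmxDl !mulNmx -![_ *m _ *m sigP]mulmxA.
have [-> -> -> ->] : [/\ pr_a *m sigP = pu pr_a pr_c,
    pr_b *m sigP = - pv pr_a pr_c, pr_c *m sigP = - pv pr_b pr_t
  & connection *m sigP = V *m pu pr_b pr_t] by exact: pr_assemble.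
move: (neutral pr_a pr_c) (neutral pr_b pr_t).
move: (pu pr_a pr_c) (pv pr_a pr_c) (pu pr_b pr_t) (pv pr_b pr_t) => x y x' y'.
rewrite !trN trmx_mul VT !mulNmx !mulmxN !opprK => e1 e2.
rewrite -[_ *m V *m W]mulmxA VW mulmx1 !mulmxA e1 -addrA.
by rewrite [X in _ + X]addrC e2 opprD addrACA.
Qed.

End Frame.

Section Signature.
Local Open Scope ring_scope.

(** Stated for [p = n + n] up to a proof, in order to cover [2 * n + 2 * n]. *)
Lemma hsG_signature (R : realType) (n p : nat) (ep : (n + n)%N = p)
    (e : (n + n + (n + n))%N = (p + p)%N) (V W A1 A2 : 'M[R]_n) :
  V *m W = 1%:M -> W *m V = 1%:M -> V^T = V ->
  signature (hsG e V W A1 A2).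
Proof.
move=> VW WV VT.
have h := sigP_cong e A1 A2 VW WV VT.
have eJ : (pr_a R e)^T *m pr_a R e + (pr_b R e)^T *m pr_b R e
  - ((pr_c R e)^T *m pr_c R e + (pr_t R e)^T *m pr_t R e)
  = block_mx 1%:M 0 0 (- 1%:M).
  case: _ / ep e {h} => e; rewrite /pr_a /pr_b /pr_c /pr_t (eq_irrelevance e erefl).
  rewrite !castmx_id !tr_row_mx !trmx1 !trmx0 !mul_col_row !mulmx1 !mulmx0.
  rewrite !add_block_mx !addr0 !add0r -!scalar_mx_block opp_block_mx add_block_mx.
  by rewrite block_mx0 !oppr0 !addr0 !add0r.
rewrite {}eJ in h; exists (sigP e V W A1 A2) => //.
have JJ : block_mx 1%:M 0 0 (- 1%:M) *m block_mx 1%:M 0 0 (- 1%:M)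
  = 1%:M :> 'M[R]_(p + p).
  rewrite mulmx_block !mulmx0 !mul0mx mulmx1 mulNmx mulmxN mulmx1 opprK.
  by rewrite !addr0 add0r -scalar_mx_block.
by move: JJ; rewrite -{2}h mulmxA => /mulmx1_unit[].
Qed.

End Signature.

(** * Invariants and polar form of a point of flat space *)

Lemma complex_sum (R : realType) (I : Type) (r : seq I) (f g : I -> R) :
  (\sum_(k <- r) (f k +i* g k)%C = ((\sum_(k <- r) f k) +i* (\sum_(k <- r) g k))%C)%R.
Proof.
elim: r => [|k r IH]; first by rewrite !big_nil.
by rewrite !big_cons IH.
Qed.

Section Points.
Local Open Scope ring_scope.
Variables (R : realType) (d : nat).
Implicit Types (p : flat R d) (k : 'I_d).

(** With [z] and [w] for the complex coordinates [zcoord p k] and [wcoord p k]: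
    [mom_a = (|z|^2 + |w|^2) / 2], [mom_b + i mom_c = i conj(z) w] and
    [mom_d = |z|^2 - |w|^2]. *)
Definition mom_a p k : R := 2^-1 * (p k 0 ^+ 2 + p k 1 ^+ 2 + p k 2%:R ^+ 2 + p k 3%:R ^+ 2).
Definition mom_b p k : R := p k 1 * p k 2%:R - p k 0 * p k 3%:R.
Definition mom_c p k : R := p k 0 * p k 2%:R + p k 1 * p k 3%:R.
Definition mom_d p k : R := p k 0 ^+ 2 + p k 1 ^+ 2 - p k 2%:R ^+ 2 - p k 3%:R ^+ 2.

Lemma mom_sqE p k : mom_a p k ^+ 2 - mom_b p k ^+ 2 - mom_c p k ^+ 2 = (2^-1 * mom_d p k) ^+ 2.
Proof. by rewrite /mom_a /mom_b /mom_c /mom_d; field. Qed.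

Lemma polar (x y : R) : exists phi,
  x = Num.sqrt (x ^+ 2 + y ^+ 2) * cos phi /\
  y = Num.sqrt (x ^+ 2 + y ^+ 2) * sin phi.
Proof.
have [e0|n0] := eqVneq (x ^+ 2 + y ^+ 2) 0.
  move/eqP: (e0); rewrite paddr_eq0 ?sqr_ge0 // !sqrf_eq0 => /andP[/eqP-> /eqP->].
  by exists 0; rewrite expr0n /= addr0 sqrtr0 !mul0r.
have p0 : 0 < x ^+ 2 + y ^+ 2.
  by rewrite lt_neqAle eq_sym n0 addr_ge0 ?sqr_ge0.
set r := Num.sqrt _; have r0 : 0 < r by rewrite sqrtr_gt0.
have r2 : r ^+ 2 = x ^+ 2 + y ^+ 2 by rewrite sqr_sqrtr // ltW.
have rn0 : r != 0 by rewrite gt_eqF.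
have xr : x / r \in `[-1, 1].
  rewrite in_itv /= ler_pdivrMr // ler_pdivlMr // mulN1r mul1r -ler_norml.
  by rewrite -(@ler_pXn2r _ 2) ?nnegrE ?(ltW r0) // real_normK ?num_real // r2 lerDl sqr_ge0.
have cE := acosK xr.
have sE : sin (acos (x / r)) = `|y| / r.
  rewrite sin_acos; last by move: xr; rewrite in_itv.
  have -> : 1 - (x / r) ^+ 2 = (`|y| / r) ^+ 2.
    rewrite !exprMn real_normK ?num_real // exprVn r2.
    by field; rewrite n0.
  by rewrite sqrtr_sqr ger0_norm // divr_ge0 // ltW.
have [y0|y0] := leP 0 y.
  exists (acos (x / r)); rewrite cE sE ger0_norm //.
  by split; rewrite mulrC divfK.
exists (- acos (x / r)); rewrite cosN sinN cE sE ltr0_norm // mulNr opprK.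
by split; rewrite mulrC divfK.
Qed.

Implicit Types (a b c th : 'I_d -> R) (eps : {ffun 'I_d -> bool}).

(** The modulus of the longer of two complex numbers with invariants [a], [b],
    [c]: their squared moduli are [a + f] and [a - f], with [f] the inner square
    root. *)
Definition long_rad (a b c : R) : R := Num.sqrt (a + Num.sqrt (a ^+ 2 - b ^+ 2 - c ^+ 2)).

(** The longer coordinate, [z_k] or [w_k] according to [eps k], has argument
    [th k]; the other one is then given by [i conj(z_k) w_k = b_k + i c_k].  At
    [a_k = 0] both vanish, since division by zero yields zero. *)
Definition polar_pt eps a b c th : flat R d := \matrix_(k < d, j < 4)
  let r := long_rad (a k) (b k) (c k) in
  (if eps k then
    [:: r * cos (th k); r * sin (th k);
        (c k * cos (th k) + b k * sin (th k)) / r;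
        (c k * sin (th k) - b k * cos (th k)) / r]
  else
    [:: (c k * cos (th k) - b k * sin (th k)) / r;
        (c k * sin (th k) + b k * cos (th k)) / r;
        r * cos (th k); r * sin (th k)])`_j.

Lemma polar_pt_entries eps a b c th k (r := long_rad (a k) (b k) (c k)) :
  [/\ polar_pt eps a b c th k 0 = if eps k then r * cos (th k)
        else (c k * cos (th k) - b k * sin (th k)) / r,
      polar_pt eps a b c th k 1 = if eps k then r * sin (th k)
        else (c k * sin (th k) + b k * cos (th k)) / r,
      polar_pt eps a b c th k 2%:R = if eps k
        then (c k * cos (th k) + b k * sin (th k)) / r else r * cos (th k) &
      polar_pt eps a b c th k 3%:R = if eps k
        then (c k * sin (th k) - b k * cos (th k)) / r else r * sin (th k)].
Proof. by rewrite !mxE /=; case: (eps k). Qed.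

Definition in_cone (a b c : R) := (0 <= a) /\ (b ^+ 2 + c ^+ 2 <= a ^+ 2).
Definition in_icone (a b c : R) := (0 < a) /\ (b ^+ 2 + c ^+ 2 < a ^+ 2).

Lemma icone_cone (a b c : R) : in_icone a b c -> in_cone a b c.
Proof. by move=> [/ltW ? /ltW ?]. Qed.

Lemma long_rad_gt0 (a b c : R) : 0 < a -> 0 < long_rad a b c.
Proof. by move=> a0; rewrite sqrtr_gt0 ltr_wpDr ?sqrtr_ge0. Qed.

Lemma long_radE (a b c : R) (f := Num.sqrt (a ^+ 2 - b ^+ 2 - c ^+ 2)) :
  in_cone a b c -> long_rad a b c ^+ 2 = a + f /\ f ^+ 2 = a ^+ 2 - b ^+ 2 - c ^+ 2.
Proof.
move=> [a0 h]; split; rewrite sqr_sqrtr //; first by rewrite addr_ge0 ?sqrtr_ge0.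
by rewrite -addrA -opprD subr_ge0.
Qed.

Lemma mom_polar_pt eps a b c th k : in_cone (a k) (b k) (c k) ->
  [/\ mom_a (polar_pt eps a b c th) k = a k, mom_b (polar_pt eps a b c th) k = b k,
      mom_c (polar_pt eps a b c th) k = c k &
      mom_d (polar_pt eps a b c th) k = (if eps k then 2 else -2)
        * Num.sqrt (a k ^+ 2 - b k ^+ 2 - c k ^+ 2)].
Proof.
move=> h; rewrite /mom_a /mom_b /mom_c /mom_d.
have [-> -> -> ->] := polar_pt_entries eps a b c th k.
have [r2 f2] := long_radE h; case: h => a0 h.
move: (cos2Dsin2 (th k)); move: (cos _) (sin _) => C S CS.
move: r2 f2; set r := long_rad _ _ _; set f := Num.sqrt _ => r2 f2.
have [k0|kn0] := eqVneq (a k) 0.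
  (* the vertex of the cone, where the two quotients are [0 / 0] *)
  have [b0 c0] : b k = 0 /\ c k = 0.
    move: h; rewrite k0 expr0n /= => h.
    have /eqP : b k ^+ 2 + c k ^+ 2 = 0.
      by apply/le_anti; rewrite h addr_ge0 ?sqr_ge0.
    by rewrite paddr_eq0 ?sqr_ge0 // !sqrf_eq0 => /andP[/eqP-> /eqP->].
  have f0 : f = 0.
    by apply/eqP; rewrite -sqrf_eq0 f2 k0 b0 c0 !expr0n /= !subr0.
  have r0 : r = 0 by apply/eqP; rewrite -sqrf_eq0 r2 k0 f0 addr0.
  by rewrite k0 b0 c0 f0 r0; case: (eps k); split; rewrite !(mul0r, mulr0, subr0, addr0,
      expr0n).
have r0 : r != 0 by rewrite gt_eqF // long_rad_gt0 // lt_neqAle eq_sym kn0.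
have q2 : (b k ^+ 2 + c k ^+ 2) / r ^+ 2 = a k - f.
  apply: (mulIf (x := r ^+ 2)); rewrite ?expf_neq0 // divfK ?expf_neq0 //.
  by rewrite r2 -subr_sqr f2; ring.
have e1 : (r * C) ^+ 2 + (r * S) ^+ 2 = a k + f by rewrite -r2 -[RHS]mulr1 -CS; ring.
case: (eps k); split.
- have -> : (r * C) ^+ 2 + (r * S) ^+ 2 + ((c k * C + b k * S) / r) ^+ 2
    + ((c k * S - b k * C) / r) ^+ 2 = (a k + f) + (b k ^+ 2 + c k ^+ 2) / r ^+ 2.
    by rewrite -e1 -[X in _ = _ + X]mulr1 -CS; field.
  by rewrite q2; field.
- rewrite -[RHS]mulr1 -CS; by field.
- rewrite -[RHS]mulr1 -CS; by field.
- have -> : (r * C) ^+ 2 + (r * S) ^+ 2 - ((c k * C + b k * S) / r) ^+ 2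
    - ((c k * S - b k * C) / r) ^+ 2 = (a k + f) - (b k ^+ 2 + c k ^+ 2) / r ^+ 2.
    by rewrite -e1 -[X in _ = _ - X]mulr1 -CS; field.
  by rewrite q2; ring.
- have -> : ((c k * C - b k * S) / r) ^+ 2 + ((c k * S + b k * C) / r) ^+ 2
    + (r * C) ^+ 2 + (r * S) ^+ 2 = (a k + f) + (b k ^+ 2 + c k ^+ 2) / r ^+ 2.
    by rewrite -e1 -[X in _ = _ + X]mulr1 -CS; field.
  by rewrite q2; field.
- rewrite -[RHS]mulr1 -CS; by field.
- rewrite -[RHS]mulr1 -CS; by field.
- have -> : ((c k * C - b k * S) / r) ^+ 2 + ((c k * S + b k * C) / r) ^+ 2
    - (r * C) ^+ 2 - (r * S) ^+ 2 = - (a k + f) + (b k ^+ 2 + c k ^+ 2) / r ^+ 2.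
    by rewrite -e1 -[X in _ = _ + X]mulr1 -CS; field.
  by rewrite q2; ring.
Qed.

Definition major_signs p : {ffun 'I_d -> bool} := [ffun k => 0 <= mom_d p k].

(** Phrased without division, so that every [th k] will do if the coordinate
    vanishes. *)
Definition major_arg eps p th := forall k,
  if eps k then p k 0 = Num.sqrt (p k 0 ^+ 2 + p k 1 ^+ 2) * cos (th k) /\
                p k 1 = Num.sqrt (p k 0 ^+ 2 + p k 1 ^+ 2) * sin (th k)
  else p k 2%:R = Num.sqrt (p k 2%:R ^+ 2 + p k 3%:R ^+ 2) * cos (th k) /\
       p k 3%:R = Num.sqrt (p k 2%:R ^+ 2 + p k 3%:R ^+ 2) * sin (th k).

Lemma major_arg_ex eps p : exists th, major_arg eps p th.
Proof.
suff /choice[th h] : forall k, exists t, if eps k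
  then p k 0 = Num.sqrt (p k 0 ^+ 2 + p k 1 ^+ 2) * cos t /\
       p k 1 = Num.sqrt (p k 0 ^+ 2 + p k 1 ^+ 2) * sin t
  else p k 2%:R = Num.sqrt (p k 2%:R ^+ 2 + p k 3%:R ^+ 2) * cos t /\
       p k 3%:R = Num.sqrt (p k 2%:R ^+ 2 + p k 3%:R ^+ 2) * sin t.
  by exists th.
by move=> k; case: (eps k); exact: polar.
Qed.

Lemma mom_cone p k : in_cone (mom_a p k) (mom_b p k) (mom_c p k).
Proof.
split; first by rewrite /mom_a mulr_ge0 ?addr_ge0 ?sqr_ge0 // invr_ge0.
by rewrite -subr_ge0 opprD addrA mom_sqE sqr_ge0.
Qed.

Lemma flat_ext (p q : flat R d) : (forall k, [/\ p k 0 = q k 0, p k 1 = q k 1,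
  p k 2%:R = q k 2%:R & p k 3%:R = q k 3%:R]) -> p = q.
Proof.
move=> h; apply/matrixP => k j; have [h0 h1 h2 h3] := h k.
case: j => -[|[|[|[|//]]]] Hj.
- by move: h0; congr (p k _ = q k _); apply/val_inj.
- by move: h1; congr (p k _ = q k _); apply/val_inj.
- by move: h2; congr (p k _ = q k _); apply/val_inj.
- by move: h3; congr (p k _ = q k _); apply/val_inj.
Qed.

Lemma polar_ptK p th : major_arg (major_signs p) p th -> polar_pt (major_signs p) (mom_a p)
    (mom_b p) (mom_c p) th = p.
Proof.
move=> h; apply: flat_ext => k; move: (h k).
have [-> -> -> ->] := polar_pt_entries (major_signs p) (mom_a p) (mom_b p) (mom_c p) th k.
rewrite /long_rad mom_sqE sqrtr_sqr normrM normfV (ger0_norm (ler0n _ 2)) ffunE.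
rewrite /mom_a /mom_b /mom_c /mom_d.
move: (p k 0) (p k 1) (p k 2%:R) (p k 3%:R) => x y s t.
case: ifP => [d0|/negbT].
  rewrite ger0_norm //.
  have -> : 2^-1 * (x ^+ 2 + y ^+ 2 + s ^+ 2 + t ^+ 2)
    + 2^-1 * (x ^+ 2 + y ^+ 2 - s ^+ 2 - t ^+ 2) = x ^+ 2 + y ^+ 2 by field.
  move=> [xE yE]; rewrite -xE -yE.
  have [r0|rn0] := eqVneq (Num.sqrt (x ^+ 2 + y ^+ 2)) 0.
    have x0 : x = 0 by rewrite xE r0 mul0r.
    have y0 : y = 0 by rewrite yE r0 mul0r.
    move: d0; rewrite r0 x0 y0 expr0n /= addr0 sub0r -opprD oppr_ge0 => d0.
    have /eqP : s ^+ 2 + t ^+ 2 = 0 by apply/le_anti; rewrite d0 addr_ge0 ?sqr_ge0.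
    rewrite paddr_eq0 ?sqr_ge0 // !sqrf_eq0 => /andP[/eqP-> /eqP->].
    by rewrite invr0 !mulr0.
  have p0 : 0 <= x ^+ 2 + y ^+ 2 by rewrite addr_ge0 ?sqr_ge0.
  have r2 : Num.sqrt (x ^+ 2 + y ^+ 2) ^+ 2 = x ^+ 2 + y ^+ 2 by rewrite sqr_sqrtr.
  move: r2 xE yE rn0; set r := Num.sqrt _ => r2 xE yE rn0.
  have cE : cos (th k) = x / r by rewrite [in RHS]xE mulrC mulKf.
  have sE : sin (th k) = y / r by rewrite [in RHS]yE mulrC mulKf.
  have nz : x ^+ 2 + y ^+ 2 != 0 by rewrite -r2 expf_neq0.
  split=> //; rewrite cE sE.
    have -> : ((x * s + y * t) * (x / r) + (y * s - x * t) * (y / r)) / r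
      = (x ^+ 2 + y ^+ 2) * s / r ^+ 2 by field.
    by rewrite r2 mulrAC divff // mul1r.
  have -> : ((x * s + y * t) * (y / r) - (y * s - x * t) * (x / r)) / r
    = (x ^+ 2 + y ^+ 2) * t / r ^+ 2 by field.
  by rewrite r2 mulrAC divff // mul1r.
rewrite -ltNge => d0; rewrite ltr0_norm //.
have -> : 2^-1 * (x ^+ 2 + y ^+ 2 + s ^+ 2 + t ^+ 2)
  + 2^-1 * - (x ^+ 2 + y ^+ 2 - s ^+ 2 - t ^+ 2) = s ^+ 2 + t ^+ 2 by field.
move=> [sE tE]; rewrite -sE -tE.
have p0 : 0 < s ^+ 2 + t ^+ 2.
  have : 0 <= x ^+ 2 + y ^+ 2 by rewrite addr_ge0 ?sqr_ge0.
  by move: d0; lra.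
have r2 : Num.sqrt (s ^+ 2 + t ^+ 2) ^+ 2 = s ^+ 2 + t ^+ 2 by rewrite sqr_sqrtr // ltW.
have rn0 : Num.sqrt (s ^+ 2 + t ^+ 2) != 0 by rewrite gt_eqF // sqrtr_gt0.
move: r2 sE tE rn0; set r := Num.sqrt _ => r2 sE tE rn0.
have cE : cos (th k) = s / r by rewrite [in RHS]sE mulrC mulKf.
have siE : sin (th k) = t / r by rewrite [in RHS]tE mulrC mulKf.
have nz : s ^+ 2 + t ^+ 2 != 0 by rewrite -r2 expf_neq0.
split=> //; rewrite cE siE.
  have -> : ((x * s + y * t) * (s / r) - (y * s - x * t) * (t / r)) / r
    = (s ^+ 2 + t ^+ 2) * x / r ^+ 2 by field.
  by rewrite r2 mulrAC divff // mul1r.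
have -> : ((x * s + y * t) * (t / r) + (y * s - x * t) * (s / r)) / r
  = (s ^+ 2 + t ^+ 2) * y / r ^+ 2 by field.
by rewrite r2 mulrAC divff // mul1r.
Qed.

Lemma torus_act_entries (th : 'rV[R]_d) p k : let q := torus_act (torus_exp th) p in
  [/\ q k 0 = cos (th 0 k) * p k 0 - sin (th 0 k) * p k 1,
      q k 1 = cos (th 0 k) * p k 1 + sin (th 0 k) * p k 0,
      q k 2%:R = cos (th 0 k) * p k 2%:R - sin (th 0 k) * p k 3%:R &
      q k 3%:R = cos (th 0 k) * p k 3%:R + sin (th 0 k) * p k 2%:R].
Proof.
by rewrite /torus_act /flat_point !mxE /=.
Qed.

Lemma torus_act_polar (phi : 'rV[R]_d) eps a b c th :
  torus_act (torus_exp phi) (polar_pt eps a b c th)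
  = polar_pt eps a b c (fun k => th k + phi 0 k).
Proof.
apply: flat_ext => k; have [-> -> -> ->] := torus_act_entries phi (polar_pt eps a b c th) k.
have [-> -> -> ->] := polar_pt_entries eps a b c (fun k => th k + phi 0 k) k.
have [-> -> -> ->] := polar_pt_entries eps a b c th k.
rewrite cosD sinD; case: (eps k); split; ring.
Qed.

Lemma mom_torus_act (phi : 'rV[R]_d) p k (q := torus_act (torus_exp phi) p) :
  [/\ mom_a q k = mom_a p k, mom_b q k = mom_b p k, mom_c q k = mom_c p k & mom_d q k = mom_d
      p k].
Proof.
rewrite /mom_a /mom_b /mom_c /mom_d; have [-> -> -> ->] := torus_act_entries phi p k.
move: (cos2Dsin2 (phi 0 k)); move: (cos _) (sin _) => C S CS.
by split; rewrite -[RHS]mulr1 -CS; ring.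
Qed.

End Points.

(** * The zero set of the moment map and its orbits *)

Section Moment.
Local Open Scope ring_scope.
Variables (R : realType) (d n : nat) (u : 'I_d -> 'rV[int]_n).
Variables (lam1 lam2 lam3 : 'I_d -> R).
Implicit Types (p : flat R d) (k : 'I_d).

Let bm := beta_mx R u.
Let Pr := proj_mx (lie_n R u) (orthogonal_mx (lie_n R u)).

Lemma orthogonal_mx_disjoint (K : 'M[R]_d) : (K :&: orthogonal_mx K = 0)%MS.
Proof.
apply/eqP; rewrite -submx0; apply/rV_subP => v; rewrite sub_capmx.
move=> /andP[/submxP[z vE] /sub_kermxP vK].
have : v *m v^T = 0 by rewrite {2}vE trmx_mul mulmxA vK mul0mx.
move=> /matrixP/(_ 0 0); rewrite !mxE => /eqP.
under eq_bigr do rewrite mxE -expr2.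
rewrite psumr_eq0 => [/allP h|i _]; last exact: sqr_ge0.
suff -> : v = 0 by exact: sub0mx.
apply/rowP => i; rewrite mxE; apply/eqP; rewrite -sqrf_eq0.
by have := h i; rewrite mem_index_enum => /(_ isT)/=.
Qed.

Lemma orthogonal_mx_full (K : 'M[R]_d) (x : 'rV[R]_d) : (x <= K + orthogonal_mx K)%MS.
Proof.
apply: submx_full; rewrite /row_full mxrank_disjoint_sum ?orthogonal_mx_disjoint //.
by rewrite mxrank_ker mxrank_tr subnKC // rank_leq_row.
Qed.

(** Both sides describe the orthogonal complement of [ker beta]. *)
Lemma proj_lie_eq0 (x : 'rV[R]_d) : x *m Pr = 0 <-> exists y : 'rV_n, x = y *m bm^T.
Proof.
have cap := orthogonal_mx_disjoint (lie_n R u).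
have eqO : (bm^T :=: orthogonal_mx (lie_n R u))%MS.
  apply/eqmxP; have le : (bm^T <= orthogonal_mx (lie_n R u))%MS.
    by apply/sub_kermxP; rewrite -trmx_mul mulmx_ker trmx0.
  rewrite -(geq_leqif (mxrank_leqif_eq le)).
  by rewrite mxrank_ker !mxrank_tr mxrank_ker subKn // rank_leq_row.
split=> [x0|[y ->]]; last first.
  by apply: proj_mx_0 => //; rewrite -eqO submxMl.
have := add_proj_mx cap (orthogonal_mx_full (lie_n R u) x).
rewrite x0 add0r => <-; apply/submxP; rewrite eqO.
exact: proj_mx_sub.
Qed.

Lemma sum_alpha (x : 'I_d -> R) :
  \sum_k x k *: alpha R u k = (\row_k x k) *m Pr.
Proof.
rewrite {1}(row_sum_delta (\row_k x k)) mulmx_suml; apply: eq_bigr => k _.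
by rewrite mxE -scalemxAl.
Qed.

Lemma normc_sq (x y : R) : Normc.normc (x +i* y)%C ^+ 2 = x ^+ 2 + y ^+ 2.
Proof. by rewrite /Normc.normc sqr_sqrtr // addr_ge0 ?sqr_ge0. Qed.

Lemma mu_IE p : mu_I u lam1 p = (\row_k (mom_a p k + lam1 k)) *m Pr.
Proof.
rewrite /mu_I /constant_c -big_split /= -sum_alpha; apply: eq_bigr => k _.
by rewrite -scalerDl !normc_sq /mom_a addrA.
Qed.

Lemma mu_STE p : mu_ST u lam2 lam3 p = \row_j
  (((\row_k (mom_b p k + lam2 k)) *m Pr) 0 j +i* ((\row_k (mom_c p k + lam3 k)) *m Pr) 0 j)%C.
Proof.
apply/rowP => j; rewrite /mu_ST -!sum_alpha /constant_c !mxE !summxE.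
have scE (x : R) (v : 'rV_d) : (x *: v) 0 j = x * v 0 j by rewrite mxE.
under eq_bigr => k _.
  rewrite (_ : _ 0 j = ((mom_b p k * alpha R u k 0 j) +i* (mom_c p k * alpha R u k 0 j))%C).
    over.
  rewrite !mxE /zcoord /wcoord /mom_b /mom_c; apply/eqP; rewrite eq_complex /=.
  by apply/andP; split; apply/eqP; ring.
rewrite complex_sum; apply/eqP; rewrite eq_complex /=; apply/andP; split; apply/eqP.
  rewrite mulr0 mul0r !subr0 addr0 -big_split /=.
  by apply: eq_bigr => k _; rewrite !scE [RHS]mulrDl.
rewrite !mul1r mul0r addr0 add0r -big_split /=.
by apply: eq_bigr => k _; rewrite !scE [RHS]mulrDl.
Qed.

(** The moment map is the projection to [ker beta] of the vectors of shifted
    invariants; it vanishes when these are values of the transpose of [beta]. *)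
Lemma mu_zeroP p : mu_zero u lam1 lam2 lam3 p <->
  exists xa xb xc : 'rV[R]_n,
    [/\ \row_k (mom_a p k + lam1 k) = xa *m bm^T,
        \row_k (mom_b p k + lam2 k) = xb *m bm^T &
        \row_k (mom_c p k + lam3 k) = xc *m bm^T].
Proof.
rewrite /mu_zero /= mu_IE mu_STE; split.
  move=> [/proj_lie_eq0[xa ea] /rowP e].
  have /proj_lie_eq0[xb eb] : (\row_k (mom_b p k + lam2 k)) *m Pr = 0.
    by apply/rowP => j; move: (e j); rewrite !mxE => -[].
  have /proj_lie_eq0[xc ec] : (\row_k (mom_c p k + lam3 k)) *m Pr = 0.
    by apply/rowP => j; move: (e j); rewrite !mxE => -[].
  by exists xa, xb, xc.
move=> [xa [xb [xc [ea eb ec]]]]; split; first by apply/proj_lie_eq0; exists xa.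
have -> : (\row_k (mom_b p k + lam2 k)) *m Pr = 0 by apply/proj_lie_eq0; exists xb.
have -> : (\row_k (mom_c p k + lam3 k)) *m Pr = 0 by apply/proj_lie_eq0; exists xc.
by apply/rowP => j; rewrite !mxE.
Qed.

Lemma mu_zero_act (th : 'rV[R]_d) p : mu_zero u lam1 lam2 lam3 p ->
  mu_zero u lam1 lam2 lam3 (torus_act (torus_exp th) p).
Proof.
move=> /mu_zeroP[xa [xb [xc [ea eb ec]]]]; apply/mu_zeroP; exists xa, xb, xc.
by rewrite -ea -eb -ec; split; apply/rowP => k; rewrite !mxE;
  have [ha hb hc _] := mom_torus_act th p k; rewrite ?ha ?hb ?hc.
Qed.

Notation MZ := (mu_zero u lam1 lam2 lam3).
Notation M := (hs_quotient u lam1 lam2 lam3).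

(** Points of the orbit space are handled through this relation, which avoids
    the choice of representatives and the subtype [mu_zero]. *)
Definition above p (X : M) := exists2 q : MZ, set_val q = p & quotient_pi q = X.

Lemma above_ex p : MZ p -> exists X, above p X.
Proof.
move=> h; pose q : MZ := exist _ p (mem_set h).
by exists (quotient_pi q), q.
Qed.

Lemma above_mu p X : above p X -> MZ p.
Proof. by move=> [q <- _]; case: q => q h; exact: set_mem h. Qed.

Lemma above_surj X : exists p, above p X.
Proof.
have [q <-] : exists q : MZ, quotient_pi q = X.
  by exists (repr X); rewrite /quotient_pi reprK.
by exists (set_val q), q.
Qed.

Lemma above_uniq p X Y : above p X -> above p Y -> X = Y.
Proof.
move=> [q <- <-] [q' e <-]; congr quotient_pi.
by apply: val_inj; exact: esym.
Qed.

Lemma quotient_pi_eq (p q : MZ) : quotient_pi p = quotient_pi q <->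
  exists2 t, group_N u t & set_val q = torus_act t (set_val p).
Proof.
rewrite /quotient_pi; split.
  by move/eqquotP; rewrite /= => /asboolP.
by move=> h; apply/eqquotP; rewrite /=; apply/asboolP.
Qed.

Lemma above_orbit p q X : above p X -> above q X ->
  exists2 th : 'rV[R]_d, torus_exp (beta u th) = const_mx 1 &
    q = torus_act (torus_exp th) p.
Proof.
move=> [p' <- <-] [q' <- e].
have /quotient_pi_eq[t [th -> h] e'] := esym e.
by exists th.
Qed.

Lemma above_act p X (th : 'rV[R]_d) : above p X ->
  torus_exp (beta u th) = const_mx 1 -> above (torus_act (torus_exp th) p) X.
Proof.
move=> oX h; have /above_ex[Y oY] := mu_zero_act th (above_mu oX).
suff <- : Y = X by [].
move: oX oY => [p' <- <-] [q' e <-]; apply/esym/quotient_pi_eq.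
by exists (torus_exp th) => //; exists th.
Qed.

End Moment.

(** * Coordinates over the combinatorial interior *)

Section Coordinates.
Local Open Scope ring_scope.
Variables (R : realType) (d n : nat) (u : 'I_d -> 'rV[int]_n).
Variables (lam1 lam2 lam3 : 'I_d -> R).
Variables (m : nat) (e : (n + n + (n + n))%N = m).
Variable B : 'M[R]_(n, d).
Hypothesis BK : B *m beta_mx R u = 1%:M.
Implicit Types (p : flat R d) (k : 'I_d) (y : 'cV[R]_m).
Implicit Types (eps : {ffun 'I_d -> bool}).

Let bm := beta_mx R u.
Notation MZ := (mu_zero u lam1 lam2 lam3).
Notation M := (hs_quotient u lam1 lam2 lam3).

(** The values [a_k], [b_k], [c_k] at the point with coordinates
    [y = (a, b, c, tau)], and angles [face_t] over [tau]. *)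
Definition face_a y k : R := (bm *m (pr_a R e *m y)) k 0 - lam1 k.
Definition face_b y k : R := (bm *m (pr_b R e *m y)) k 0 - lam2 k.
Definition face_c y k : R := (bm *m (pr_c R e *m y)) k 0 - lam3 k.
Definition face_t y k : R := (B^T *m (pr_t R e *m y)) k 0.

(** A section of the quotient map in the coordinates [(a, b, c, tau)]; since [B]
    is a right inverse of [beta], the angles [face_t] map to [tau]. *)
Definition toric_sec eps y : flat R d := polar_pt eps (face_a y) (face_b y) (face_c y)
    (face_t y).

(** The combinatorial interior of [K], times the space of all [tau]. *)
Definition interior_pts : set 'cV[R]_m :=
  [set y | forall k, in_icone (face_a y k) (face_b y k) (face_c y k)].

(** Coordinates of the orbit of [p], when [t] lists the arguments of its longer
    coordinates. *)
Definition lift_pt p (t : 'I_d -> R) : 'cV[R]_m :=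
  glue_coords e (B *m \col_k (mom_a p k + lam1 k)) (B *m \col_k (mom_b p k + lam2 k))
         (B *m \col_k (mom_c p k + lam3 k)) (bm^T *m \col_k t k).

Lemma lift_ptE p t : MZ p -> [/\ face_a (lift_pt p t) = mom_a p,
  face_b (lift_pt p t) = mom_b p, face_c (lift_pt p t) = mom_c p &
  pr_t R e *m lift_pt p t = bm^T *m \col_k t k].
Proof.
move=> /mu_zeroP[xa [xb [xc [ea eb ec]]]].
have [ha hb hc ht] := glue_coordsE e (B *m \col_k (mom_a p k + lam1 k))
  (B *m \col_k (mom_b p k + lam2 k)) (B *m \col_k (mom_c p k + lam3 k)) (bm^T *m \col_k t k).
have key (f l : 'I_d -> R) (x : 'rV[R]_n) : \row_k (f k + l k) = x *m bm^T ->
    forall k, (bm *m (B *m \col_k (f k + l k))) k 0 - l k = f k.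
  move=> E k; have -> : \col_k (f k + l k) = bm *m x^T.
    by rewrite -[RHS]trmxK trmx_mul trmxK -E; apply/colP => i; rewrite !mxE.
  rewrite (mulmxA B) BK mul1mx.
  have := congr1 (fun X : 'rV_d => X 0 k) E; rewrite mxE => E'.
  by rewrite -[bm *m x^T]trmxK trmx_mul trmxK mxE -E' addrK.
by split=> //; apply/funext => k; rewrite /face_a /face_b /face_c ?ha ?hb ?hc;
  [exact: key ea k|exact: key eb k|exact: key ec k].
Qed.

Lemma toric_sec_mu eps y : (forall k, in_cone (face_a y k) (face_b y k) (face_c y k)) -> MZ
    (toric_sec eps y).
Proof.
move=> h; apply/mu_zeroP.
exists (pr_a R e *m y)^T, (pr_b R e *m y)^T, (pr_c R e *m y)^T.
by split; apply/rowP => k; rewrite -trmx_mul mxE [RHS]mxE;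
  have [ha hb hc _] := mom_polar_pt eps (face_t y) (h k);
  rewrite /toric_sec ?ha ?hb ?hc /face_a /face_b /face_c subrK.
Qed.

Lemma toric_sec_above_polar eps y th (X : M) :
  above (polar_pt eps (face_a y) (face_b y) (face_c y) th) X ->
  pr_t R e *m y = bm^T *m \col_k th k -> above (toric_sec eps y) X.
Proof.
move=> oX et; pose phi : 'rV[R]_d := \row_k (face_t y k - th k).
have -> : toric_sec eps y = torus_act (torus_exp phi) (polar_pt eps (face_a y) (face_b y)
    (face_c y) th).
  rewrite torus_act_polar /toric_sec; congr polar_pt.
  by apply/funext => k; rewrite mxE addrC subrK.
apply: above_act oX _.
have -> : phi = (pr_t R e *m y)^T *m B - (\col_k th k)^T.
  by apply/rowP => k; rewrite mxE /face_t -[B]trmxK -trmx_mul !mxE trmxK.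
rewrite /beta mulmxBl -mulmxA BK mulmx1 et trmx_mul trmxK subrr.
exact: torus_exp0.
Qed.

Lemma toric_sec_above p (X : M) y th : above p X ->
  face_a y = mom_a p -> face_b y = mom_b p -> face_c y = mom_c p -> major_arg (major_signs p)
      p th ->
  pr_t R e *m y = bm^T *m \col_k th k -> above (toric_sec (major_signs p) y) X.
Proof.
move=> oX ea eb ec mth; apply: toric_sec_above_polar.
by rewrite ea eb ec polar_ptK.
Qed.

Lemma icone_disc_gt0 (a b c : R) : in_icone a b c -> 0 < a ^+ 2 - b ^+ 2 - c ^+ 2.
Proof. by move=> [_]; rewrite -addrA -opprD subr_gt0. Qed.

Lemma beta_mx_inj q (x y : 'M[R]_(n, q)) : bm *m x = bm *m y -> x = y.
Proof. by move=> h; rewrite -[x]mul1mx -[y]mul1mx -BK -!mulmxA h. Qed.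

Lemma torus_exp_eq1 (q : nat) (x : 'rV[R]_q) : torus_exp x = const_mx 1 ->
  exists z : 'rV[int]_q, x = map_mx intr z *m (2 * pi)%:M.
Proof.
move=> h.
suff /choice[f hf] : forall k : 'I_q, exists z : int, x 0 k = z%:~R * (2 * pi).
  exists (\row_k f k); apply/rowP => k.
  by rewrite mul_mx_scalar !mxE hf mulrC.
move=> k; apply: cos_eq1.
by have := congr1 (fun X : 'rV_q => X 0 k) h; rewrite !mxE => -[].
Qed.

Lemma beta_mx_int (z : 'rV[int]_d) : map_mx intr z *m bm =
  map_mx intr (z *m \matrix_(k, j) u k 0 j) :> 'rV[R]_n.
Proof.
rewrite map_mxM; congr (_ *m _).
by apply/matrixP => i j; rewrite !mxE.
Qed.

(** Orbits preserve the invariants, and these give [eps], [a], [b], [c].  The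
    angles of two points of an orbit differ by an element that [beta] maps to the
    period lattice, up to multiples of [2 pi]; the latter are mapped there too,
    because the [u_k] are integral. *)
Lemma toric_sec_inj eps eps' y y' (X : M) : interior_pts y -> interior_pts y' ->
  above (toric_sec eps y) X -> above (toric_sec eps' y') X ->
  [/\ eps = eps', pr_a R e *m y = pr_a R e *m y', pr_b R e *m y = pr_b R e *m y',
      pr_c R e *m y = pr_c R e *m y' &
      exists z : 'rV[int]_n,
        pr_t R e *m y' = pr_t R e *m y + (2 * pi) *: (map_mx intr z)^T].
Proof.
move=> cy cy' oy oy'; have [phi hphi E] := above_orbit oy oy'.
have inv k := mom_torus_act phi (toric_sec eps y) k.
have pk k := mom_polar_pt eps (face_t y) (icone_cone (cy k)).
have pk' k := mom_polar_pt eps' (face_t y') (icone_cone (cy' k)).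
have hk k : [/\ face_a y k = face_a y' k, face_b y k = face_b y' k, face_c y k = face_c y' k &
    eps k = eps' k].
  have [a1 a2 a3 a4] := inv k; have [b1 b2 b3 b4] := pk k.
  have [c1 c2 c3 c4] := pk' k; rewrite -E in a1 a2 a3 a4.
  have ha : face_a y k = face_a y' k by rewrite -b1 -c1 -a1.
  have hb : face_b y k = face_b y' k by rewrite -b2 -c2 -a2.
  have hc : face_c y k = face_c y' k by rewrite -b3 -c3 -a3.
  split=> //; move: a4; rewrite /toric_sec c4 b4 -ha -hb -hc.
  have f0 : Num.sqrt (face_a y k ^+ 2 - face_b y k ^+ 2 - face_c y k ^+ 2) != 0.
    by rewrite gt_eqF // sqrtr_gt0 icone_disc_gt0.
  move=> /(mulIf f0); case: (eps k); case: (eps' k) => //; lra.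
have eeps : eps = eps' by apply/ffunP => k; have [] := hk k.
have ea : face_a y = face_a y' by apply/funext => k; have [] := hk k.
have eb : face_b y = face_b y' by apply/funext => k; have [] := hk k.
have ec : face_c y = face_c y' by apply/funext => k; have [] := hk k.
have inj (P : 'M[R]_(n, m)) (l : 'I_d -> R) :
    (fun k => (bm *m (P *m y)) k 0 - l k) = (fun k => (bm *m (P *m y')) k 0 - l k) ->
    P *m y = P *m y'.
  move=> h; apply: beta_mx_inj; apply/colP => k.
  by have := congr1 (fun f => f k) h => /addIr.
split=> //; [exact: inj ea|exact: inj eb|exact: inj ec|].
have [z hz] : exists z : 'rV[int]_d,
    \row_k (face_t y' k) - \row_k face_t y k - phi = map_mx intr z *m (2 * pi)%:M.
  apply: torus_exp_eq1; apply/rowP => k; rewrite !mxE.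
  have r0 : long_rad (face_a y k) (face_b y k) (face_c y k) != 0 by rewrite gt_eqF //
      long_rad_gt0 //; case: (cy k).
  have [ec1 es1] : cos (face_t y' k) = cos (face_t y k + phi 0 k) /\
      sin (face_t y' k) = sin (face_t y k + phi 0 k).
    move: E; rewrite /toric_sec torus_act_polar -eeps -ea -eb -ec => E.
    have := congr1 (fun X : 'M[R]_(d, 4) => (X k 0, X k 1, X k 2%:R, X k 3%:R)) E.
    have [-> -> -> ->] := polar_pt_entries eps (face_a y) (face_b y) (face_c y) (face_t y') k.
    have [-> -> -> ->] := polar_pt_entries eps (face_a y) (face_b y) (face_c y) (fun k =>
        face_t y k + phi 0 k) k.
    by case: (eps k) => -[h1 h2 h3 h4]; split; apply: (mulfI r0).
  rewrite -addrA -opprD; apply/eqP; rewrite eq_complex /= cosB sinB ec1 es1.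
  by rewrite -!expr2 cos2Dsin2 mulrC subrr !eqxx.
have [z' hz'] := torus_exp_eq1 hphi.
exists (z' + z *m \matrix_(k, j) u k 0 j).
have ktE v : (\row_k face_t v k) *m bm = (pr_t R e *m v)^T.
  have -> : \row_k face_t v k = (pr_t R e *m v)^T *m B.
    by apply/rowP => k; rewrite mxE /face_t -[B]trmxK -trmx_mul !mxE trmxK.
  by rewrite -mulmxA BK mulmx1.
have : (\row_k (face_t y' k) - \row_k face_t y k - phi) *m bm =
    map_mx intr z *m (2 * pi)%:M *m bm by rewrite hz.
rewrite !mulmxBl !ktE -/(beta u phi) hz' -mulmxA -scalar_mxC mulmxA beta_mx_int => h.
apply: trmx_inj; rewrite linearD /= linearZ /= trmxK map_mxD scalerDr.
move/eqP: h; rewrite !mul_mx_scalar !subr_eq => /eqP ->.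
by rewrite addrC [X in _ = _ + X]addrC.
Qed.

End Coordinates.

(** * The Gibbons-Hawking data of the faces *)

Section Potentials.
Local Open Scope ring_scope.
Variables (R : realType) (d n : nat) (u : 'I_d -> 'rV[int]_n).
Variables (lam1 lam2 lam3 : 'I_d -> R).
Variables (m : nat) (e : (n + n + (n + n))%N = m).
Implicit Types (k : 'I_d) (y v w : 'cV[R]_m).
Implicit Types (eps : {ffun 'I_d -> bool}).

Let bm := beta_mx R u.
Notation face_a := (face_a u lam1 e).
Notation face_b := (face_b u lam2 e).
Notation face_c := (face_c u lam3 e).
Notation interior_pts := (interior_pts u lam1 lam2 lam3 e).

(** The differentials of [face_a], [face_b], [face_c], which do not depend on the
    point. *)
Definition face_da k v : R := (bm *m (pr_a R e *m v)) k 0.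
Definition face_db k v : R := (bm *m (pr_b R e *m v)) k 0.
Definition face_dc k v : R := (bm *m (pr_c R e *m v)) k 0.

Definition sign_of (b : bool) : R := if b then 1 else -1.
(** The data of the face [k]: [face_f] is half the absolute value of [mom_d] above
    the point; the potential [face_V] has a pole at the wall, and the connection
    form is [face_A (c_k db_k - b_k dc_k)]. *)
Definition face_f y k : R := Num.sqrt (face_a y k ^+ 2 - face_b y k ^+ 2 - face_c y k ^+ 2).
Definition face_V eps y k : R := sign_of (eps k) * (2 * face_f y k)^-1.
Definition face_A eps y k : R := face_V eps y k * (face_a y k + face_f y k)^-1.

(** [V = sum_k V_k u_k^T u_k], and the [db] and [dc] components of
    [A = sum_k Q_k (c_k db_k - b_k dc_k) u_k]. *)
Definition gh_V eps y : 'M[R]_n := bm^T *m diag_mx (\row_k face_V eps y k) *m bm.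
Definition gh_Ab eps y : 'M[R]_n :=
  bm^T *m diag_mx (\row_k (face_A eps y k * face_c y k)) *m bm.
Definition gh_Ac eps y : 'M[R]_n :=
  - (bm^T *m diag_mx (\row_k (face_A eps y k * face_b y k)) *m bm).

Definition nondeg eps y : bool := \det (gh_V eps y) != 0.
(** Where [V] is singular, the constant data [V = 1] and [A = 0] replace it. *)
Definition hat_V eps y : 'M[R]_n := if nondeg eps y then gh_V eps y else 1%:M.
Definition hat_W eps y : 'M[R]_n := invmx (hat_V eps y).
Definition hat_Ab eps y : 'M[R]_n := if nondeg eps y then gh_Ab eps y else 0.
Definition hat_Ac eps y : 'M[R]_n := if nondeg eps y then gh_Ac eps y else 0.

(** Points on the boundary of the set where [V] is singular are left out; around
    any other point, one of the two definitions of [hat_V] holds throughout a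
    neighbourhood. *)
Definition goodset eps : set 'cV[R]_m :=
  [set y | interior_pts y /\ (nondeg eps y \/ \forall z \near y, ~~ nondeg eps z)].

Lemma Ck_lin l (A : set 'cV[R]_m) (Q : 'M[R]_(d, m)) k (c : R) : open A ->
  Ck_on l A (fun y => (Q *m y) k 0 - c).
Proof.
move=> oA; apply: CkD => //; last exact: Ck_cst.
apply: (@Ck_coord _ _ _ _ l A (fun y => Q *m y)) => //.
apply: Ck_mulmx => //; first exact: Ck_cst.
by apply: Ck_mx => // i j; exact: Ck_entry.
Qed.

Lemma Ck_face_a l (A : set 'cV[R]_m) k : open A -> Ck_on l A (fun y => face_a y k).
Proof.
move=> oA; have := Ck_lin l (bm *m pr_a R e) k (lam1 k) oA.
by under eq_fun do rewrite -mulmxA.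
Qed.
Lemma Ck_face_b l (A : set 'cV[R]_m) k : open A -> Ck_on l A (fun y => face_b y k).
Proof.
move=> oA; have := Ck_lin l (bm *m pr_b R e) k (lam2 k) oA.
by under eq_fun do rewrite -mulmxA.
Qed.
Lemma Ck_face_c l (A : set 'cV[R]_m) k : open A -> Ck_on l A (fun y => face_c y k).
Proof.
move=> oA; have := Ck_lin l (bm *m pr_c R e) k (lam3 k) oA.
by under eq_fun do rewrite -mulmxA.
Qed.

Lemma Ck_sqr (V : normedModType R) l (A : set V) (f : V -> R) : open A ->
  Ck_on l A f -> Ck_on l A (fun x => f x ^+ 2).
Proof. by move=> oA cf; under eq_fun do rewrite expr2; apply: CkM. Qed.

Lemma Ck_disc l (A : set 'cV[R]_m) k : open A ->
  Ck_on l A (fun y => face_a y k ^+ 2 - face_b y k ^+ 2 - face_c y k ^+ 2).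
Proof.
move=> oA; have sq f := @Ck_sqr _ l _ f oA.
apply: CkD => //; [apply: CkD => //|].
- exact: sq (Ck_face_a l k oA).
- by apply: CkN => //; exact: sq (Ck_face_b l k oA).
- by apply: CkN => //; exact: sq (Ck_face_c l k oA).
Qed.

Lemma Ck0_continuous (V W : normedModType R) (f : V -> W) : Ck_on 0 setT f -> continuous f.
Proof. by move=> cf x; exact: cf. Qed.

Lemma open_interior_pts : open interior_pts.
Proof.
rewrite openE => y cy.
apply: (@filter_forall _ _ (fun k z => in_icone (face_a z k) (face_b z k) (face_c z k)) (nbhs
    y)).
move=> k; have [a0 f0] := cy k.
have ca := @Ck0_continuous _ _ _ (Ck_face_a 0 k openT) y.
have cd := @Ck0_continuous _ _ _ (Ck_disc 0 k openT) y.
have d0 : 0 < face_a y k ^+ 2 - face_b y k ^+ 2 - face_c y k ^+ 2 by exact: icone_disc_gt0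
    (cy k).
have n1 : \forall t \near y, 0 < face_a t k by exact: (cvgr_gt _ ca _ a0).
have n2 : \forall t \near y, 0 < face_a t k ^+ 2 - face_b t k ^+ 2 - face_c t k ^+ 2.
  exact: (cvgr_gt _ cd _ d0).
apply: filterS2 n1 n2 => z z1 z2; split=> //.
by rewrite -subr_gt0 opprD addrA.
Qed.

Section OnInterior.
Variables (A : set 'cV[R]_m).
Hypotheses (oA : open A) (Ac : A `<=` interior_pts).

Lemma face_f_gt0 y k : interior_pts y -> 0 < face_f y k.
Proof. by move=> cy; rewrite sqrtr_gt0; exact: icone_disc_gt0. Qed.

Lemma Ck_face_f l k : Ck_on l A (fun y => face_f y k).
Proof.
apply: Ck_sqrt => //; last exact: Ck_disc.
by move=> y /Ac cy; exact: icone_disc_gt0.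
Qed.

Lemma Ck_face_V l eps k : Ck_on l A (fun y => face_V eps y k).
Proof.
apply: CkM => //; first exact: Ck_cst.
apply: CkV => //; first by move=> y /Ac cy; rewrite mulf_neq0 // gt_eqF // face_f_gt0.
by apply: CkM => //; [exact: Ck_cst|exact: Ck_face_f].
Qed.

Lemma Ck_face_A l eps k : Ck_on l A (fun y => face_A eps y k).
Proof.
apply: CkM => //; first exact: Ck_face_V.
apply: CkV => //; last by apply: CkD => //; [exact: Ck_face_a|exact: Ck_face_f].
by move=> y /Ac cy; rewrite gt_eqF // addr_gt0 ?face_f_gt0 //; case: (cy k).
Qed.

Let Ck_sandwich l (F : 'I_d -> 'cV[R]_m -> R) : (forall k, Ck_on l A (F k)) ->
  Ck_on l A (fun y => bm^T *m diag_mx (\row_k F k y) *m bm).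
Proof.
move=> cF; apply: Ck_mulmx => //; last exact: Ck_cst.
by apply: Ck_mulmx => //; [exact: Ck_cst|exact: Ck_diag].
Qed.

Lemma Ck_gh_V l eps : Ck_on l A (gh_V eps).
Proof. by apply: Ck_sandwich => k; exact: Ck_face_V. Qed.

Lemma Ck_gh_Ab l eps : Ck_on l A (gh_Ab eps).
Proof. by apply: Ck_sandwich => k; apply: CkM => //; [exact: Ck_face_A|exact: Ck_face_c]. Qed.

Lemma Ck_gh_Ac l eps : Ck_on l A (gh_Ac eps).
Proof.
apply: Ck_oppmx => //.
by apply: Ck_sandwich => k; apply: CkM => //; [exact: Ck_face_A|exact: Ck_face_b].
Qed.

End OnInterior.

Definition goodset1 eps : set 'cV[R]_m := [set y | interior_pts y /\ nondeg eps y].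

Lemma open_goodset1 eps : open (goodset1 eps).
Proof.
rewrite openE => y [cy ny].
have cd : {for y, continuous (fun y => \det (gh_V eps y))}.
  by apply: (@Ck_det _ _ _ open_interior_pts 0 _ _ (Ck_gh_V open_interior_pts (@subset_refl _
      _) 0 eps)).
have n1 : \forall z \near y, \det (gh_V eps z) != 0.
  exact: cvgr_neq0 cd ny.
by apply: filterS2 (open_nbhs_nbhs (conj open_interior_pts cy)) n1.
Qed.

Lemma open_goodset eps : open (goodset eps).
Proof.
rewrite openE => y [cy [ny|ny]].
  have := open_nbhs_nbhs (conj (@open_goodset1 eps) (conj cy ny)).
  by apply: filterS => z [cz nz]; split=> //; left.
have ny' := nbhs_interior ny.
by apply: filterS2 (open_nbhs_nbhs (conj open_interior_pts cy)) ny' => z cz nz; split=> //;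
    right.
Qed.

Let Ck_hat l q (eps : {ffun 'I_d -> bool}) (X : 'M[R]_q) (F G : 'cV[R]_m -> 'M[R]_q) :
  (forall y, nondeg eps y -> G y = F y) -> (forall y, ~~ nondeg eps y -> G y = X) ->
  Ck_on l (goodset1 eps) F -> Ck_on l (goodset eps) G.
Proof.
move=> GF GX cF; apply: Ck_local => y [cy [ny|ny]].
  exists (goodset1 eps) => //; apply: (@Ck_ext _ _ _ l _ F G (@open_goodset1 eps)) => //.
  by move=> z /set_mem[_ nz]; rewrite GF.
exists (interior [set z | ~~ nondeg eps z]) => //.
apply: (@Ck_ext _ _ _ l _ (fun=> X)); [exact: open_interior| |exact: Ck_cst].
by move=> z /set_mem /interior_subset /= nz; rewrite GX.
Qed.

Let gc eps : goodset1 eps `<=` interior_pts. Proof. by move=> y []. Qed.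

Lemma Ck_hat_V l eps : Ck_on l (goodset eps) (hat_V eps).
Proof.
apply: (@Ck_hat l _ eps 1%:M (gh_V eps)); last exact: (@Ck_gh_V _ (@open_goodset1 eps) (@gc
    eps)).
  by move=> y h; rewrite /hat_V h.
by move=> y /negbTE h; rewrite /hat_V h.
Qed.

Lemma Ck_hat_Ab l eps : Ck_on l (goodset eps) (hat_Ab eps).
Proof.
apply: (@Ck_hat l _ eps 0 (gh_Ab eps)); last exact: (@Ck_gh_Ab _ (@open_goodset1 eps) (@gc
    eps)).
  by move=> y h; rewrite /hat_Ab h.
by move=> y /negbTE h; rewrite /hat_Ab h.
Qed.

Lemma Ck_hat_Ac l eps : Ck_on l (goodset eps) (hat_Ac eps).
Proof.
apply: (@Ck_hat l _ eps 0 (gh_Ac eps)); last exact: (@Ck_gh_Ac _ (@open_goodset1 eps) (@gc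
    eps)).
  by move=> y h; rewrite /hat_Ac h.
by move=> y /negbTE h; rewrite /hat_Ac h.
Qed.

Lemma hat_V_det eps y : \det (hat_V eps y) != 0.
Proof. by rewrite /hat_V; case: ifP => // _; rewrite det1 oner_eq0. Qed.

Lemma hat_V_unit eps y : hat_V eps y \in unitmx.
Proof. by rewrite unitmxE unitfE hat_V_det. Qed.

Lemma hat_VW eps y : hat_V eps y *m hat_W eps y = 1%:M.
Proof. by rewrite mulmxV // hat_V_unit. Qed.

Lemma hat_WV eps y : hat_W eps y *m hat_V eps y = 1%:M.
Proof. by rewrite mulVmx // hat_V_unit. Qed.

Lemma gh_V_sym eps y : (gh_V eps y)^T = gh_V eps y.
Proof. by rewrite /gh_V !trmx_mul trmxK tr_diag_mx mulmxA. Qed.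

Lemma hat_V_sym eps y : (hat_V eps y)^T = hat_V eps y.
Proof. by rewrite /hat_V; case: ifP => _; rewrite ?gh_V_sym ?trmx1. Qed.

Lemma Ck_hat_W l eps : Ck_on l (goodset eps) (hat_W eps).
Proof.
apply: Ck_invmx; [exact: open_goodset|by move=> y _; exact: hat_V_det|exact: Ck_hat_V].
Qed.

Definition toric_g eps y := hsG e (hat_V eps y) (hat_W eps y) (hat_Ab eps y) (hat_Ac eps y).
Definition toric_I eps y := hsI e (hat_V eps y) (hat_W eps y) (hat_Ab eps y) (hat_Ac eps y).
Definition toric_S eps y := hsS e (hat_V eps y) (hat_W eps y) (hat_Ab eps y) (hat_Ac eps y).
Definition toric_T eps y := hsT e (hat_V eps y) (hat_W eps y) (hat_Ab eps y) (hat_Ac eps y).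

Section SmoothFields.
Variables (l : nat) (eps : {ffun 'I_d -> bool}).
Let oG := @open_goodset eps.
Let cV := @Ck_hat_V l eps.
Let cW := @Ck_hat_W l eps.
Let cA1 := @Ck_hat_Ab l eps.
Let cA2 := @Ck_hat_Ac l eps.

Let Ck_M q r s (F : 'cV[R]_m -> 'M[R]_(q, r)) (G : 'cV[R]_m -> 'M[R]_(r, s)) :
  Ck_on l (goodset eps) F -> Ck_on l (goodset eps) G ->
  Ck_on l (goodset eps) (fun x => F x *m G x).
Proof. exact: Ck_mulmx. Qed.
Let Ck_D q r (F G : 'cV[R]_m -> 'M[R]_(q, r)) :
  Ck_on l (goodset eps) F -> Ck_on l (goodset eps) G ->
  Ck_on l (goodset eps) (fun x => F x + G x).
Proof. by move=> cF cG; exact: CkD. Qed.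
Let Ck_N q r (F : 'cV[R]_m -> 'M[R]_(q, r)) :
  Ck_on l (goodset eps) F -> Ck_on l (goodset eps) (fun x => - F x).
Proof. exact: Ck_oppmx. Qed.
Let Ck_C q r (X : 'M[R]_(q, r)) : Ck_on l (goodset eps) (fun=> X).
Proof. exact: Ck_cst. Qed.

Let Ck_connection : Ck_on l (goodset eps) (fun y => connection e (hat_Ab eps y) (hat_Ac eps y)).
Proof.
under eq_fun do rewrite connectionE.
by do ![apply: Ck_D|apply: Ck_M|exact: Ck_C].
Qed.

Let Ck_assemble q (F1 F2 F3 F4 : 'cV[R]_m -> 'M[R]_(n, q)) :
  Ck_on l (goodset eps) F1 -> Ck_on l (goodset eps) F2 ->
  Ck_on l (goodset eps) F3 -> Ck_on l (goodset eps) F4 ->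
  Ck_on l (goodset eps)
    (fun y => assemble e (hat_Ab eps y) (hat_Ac eps y) (F1 y) (F2 y) (F3 y) (F4 y)).
Proof.
move=> c1 c2 c3 c4; rewrite /assemble.
by do ![apply: Ck_D|apply: Ck_M|apply: Ck_N|exact: Ck_C].
Qed.

Lemma Ck_toric_g : Ck_on l (goodset eps) (toric_g eps).
Proof.
rewrite /toric_g /hsG.
have cT : Ck_on l (goodset eps) (fun y => (connection e (hat_Ab eps y) (hat_Ac eps y))^T).
  exact: Ck_trmx.
by do ![apply: Ck_D|apply: Ck_M|apply: Ck_N|exact: Ck_C].
Qed.

Lemma Ck_toric_I : Ck_on l (goodset eps) (toric_I eps).
Proof.
by apply: Ck_assemble; do ![apply: Ck_M|apply: Ck_N|exact: Ck_C].
Qed.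

Lemma Ck_toric_S : Ck_on l (goodset eps) (toric_S eps).
Proof.
by apply: Ck_assemble; do ![apply: Ck_M|apply: Ck_N|exact: Ck_C|apply: Ck_M].
Qed.

Lemma Ck_toric_T : Ck_on l (goodset eps) (toric_T eps).
Proof.
by apply: Ck_assemble; do ![apply: Ck_M|apply: Ck_N|exact: Ck_C|apply: Ck_M].
Qed.

End SmoothFields.

End Potentials.

(** * Closedness of the two-forms *)

Section Closed.
Local Open Scope ring_scope.
Variables (R : realType) (d n : nat) (u : 'I_d -> 'rV[int]_n).
Variables (lam1 lam2 lam3 : 'I_d -> R).
Variables (m : nat) (e : (n + n + (n + n))%N = m).
Implicit Types (k : 'I_d) (y v w : 'cV[R]_m).
Implicit Types (eps : {ffun 'I_d -> bool}).

Let bm := beta_mx R u.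
Notation face_a := (face_a u lam1 e).
Notation face_b := (face_b u lam2 e).
Notation face_c := (face_c u lam3 e).
Notation interior_pts := (interior_pts u lam1 lam2 lam3 e).
Notation face_da := (face_da u e).
Notation face_db := (face_db u e).
Notation face_dc := (face_dc u e).
Notation face_f := (face_f u lam1 lam2 lam3 e).
Notation face_V := (face_V u lam1 lam2 lam3 e).
Notation face_A := (face_A u lam1 lam2 lam3 e).
Notation gh_V := (gh_V u lam1 lam2 lam3 e).
Notation gh_Ab := (gh_Ab u lam1 lam2 lam3 e).
Notation gh_Ac := (gh_Ac u lam1 lam2 lam3 e).
Notation goodset := (goodset u lam1 lam2 lam3 e).
Notation hat_V := (hat_V u lam1 lam2 lam3 e).
Notation hat_Ab := (hat_Ab u lam1 lam2 lam3 e).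
Notation hat_Ac := (hat_Ac u lam1 lam2 lam3 e).
Notation toric_g := (toric_g u lam1 lam2 lam3 e).
Notation toric_I := (toric_I u lam1 lam2 lam3 e).
Notation toric_S := (toric_S u lam1 lam2 lam3 e).
Notation toric_T := (toric_T u lam1 lam2 lam3 e).

Let face_a_diff k y : differentiable (fun y => face_a y k) y.
Proof. by have [+ _] := @Ck_face_a R d n u lam1 m e 1 setT k openT; exact. Qed.
Let face_b_diff k y : differentiable (fun y => face_b y k) y.
Proof. by have [+ _] := @Ck_face_b R d n u lam2 m e 1 setT k openT; exact. Qed.
Let face_c_diff k y : differentiable (fun y => face_c y k) y.
Proof. by have [+ _] := @Ck_face_c R d n u lam3 m e 1 setT k openT; exact. Qed.

Let isD_lin (Q : 'M[R]_(d, m)) k (c : R) y v :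
  is_derive y v (fun y => (Q *m y) k 0 - c) ((Q *m v) k 0).
Proof.
have hj j : is_derive y v (fun x : 'cV[R]_m => x j 0) (v j 0).
  apply: DeriveDef; first by apply: diff_derivable; exact: differentiable_coord.
  by rewrite (@derive_coord _ _ m 1 (fun x => x)) // derive_id.
have h := isD_add (isD_sum (index_enum _)
  (fun j => isD_mul (isD_cst y v (Q k j)) (hj j))) (isD_cst y v (- c)).
have -> : (fun y => (Q *m y) k 0 - c) = fun y => (\sum_j Q k j * y j 0) + - c.
  by apply/funext => z; rewrite mxE.
apply: is_derive_eq h _; rewrite addr0 mxE; apply: eq_bigr => j _.
by rewrite mulr0 addr0.
Qed.

Lemma isD_face_a k y v : is_derive y v (fun y => face_a y k) (face_da k v).
Proof. by have := isD_lin (bm *m pr_a R e) k (lam1 k) y v; under eq_fun do rewrite -mulmxA;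
    rewrite -mulmxA. Qed.
Lemma isD_face_b k y v : is_derive y v (fun y => face_b y k) (face_db k v).
Proof. by have := isD_lin (bm *m pr_b R e) k (lam2 k) y v; under eq_fun do rewrite -mulmxA;
    rewrite -mulmxA. Qed.
Lemma isD_face_c k y v : is_derive y v (fun y => face_c y k) (face_dc k v).
Proof. by have := isD_lin (bm *m pr_c R e) k (lam3 k) y v; under eq_fun do rewrite -mulmxA;
    rewrite -mulmxA. Qed.

Let face_f_diff k y : interior_pts y -> differentiable (fun y => face_f y k) y.
Proof.
have := @Ck_face_f R d n u lam1 lam2 lam3 m e _ (@open_interior_pts _ _ _ _ _ _ _ _ _)
    (@subset_refl _ _) 1 k.
by move=> [+ _]; exact.
Qed.

Lemma isD_face_f k y v : interior_pts y -> is_derive y v (fun y => face_f y k)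
  ((face_f y k)^-1 * (face_a y k * face_da k v - face_b y k * face_db k v - face_c y k *
      face_dc k v)).
Proof.
move=> cy; have f0 := face_f_gt0 k cy.
have d0 : 0 < face_a y k ^+ 2 - face_b y k ^+ 2 - face_c y k ^+ 2 by exact: icone_disc_gt0
    (cy k).
have Dd : differentiable (fun y => face_a y k ^+ 2 - face_b y k ^+ 2 - face_c y k ^+ 2) y.
  by have [+ _] := @Ck_disc R d n u lam1 lam2 lam3 m e 1 setT k openT; exact.
have h := isD_add (isD_add (isD_mul (isD_face_a k y v) (isD_face_a k y v))
  (isD_opp (isD_mul (isD_face_b k y v) (isD_face_b k y v))))
  (isD_opp (isD_mul (isD_face_c k y v) (isD_face_c k y v))).
apply: is_derive_eq (isD_comp Dd h (is_derive1_sqrt d0)) _.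
by rewrite -/(face_f y k); field; rewrite gt_eqF.
Qed.

Lemma isD_face_V eps k y v : interior_pts y -> is_derive y v (fun y => face_V eps y k)
  (- (face_V eps y k / face_f y k ^+ 2)
     * (face_a y k * face_da k v - face_b y k * face_db k v - face_c y k * face_dc k v)).
Proof.
move=> cy; have f0 := face_f_gt0 k cy.
have Df : differentiable (fun y => 2 * face_f y k) y.
  by apply: differentiableM => //; exact: face_f_diff.
have hf := isD_mul (isD_cst y v 2) (isD_face_f k v cy).
have f20 : 2 * face_f y k != 0 by rewrite mulf_neq0 // gt_eqF.
apply: is_derive_eq (isD_mul (isD_cst y v (sign_of R (eps k))) (isD_inv Df hf f20)) _.
by rewrite /face_V; field; rewrite gt_eqF.
Qed.

(** Partial derivatives: [va], [vb], [vc] of [face_V] in [a_k], [b_k], [c_k];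
    [qa] of [face_A] in [a_k], while those in [b_k] and [c_k] are [qb'] times
    [b_k] and [c_k]. *)
Let va eps y k := - face_V eps y k * face_a y k / face_f y k ^+ 2.
Let vb eps y k := face_V eps y k * face_b y k / face_f y k ^+ 2.
Let vc eps y k := face_V eps y k * face_c y k / face_f y k ^+ 2.
Let qa eps y k := - face_V eps y k / face_f y k ^+ 2.
Let qb' eps y k := face_V eps y k * (face_a y k + 2 * face_f y k)
  / (face_f y k ^+ 2 * (face_a y k + face_f y k) ^+ 2).

Lemma isD_face_A eps k y v : interior_pts y -> is_derive y v (fun y => face_A eps y k)
  (qa eps y k * face_da k v + qb' eps y k * (face_b y k * face_db k v + face_c y k * face_dc
      k v)).
Proof.
move=> cy; have f0 := face_f_gt0 k cy.
have a0 : 0 < face_a y k by case: (cy k).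
have s0 : face_a y k + face_f y k != 0 by rewrite gt_eqF // addr_gt0.
have Ds : differentiable (fun y => face_a y k + face_f y k) y.
  by apply: differentiableD; [exact: face_a_diff|exact: face_f_diff].
have hs := isD_add (isD_face_a k y v) (isD_face_f k v cy).
apply: is_derive_eq (isD_mul (isD_face_V eps k v cy) (isD_inv Ds hs s0)) _.
by rewrite /qa /qb'; field; rewrite s0 gt_eqF.
Qed.

(** The component of the monopole equation [dV = * dA] along [da], for the
    Lorentzian metric [da^2 - db^2 - dc^2] of a single face.  The other two
    components hold by the form of the derivatives [vb], [vc], [qa]. *)
Let bogomolny eps k y : interior_pts y ->
  va eps y k = - (qb' eps y k * (face_b y k ^+ 2 + face_c y k ^+ 2) + 2 * face_A eps y k).
Proof.
move=> cy; have f0 := face_f_gt0 k cy.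
have a0 : 0 < face_a y k by case: (cy k).
have s0 : face_a y k + face_f y k != 0 by rewrite gt_eqF // addr_gt0.
have fn : face_f y k != 0 by rewrite gt_eqF.
have f2 : face_b y k ^+ 2 + face_c y k ^+ 2 = (face_a y k - face_f y k) * (face_a y k +
    face_f y k).
  rewrite -subr_sqr /face_f sqr_sqrtr; last by exact: ltW (icone_disc_gt0 (cy k)).
  by ring.
rewrite f2 /va /qb' /face_A; field; by rewrite s0 fn.
Qed.

(** The contribution of one face to [Theta /\ d1 + V d2 /\ d3], apart from
    [dtau].  The domain [T] is arbitrary because the same formula occurs for
    tangent vectors of the coordinate space and of flat space. *)
Definition gh_summand (T : Type) (q v b c : R) (db dc d1 d2 d3 : T -> R)
    (v1 v2 : T) : R :=
  q * (c * db v1 - b * dc v1) * d1 v2 - d1 v1 * (q * (c * db v2 - b * dc v2))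
  + v * (d2 v1 * d3 v2 - d3 v1 * d2 v2).

Let d_gh_summand eps k y (d1 d2 d3 : 'cV[R]_m -> R) v v1 v2 : R :=
  let dq := qa eps y k * face_da k v
    + qb' eps y k * (face_b y k * face_db k v + face_c y k * face_dc k v) in
  dq * (face_c y k * face_db k v1 - face_b y k * face_dc k v1) * d1 v2
  + face_A eps y k * (face_dc k v * face_db k v1 - face_db k v * face_dc k v1) * d1 v2
  - d1 v1 * (dq * (face_c y k * face_db k v2 - face_b y k * face_dc k v2)
      + face_A eps y k * (face_dc k v * face_db k v2 - face_db k v * face_dc k v2))
  + (va eps y k * face_da k v + vb eps y k * face_db k v + vc eps y k * face_dc k v)
    * (d2 v1 * d3 v2 - d3 v1 * d2 v2).

Let isD_gh_summand eps k y v v1 v2 (d1 d2 d3 : 'cV[R]_m -> R) : interior_pts y ->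
  is_derive y v (fun y => gh_summand (face_A eps y k) (face_V eps y k) (face_b y k) (face_c y k)
    (face_db k) (face_dc k) d1 d2 d3 v1 v2) (d_gh_summand eps k y d1 d2 d3 v v1 v2).
Proof.
move=> cy; have f0 := face_f_gt0 k cy.
have fn : face_f y k != 0 by rewrite gt_eqF.
have hq := isD_face_A eps k v cy; have hv := isD_face_V eps k v cy.
have hb := isD_face_b k y v; have hc := isD_face_c k y v.
have C (c : R) := isD_cst y v c.
have hl w := isD_mul hq (isD_add (isD_mul hc (C (face_db k w))) (isD_opp (isD_mul hb (C
    (face_dc k w))))).
have := isD_add (isD_add (isD_mul (hl v1) (C (d1 v2)))
  (isD_opp (isD_mul (C (d1 v1)) (hl v2))))
  (isD_mul hv (C (d2 v1 * d3 v2 - d3 v1 * d2 v2))).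
set X := (_ + _ : R); move=> h; apply: is_derive_eq h _.
by rewrite /X /d_gh_summand /= /va /vb /vc; field; rewrite fn.
Qed.

Lemma sandwich (D : 'I_d -> R) (x z : 'cV[R]_n) :
  (x^T *m (bm^T *m diag_mx (\row_k D k) *m bm) *m z) 0 0
  = \sum_k D k * ((bm *m x) k 0 * (bm *m z) k 0).
Proof.
rewrite !mulmxA -trmx_mul -mulmxA mxE; apply: eq_bigr => k _.
by rewrite mul_mx_diag !mxE; ring.
Qed.

(** [V] and [A] are sums over the faces, and so is the form, apart from [dtau]. *)
Lemma gh_formE eps y (p1 p2 p3 : 'M[R]_(n, m)) v w :
  let T := connection e (gh_Ab eps y) (gh_Ac eps y) in
  bform (T^T *m p1 - p1^T *m T + (p2^T *m gh_V eps y *m p3 - p3^T *m gh_V eps y *m p2)) v w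
  = ((pr_t R e *m v)^T *m (p1 *m w)) 0 0 - ((p1 *m v)^T *m (pr_t R e *m w)) 0 0
  + \sum_k gh_summand (face_A eps y k) (face_V eps y k) (face_b y k) (face_c y k) (face_db k)
      (face_dc k)
      (fun x => (bm *m (p1 *m x)) k 0) (fun x => (bm *m (p2 *m x)) k 0)
      (fun x => (bm *m (p3 *m x)) k 0) v w.
Proof.
move=> T.
have bD (X Y : 'M[R]_m) : bform (X + Y) v w = bform X v w + bform Y v w.
  by rewrite /bform mulmxDr mulmxDl mxE.
have bN (X : 'M[R]_m) : bform (- X) v w = - bform X v w.
  by rewrite /bform mulmxN mulNmx mxE.
have bTT (X Y : 'M[R]_(n, m)) : bform (X^T *m Y) v w = ((X *m v)^T *m (Y *m w)) 0 0.
  by rewrite /bform trmx_mul !mulmxA.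
have bTV (X Y : 'M[R]_(n, m)) (Z : 'M[R]_n) :
    bform (X^T *m Z *m Y) v w = ((X *m v)^T *m Z *m (Y *m w)) 0 0.
  by rewrite /bform trmx_mul !mulmxA.
have TE (x : 'cV[R]_m) : T *m x = pr_t R e *m x + (gh_Ab eps y *m (pr_b R e *m x)
    + gh_Ac eps y *m (pr_c R e *m x)).
  by rewrite /T connectionE !mulmxDl !mulmxA addrA.
have A1s : (gh_Ab eps y)^T = gh_Ab eps y by rewrite /gh_Ab !trmx_mul trmxK tr_diag_mx mulmxA.
have A2s : (gh_Ac eps y)^T = gh_Ac eps y.
  by rewrite /gh_Ac linearN /= !trmx_mul trmxK tr_diag_mx mulmxA.
have Tl x (z : 'cV[R]_n) : ((T *m x)^T *m z) 0 0 = ((pr_t R e *m x)^T *m z) 0 0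
    + \sum_k face_A eps y k * (face_c y k * face_db k x - face_b y k * face_dc k x) * (bm *m
        z) k 0.
  have tD (X Y : 'cV[R]_n) : (X + Y)^T = X^T + Y^T by exact: linearD.
  have m00 (X Y : 'M[R]_1) : (X + Y) 0 0 = X 0 0 + Y 0 0 by rewrite mxE.
  rewrite TE !tD !mulmxDl !m00; congr (_ + _).
  rewrite (trmx_mul (gh_Ab eps y)) (trmx_mul (gh_Ac eps y)) A1s A2s /gh_Ab /gh_Ac sandwich.
  rewrite mulmxN mulNmx [X in _ + X]mxE sandwich -sumrN -big_split /=.
  by apply: eq_bigr => k _; rewrite /face_db /face_dc; ring.
have Tr x (z : 'cV[R]_n) : (z^T *m (T *m x)) 0 0 = (z^T *m (pr_t R e *m x)) 0 0
    + \sum_k face_A eps y k * (face_c y k * face_db k x - face_b y k * face_dc k x) * (bm *m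
        z) k 0.
  have sym (x1 x2 : 'cV[R]_n) : (x1^T *m x2) 0 0 = (x2^T *m x1) 0 0.
    by rewrite !mxE; apply: eq_bigr => k _; rewrite !mxE mulrC.
  by rewrite sym Tl sym.
rewrite !bD !bN !bTT !bTV Tl Tr !sandwich.
have shuffle (a b s1 s2 s3 s4 : R) :
    a + s1 - (b + s2) + (s3 - s4) = a - b + (s1 - s2 + (s3 - s4)) by ring.
rewrite shuffle; congr (_ + _).
rewrite -!sumrN -!big_split /=; apply: eq_bigr => k _.
by rewrite /gh_summand; ring.
Qed.

Lemma toric_I_form eps y : two_form (toric_g eps y) (toric_I eps y) =
  (connection e (hat_Ab eps y) (hat_Ac eps y))^T *m pr_a R e - (pr_a R e)^T *m connection e
      (hat_Ab eps y) (hat_Ac eps y)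
  + ((pr_c R e)^T *m hat_V eps y *m pr_b R e - (pr_b R e)^T *m hat_V eps y *m pr_c R e).
Proof. by apply: formI; [exact: hat_VW|exact: hat_WV|exact: hat_V_sym]. Qed.

Lemma toric_S_form eps y : two_form (toric_g eps y) (toric_S eps y) =
  (connection e (hat_Ab eps y) (hat_Ac eps y))^T *m pr_b R e - (pr_b R e)^T *m connection e
      (hat_Ab eps y) (hat_Ac eps y)
  + ((pr_c R e)^T *m hat_V eps y *m pr_a R e - (pr_a R e)^T *m hat_V eps y *m pr_c R e).
Proof. by apply: formS; [exact: hat_VW|exact: hat_WV|exact: hat_V_sym]. Qed.

Lemma toric_T_form eps y : two_form (toric_g eps y) (toric_T eps y) =
  (connection e (hat_Ab eps y) (hat_Ac eps y))^T *m pr_c R e - (pr_c R e)^T *m connection e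
      (hat_Ab eps y) (hat_Ac eps y)
  + ((pr_a R e)^T *m hat_V eps y *m pr_b R e - (pr_b R e)^T *m hat_V eps y *m pr_a R e).
Proof. by apply: formT; [exact: hat_VW|exact: hat_WV|exact: hat_V_sym]. Qed.

Let hat_form eps (p1 p2 p3 : 'M[R]_(n, m)) y :=
  (connection e (hat_Ab eps y) (hat_Ac eps y))^T *m p1 - p1^T *m connection e (hat_Ab eps y)
      (hat_Ac eps y)
  + (p2^T *m hat_V eps y *m p3 - p3^T *m hat_V eps y *m p2).

(** The part of the form that involves [dtau] has constant coefficients, so that
    closedness is to be checked face by face; it is trivial where the data are
    constant. *)
Let closed_hat eps (p1 p2 p3 : 'M[R]_(n, m)) :
  (forall y k v1 v2 v3 (D := d_gh_summand eps k y (fun x => (bm *m (p1 *m x)) k 0)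
      (fun x => (bm *m (p2 *m x)) k 0) (fun x => (bm *m (p3 *m x)) k 0)),
   interior_pts y -> D v1 v2 v3 + D v2 v3 v1 + D v3 v1 v2 = 0) ->
  closed_two_form (goodset eps) (hat_form eps p1 p2 p3).
Proof.
move=> alg y gy v1 v2 v3; have [cy [ny|ny]] := gy; last first.
  have cst v w z : 'D_z (fun x => bform (hat_form eps p1 p2 p3 x) v w) y = 0.
    pose X := bform ((connection e 0 0)^T *m p1 - p1^T *m connection e 0 0
      + (p2^T *m 1%:M *m p3 - p3^T *m 1%:M *m p2)) v w.
    rewrite (@near_eq_derive _ _ _ _ (fun=> X)); first exact: (derive_cst X).
    apply: filterS ny => x /negbTE nx.
    by rewrite /hat_form /hat_Ab /hat_Ac /hat_V nx.
  by rewrite !cst !addr0.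
have nb : \forall x \near y, goodset1 u lam1 lam2 lam3 e eps x.
  exact: open_nbhs_nbhs (conj (@open_goodset1 _ _ _ _ _ _ _ _ _ eps) (conj cy ny)).
pose c0 v w := ((pr_t R e *m v)^T *m (p1 *m w)) 0 0 - ((p1 *m v)^T *m (pr_t R e *m w)) 0 0.
have DE z v w : 'D_z (fun x => bform (hat_form eps p1 p2 p3 x) v w) y = 0 +
    \sum_k d_gh_summand eps k y (fun x => (bm *m (p1 *m x)) k 0)
      (fun x => (bm *m (p2 *m x)) k 0) (fun x => (bm *m (p3 *m x)) k 0) z v w.
  rewrite (@near_eq_derive _ _ _ _ (fun x => c0 v w + \sum_k
    gh_summand (face_A eps x k) (face_V eps x k) (face_b x k) (face_c x k) (face_db k)
        (face_dc k)
      (fun x => (bm *m (p1 *m x)) k 0) (fun x => (bm *m (p2 *m x)) k 0)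
      (fun x => (bm *m (p3 *m x)) k 0) v w)); last first.
    apply: filterS nb => x [cx nx].
    by rewrite /hat_form /hat_Ab /hat_Ac /hat_V nx gh_formE.
  have hk k := isD_gh_summand eps k z v w (fun x => (bm *m (p1 *m x)) k 0)
    (fun x => (bm *m (p2 *m x)) k 0) (fun x => (bm *m (p3 *m x)) k 0) cy.
  have [_ ->] := isD_add (isD_cst y z (c0 v w)) (isD_sum (index_enum _) hk).
  by [].
rewrite !DE !add0r -!big_split /= big1 // => k _; exact: alg.
Qed.

Lemma closed_I eps : closed_two_form (goodset eps) (fun y => two_form (toric_g eps y)
    (toric_I eps y)).
Proof.
rewrite (_ : (fun y => _) = hat_form eps (pr_a R e) (pr_c R e) (pr_b R e)).
  apply: closed_hat => y k v1 v2 v3 D cy.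
  rewrite /D /d_gh_summand (bogomolny eps k cy) /vb /vc /qa.
  rewrite -/(face_da k v1) -/(face_da k v2) -/(face_da k v3) -/(face_db k v1) -/(face_db k v2)
    -/(face_db k v3) -/(face_dc k v1) -/(face_dc k v2) -/(face_dc k v3).
  by ring.
by apply/funext => y; rewrite toric_I_form.
Qed.

Lemma closed_S eps : closed_two_form (goodset eps) (fun y => two_form (toric_g eps y)
    (toric_S eps y)).
Proof.
rewrite (_ : (fun y => _) = hat_form eps (pr_b R e) (pr_c R e) (pr_a R e)).
  apply: closed_hat => y k v1 v2 v3 D cy.
  rewrite /D /d_gh_summand (bogomolny eps k cy) /vb /vc /qa.
  rewrite -/(face_da k v1) -/(face_da k v2) -/(face_da k v3) -/(face_db k v1) -/(face_db k v2)
    -/(face_db k v3) -/(face_dc k v1) -/(face_dc k v2) -/(face_dc k v3).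
  by ring.
by apply/funext => y; rewrite toric_S_form.
Qed.

Lemma closed_T eps : closed_two_form (goodset eps) (fun y => two_form (toric_g eps y)
    (toric_T eps y)).
Proof.
rewrite (_ : (fun y => _) = hat_form eps (pr_c R e) (pr_a R e) (pr_b R e)).
  apply: closed_hat => y k v1 v2 v3 D cy.
  rewrite /D /d_gh_summand (bogomolny eps k cy) /vb /vc /qa.
  rewrite -/(face_da k v1) -/(face_da k v2) -/(face_da k v3) -/(face_db k v1) -/(face_db k v2)
    -/(face_db k v3) -/(face_dc k v1) -/(face_dc k v2) -/(face_dc k v3).
  by ring.
by apply/funext => y; rewrite toric_T_form.
Qed.

End Closed.

(** * The flat two-forms in polar form *)

Section FlatForms.
Local Open Scope ring_scope.
Variables (R : realType) (d : nat).
Implicit Types (p v w : flat R d) (k : 'I_d).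

(** Real expressions for the summands of the flat two-forms. *)
Definition omI k v w : R :=
  v k 1 * w k 0 - v k 0 * w k 1 + (v k 3%:R * w k 2%:R - v k 2%:R * w k 3%:R).
Definition omS k v w : R :=
  v k 2%:R * w k 0 + v k 3%:R * w k 1 - (w k 2%:R * v k 0 + w k 3%:R * v k 1).
Definition omT k v w : R :=
  v k 3%:R * w k 0 - v k 2%:R * w k 1 - (w k 3%:R * v k 0 - w k 2%:R * v k 1).

Lemma flat_omegaIE v w : flat_omegaI v w = (\sum_k omI k v w)%:C%C.
Proof.
rewrite /flat_omegaI; under eq_bigr => k _.
  rewrite (_ : _ + _ = (0 +i* (2 * omI k v w))%C); first over.
  rewrite /wedge2 /dz /dzbar /dw /dwbar /zcoord /wcoord /omI.
  by apply/eqP; rewrite eq_complex /=; apply/andP; split; apply/eqP; ring.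
rewrite complex_sum -mulr_sumr big1 //.
have i2 : (2%:R * 'i)%C = (0 +i* 2)%C :> R[i].
  by apply/eqP; rewrite eq_complex /=; apply/andP; split; apply/eqP; ring.
have nz : (0 +i* 2)%C != 0 :> R[i] by rewrite eq_complex /= negb_and pnatr_eq0 orbT.
apply: (mulfI nz); rewrite i2 mulrA divff // mul1r.
by apply/eqP; rewrite eq_complex /=; apply/andP; split; apply/eqP; ring.
Qed.

Lemma flat_omegaSTE v w :
  flat_omegaST v w = ((\sum_k omS k v w) +i* (\sum_k omT k v w))%C.
Proof.
rewrite /flat_omegaST -complex_sum; apply: eq_bigr => k _.
rewrite /wedge2 /dw /dzbar /zcoord /wcoord /omS /omT.
by apply/eqP; rewrite eq_complex /=; apply/andP; split; apply/eqP; ring.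
Qed.

(** The differentials at [p] of [mom_a], [mom_b], [mom_c]. *)
Definition mom_da p k v : R := p k 0 * v k 0 + p k 1 * v k 1
  + p k 2%:R * v k 2%:R + p k 3%:R * v k 3%:R.
Definition mom_db p k v : R := v k 1 * p k 2%:R + p k 1 * v k 2%:R
  - (v k 0 * p k 3%:R + p k 0 * v k 3%:R).
Definition mom_dc p k v : R := v k 0 * p k 2%:R + p k 0 * v k 2%:R
  + (v k 1 * p k 3%:R + p k 1 * v k 3%:R).

(** Real and imaginary part of the longer coordinate, its squared modulus,
    and the differential of its argument. *)
Definition major_x (eps : {ffun 'I_d -> bool}) p k : R := if eps k then p k 0 else p k 2%:R.
Definition major_y (eps : {ffun 'I_d -> bool}) p k : R := if eps k then p k 1 else p k 3%:R.
Definition major_sq eps p k : R := major_x eps p k ^+ 2 + major_y eps p k ^+ 2.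
Definition major_dt eps p k v : R :=
  (major_x eps p k * major_y eps v k - major_y eps p k * major_x eps v k) / major_sq eps p k.

(** The flat space [C^(1,1)] is itself of Gibbons-Hawking form, for its circle
    action: the potential is the inverse of [mom_d], and the angle is the argument
    of the longer coordinate. *)
Lemma flat_gibbons_hawking eps p k v w : major_sq eps p k != 0 -> mom_d p k != 0 ->
  let q := (mom_d p k * major_sq eps p k)^-1 in
  let f := gh_summand q (mom_d p k)^-1 (mom_b p k) (mom_c p k) (mom_db p k) (mom_dc p k) in
  [/\ omI k v w = major_dt eps p k v * mom_da p k w - mom_da p k v * major_dt eps p k w
        + f (mom_da p k) (mom_dc p k) (mom_db p k) v w,
      omS k v w = major_dt eps p k v * mom_db p k w - mom_db p k v * major_dt eps p k w
        + f (mom_db p k) (mom_dc p k) (mom_da p k) v w &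
      omT k v w = major_dt eps p k v * mom_dc p k w - mom_dc p k v * major_dt eps p k w
        + f (mom_dc p k) (mom_da p k) (mom_db p k) v w].
Proof.
rewrite /omI /omS /omT /gh_summand /major_dt /major_sq /major_x /major_y /mom_da /mom_db
    /mom_dc /mom_d /mom_b /mom_c.
move: (p k 0) (p k 1) (p k 2%:R) (p k 3%:R) (v k 0) (v k 1) (v k 2%:R) (v k 3%:R)
  (w k 0) (w k 1) (w k 2%:R) (w k 3%:R) => x y s t x1 y1 s1 t1 x2 y2 s2 t2.
by case: (eps k) => n1 n2; split; field; rewrite n1 n2.
Qed.

End FlatForms.

Section Angles.
Local Open Scope ring_scope.
Variable R : realType.
Implicit Types (x y phi : R).

(** The branch near [phi] of the argument of [x + i y], smooth in the half plane
    of direction [phi]. *)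
Definition ang phi x y : R :=
  phi + atan ((y * cos phi - x * sin phi) / (x * cos phi + y * sin phi)).

Lemma angP phi x y : 0 < x * cos phi + y * sin phi ->
  x = Num.sqrt (x ^+ 2 + y ^+ 2) * cos (ang phi x y) /\
  y = Num.sqrt (x ^+ 2 + y ^+ 2) * sin (ang phi x y).
Proof.
rewrite /ang => pos; rewrite cosD sinD.
have := cos2Dsin2 phi; move: (cos phi) (sin phi) pos => C S pos CS.
set P := x * C + y * S in pos *; set Q := y * C - x * S.
have P0 : P != 0 by rewrite gt_eqF.
have PQ : x ^+ 2 + y ^+ 2 = P ^+ 2 + Q ^+ 2.
  by rewrite -[LHS]mulr1 -CS /P /Q; ring.
have sP : 0 < P ^+ 2 + Q ^+ 2 by rewrite ltr_pwDl ?exprn_gt0 ?sqr_ge0.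
set r := Num.sqrt _; have r0 : 0 < r by rewrite sqrtr_gt0 PQ.
have r2 : r ^+ 2 = P ^+ 2 + Q ^+ 2 by rewrite sqr_sqrtr -?PQ // PQ ltW.
have cE : cos (atan (Q / P)) = P / r.
  rewrite cos_atan.
  have -> : 1 + (Q / P) ^+ 2 = (r / P) ^+ 2 by rewrite (expr_div_n r) r2; field.
  by rewrite sqrtr_sqr ger0_norm ?invf_div // divr_ge0 // ltW.
have sE : sin (atan (Q / P)) = Q / r.
  have c0 : cos (atan (Q / P)) != 0 by rewrite cE mulf_neq0 ?invr_eq0 // gt_eqF.
  have := atanK (Q / P); rewrite /tan cE => /(canRL (divfK _)) ->.
    by field; rewrite P0 gt_eqF.
  by rewrite mulf_neq0 ?invr_eq0 // gt_eqF.
have rn : r != 0 by rewrite gt_eqF.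
rewrite cE sE; split.
  have -> : r * (C * (P / r) - S * (Q / r)) = C * P - S * Q by field.
  by rewrite -[LHS]mulr1 -CS /P /Q; ring.
have -> : r * (S * (P / r) + C * (Q / r)) = S * P + C * Q by field.
by rewrite -[LHS]mulr1 -CS /P /Q; ring.
Qed.

Lemma ang_base phi x y (r : R) : 0 < r -> x = r * cos phi -> y = r * sin phi ->
  0 < x * cos phi + y * sin phi /\ ang phi x y = phi.
Proof.
move=> r0 -> ->; split.
  by rewrite -!mulrA -mulrDr -!expr2 cos2Dsin2 mulr1.
rewrite /ang (_ : _ * _ - _ = 0) ?mul0r ?atan0 ?addr0 //; ring.
Qed.

Lemma isD_ang (V : normedModType R) (f g : V -> R) (y v : V) df dg phi :
  differentiable f y -> differentiable g y ->
  is_derive y v f df -> is_derive y v g dg ->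
  0 < f y * cos phi + g y * sin phi ->
  is_derive y v (fun x : V => ang phi (f x) (g x))
    ((f y * dg - g y * df) / (f y ^+ 2 + g y ^+ 2)).
Proof.
move=> Df Dg hf hg pos; have P0 : f y * cos phi + g y * sin phi != 0 by rewrite gt_eqF.
have C c := isD_cst y v c.
have DC (c : R) : differentiable (fun _ : V => c) y by exact: differentiable_cst.
have hP := isD_add (isD_mul hf (C (cos phi))) (isD_mul hg (C (sin phi))).
have hQ := isD_add (isD_mul hg (C (cos phi))) (isD_opp (isD_mul hf (C (sin phi)))).
have DP : differentiable (fun x : V => f x * cos phi + g x * sin phi) y.
  by apply: differentiableD; apply: differentiableM.
have DQ : differentiable (fun x : V => g x * cos phi - f x * sin phi) y.
  by apply: differentiableB; apply: differentiableM.
have DV : differentiable (fun x : V => (f x * cos phi + g x * sin phi)^-1) y.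
  exact: (@differentiableV _ _ _ _ DP P0).
have hR := isD_mul hQ (isD_inv DP hP P0).
have DR : differentiable (fun x : V => (g x * cos phi - f x * sin phi)
    / (f x * cos phi + g x * sin phi)) y by exact: differentiableM.
have := isD_add (C phi) (isD_comp DR hR (is_derive1_atan _)).
move=> h; apply: is_derive_eq h _.
have := cos2Dsin2 phi; move: (cos phi) (sin phi) P0 {hP hQ DP DQ DV hR DR pos} => c s P0 cs.
have PQ : f y ^+ 2 + g y ^+ 2 = (f y * c + g y * s) ^+ 2 + (g y * c - f y * s) ^+ 2.
  by rewrite -[LHS]mulr1 -cs; ring.
have n0 : (f y * c + g y * s) ^+ 2 + (g y * c - f y * s) ^+ 2 != 0.
  by rewrite gt_eqF // ltr_pwDl ?sqr_ge0 // lt_neqAle eq_sym sqrf_eq0 P0 sqr_ge0.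
rewrite PQ !mulr0 !add0r.
have key : (f y * c + g y * s) * (c * dg - s * df) - (g y * c - f y * s) * (c * df + s * dg)
    = f y * dg - g y * df.
  by rewrite -[RHS]mulr1 -cs; ring.
rewrite -key; move: n0 P0; set P := f y * c + g y * s; set Q := g y * c - f y * s => n0 P0.
by field; rewrite n0 P0.
Qed.

Lemma Ck_ang (V : normedModType R) l (A : set V) (f g : V -> R) phi : open A ->
  (forall x : V, A x -> 0 < f x * cos phi + g x * sin phi) ->
  Ck_on l A f -> Ck_on l A g -> Ck_on l A (fun x : V => ang phi (f x) (g x)).
Proof.
move=> oA pos cf cg; have C (c : R) : Ck_on l A (fun=> c) by exact: Ck_cst.
apply: CkD => //; apply: Ck_atan => //; apply: CkM => //.
  by apply: CkD => //; [apply: CkM|apply: CkN => //; apply: CkM].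
apply: CkV => //; first by move=> x /pos h; rewrite gt_eqF.
by apply: CkD => //; apply: CkM.
Qed.

End Angles.

(** * Smooth branches of the coordinates *)

Section LocalMap.
Local Open Scope ring_scope.
Variables (R : realType) (d n : nat) (u : 'I_d -> 'rV[int]_n).
Variables (lam1 lam2 lam3 : 'I_d -> R).
Variables (m : nat) (e : (n + n + (n + n))%N = m).
Variable B : 'M[R]_(n, d).
Hypothesis BK : B *m beta_mx R u = 1%:M.
Implicit Types (p : flat R d) (k : 'I_d) (y : 'cV[R]_m) (z : 'rV[int]_n).
Implicit Types (eps : {ffun 'I_d -> bool}) (phi : 'I_d -> R).

Let bm := beta_mx R u.
Notation MZ := (mu_zero u lam1 lam2 lam3).
Notation M := (hs_quotient u lam1 lam2 lam3).
Implicit Types (X : M).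
Notation face_a := (face_a u lam1 e).
Notation face_b := (face_b u lam2 e).
Notation face_c := (face_c u lam3 e).
Notation face_t := (face_t e B).
Notation interior_pts := (interior_pts u lam1 lam2 lam3 e).
Notation toric_sec := (toric_sec u lam1 lam2 lam3 e B).
Notation lift_pt := (lift_pt u lam1 lam2 lam3 e B).

Lemma coord_ext y y' : pr_a R e *m y = pr_a R e *m y' ->
  pr_b R e *m y = pr_b R e *m y' -> pr_c R e *m y = pr_c R e *m y' ->
  pr_t R e *m y = pr_t R e *m y' -> y = y'.
Proof.
move=> ha hb hc ht; rewrite -[y]mul1mx -[y']mul1mx -(pr_sum R e) !mulmxDl -!mulmxA.
by rewrite ha hb hc ht.
Qed.

(** Translations of [tau] by the lattice [2 pi Z^n]. *)
Definition period z : 'cV[R]_m := glue_coords e 0 0 0 ((2 * pi) *: (map_mx intr z)^T).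

Lemma pr_period z : [/\ pr_a R e *m period z = 0, pr_b R e *m period z = 0,
  pr_c R e *m period z = 0 & pr_t R e *m period z = (2 * pi) *: (map_mx intr z)^T].
Proof. exact: glue_coordsE. Qed.

Lemma face_period y z : [/\ face_a (y + period z) = face_a y, face_b (y + period z) = face_b y &
  face_c (y + period z) = face_c y].
Proof.
have [ha hb hc _] := pr_period z.
by split; apply/funext => k; rewrite /face_a /face_b /face_c mulmxDr ?ha ?hb ?hc addr0.
Qed.

Lemma torus_exp_period z : torus_exp ((2 * pi) *: map_mx intr z : 'rV[R]_n) = const_mx 1.
Proof.
apply/rowP => j; rewrite !mxE.
have [hc hs] := cos_sin_int (0 : R) (z 0 j).
by rewrite mulrC; move: hc hs; rewrite !add0r => -> ->; rewrite cos0 sin0.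
Qed.

Lemma toric_sec_period eps y z X : above (toric_sec eps y) X -> above (toric_sec eps (y +
    period z)) X.
Proof.
move=> oX; pose phi : 'rV[R]_d := (2 * pi) *: map_mx intr z *m B.
have [ha hb hc] := face_period y z; have [_ _ _ ht] := pr_period z.
have -> : toric_sec eps (y + period z) = torus_act (torus_exp phi) (toric_sec eps y).
  rewrite torus_act_polar /toric_sec ha hb hc; congr polar_pt; apply/funext => k.
  rewrite /face_t mulmxDr ht mulmxDr mxE; congr (_ + _).
  have -> : B^T *m ((2 * pi) *: (map_mx intr z)^T) = phi^T.
    by rewrite /phi trmx_mul; congr (_ *m _); apply/matrixP => i j; rewrite !mxE.
  by rewrite mxE.
apply: above_act oX _.
by rewrite /beta /phi -mulmxA BK mulmx1 torus_exp_period.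
Qed.

(** The longer coordinate is the one that [eps] selects, and its argument lies
    within [pi / 2] of [phi]. *)
Definition branch_dom eps phi : set (flat R d) := [set p | forall k,
  0 < major_x eps p k * cos (phi k) + major_y eps p k * sin (phi k) /\
  0 < sign_of R (eps k) * mom_d p k].

(** Coordinates of a point of the zero set, through smooth branches of the
    arguments; as the vectors [u] need not span the whole lattice, a period
    has to be added to reach every value of [tau]. *)
Definition branch eps phi z p : 'cV[R]_m :=
  lift_pt p (fun k => ang (phi k) (major_x eps p k) (major_y eps p k)) + period z.

Lemma Ck_major l (A : set (flat R d)) eps k :
  Ck_on l A (fun p => major_x eps p k) /\ Ck_on l A (fun p => major_y eps p k).
Proof. by rewrite /major_x /major_y; case: (eps k); split; exact: Ck_entry. Qed.

Lemma Ck_mom l (A : set (flat R d)) k : open A ->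
  [/\ Ck_on l A (fun p => mom_a p k), Ck_on l A (fun p => mom_b p k),
      Ck_on l A (fun p => mom_c p k) & Ck_on l A (fun p => mom_d p k)].
Proof.
move=> oA; have E j : Ck_on l A (fun p : flat R d => p k j) by exact: Ck_entry.
have Mu (f g : flat R d -> R) : Ck_on l A f -> Ck_on l A g -> Ck_on l A (fun x => f x * g x).
  by move=> cf cg; exact: CkM.
have Ad (f g : flat R d -> R) : Ck_on l A f -> Ck_on l A g -> Ck_on l A (fun x => f x + g x).
  by move=> cf cg; exact: CkD.
have Ng (f : flat R d -> R) : Ck_on l A f -> Ck_on l A (fun x => - f x) by move=> cf; exact:
    CkN.
have C (c : R) : Ck_on l A (fun=> c) by exact: Ck_cst.
split; rewrite /mom_a /mom_b /mom_c /mom_d.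
- under eq_fun do rewrite !expr2.
  by apply: (Mu) => //; do ![apply: (Ad)|apply: (Mu)].
- by do ![apply: (Ad)|apply: (Ng)|apply: (Mu)].
- by do ![apply: (Ad)|apply: (Ng)|apply: (Mu)].
- under eq_fun do rewrite !expr2.
  by do ![apply: (Ad)|apply: (Ng)|apply: (Mu)].
Qed.

Lemma open_branch_dom eps phi : open (branch_dom eps phi).
Proof.
rewrite openE => p hp.
apply: (@filter_forall _ _ (fun k q =>
  0 < major_x eps q k * cos (phi k) + major_y eps q k * sin (phi k) /\
  0 < sign_of R (eps k) * mom_d q k) (nbhs p)) => k.
have [h1 h2] := hp k.
have [c1 c2] := @Ck_major 0 setT eps k.
have [_ _ _ c3] := @Ck_mom 0 setT k openT.
have C (c : R) : Ck_on 0 setT (fun _ : flat R d => c) by exact: Ck_cst.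
have n1 : \forall q \near p, 0 < major_x eps q k * cos (phi k) + major_y eps q k * sin (phi k).
  have cc : Ck_on 0 setT (fun q => major_x eps q k * cos (phi k) + major_y eps q k * sin (phi
      k)).
    exact: CkD (CkM openT c1 (C _)) (CkM openT c2 (C _)) openT.
  exact: (cvgr_gt _ (@Ck0_continuous _ _ _ _ cc p) _ h1).
have n2 : \forall q \near p, 0 < sign_of R (eps k) * mom_d q k.
  have cc : Ck_on 0 setT (fun q : flat R d => sign_of R (eps k) * mom_d q k).
    exact: (@CkM _ _ _ openT 0 _ _ (C (sign_of R (eps k))) c3).
  exact: (cvgr_gt _ (@Ck0_continuous _ _ _ _ cc p) _ h2).
by apply: filterS2 n1 n2.
Qed.

Lemma Ck_branch l eps phi z : Ck_on l (branch_dom eps phi) (branch eps phi z).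
Proof.
have oA := @open_branch_dom eps phi; set A := branch_dom eps phi in oA *.
have Mu q r s (F : flat R d -> 'M[R]_(q, r)) (G : flat R d -> 'M[R]_(r, s)) :
    Ck_on l A F -> Ck_on l A G -> Ck_on l A (fun x => F x *m G x).
  by exact: Ck_mulmx.
have Ad q r (F G : flat R d -> 'M[R]_(q, r)) :
    Ck_on l A F -> Ck_on l A G -> Ck_on l A (fun x => F x + G x).
  by move=> cF cG; exact: CkD.
have C q r (X : 'M[R]_(q, r)) : Ck_on l A (fun=> X) by exact: Ck_cst.
have col (f : flat R d -> 'I_d -> R) : (forall k, Ck_on l A (fun p => f p k)) ->
    Ck_on l A (fun p => \col_k f p k).
  by move=> cf; apply: Ck_mx => // i j; under eq_fun do rewrite mxE; exact: cf.
have Cr (c : R) : Ck_on l A (fun=> c) by exact: Ck_cst.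
have ca k := @Ck_mom l A k oA.
rewrite /branch /lift_pt /glue_coords.
apply: (Ad) => //; do ![apply: (Ad)]; apply: (Mu) => //; apply: (Mu) => //;
  apply: (col) => k; have [c1 c2 c3 _] := ca k.
- by apply: CkD.
- by apply: CkD.
- by apply: CkD.
- have [m1 m2] := @Ck_major l A eps k.
  by apply: Ck_ang => // p /(_ k)[].
Qed.

Lemma branch_eps eps phi p : branch_dom eps phi p -> major_signs p = eps.
Proof.
move=> h; apply/ffunP => k; rewrite ffunE; have [_] := h k; rewrite /sign_of.
case: (eps k); first by rewrite mul1r => /ltW ->.
by rewrite mulN1r oppr_gt0 => /lt_geF ->.
Qed.

Lemma branch_major eps phi p : branch_dom eps phi p ->
  major_arg eps p (fun k => ang (phi k) (major_x eps p k) (major_y eps p k)).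
Proof.
move=> h k; have [+ _] := h k; rewrite /major_x /major_y.
by case: (eps k) => h1; exact: angP.
Qed.

Lemma branchE eps phi z p : MZ p ->
  [/\ face_a (branch eps phi z p) = mom_a p, face_b (branch eps phi z p) = mom_b p,
      face_c (branch eps phi z p) = mom_c p & pr_t R e *m branch eps phi z p =
        bm^T *m (\col_k ang (phi k) (major_x eps p k) (major_y eps p k))
        + (2 * pi) *: (map_mx intr z)^T].
Proof.
move=> hp; rewrite /branch; set y := lift_pt _ _.
have [-> -> ->] := face_period y z; rewrite mulmxDr; have [_ _ _ ->] := pr_period z.
by have [-> -> -> ->] := lift_ptE e BK (fun k => ang (phi k) (major_x eps p k) (major_y eps p
    k)) hp.
Qed.

Lemma branch_above eps phi z p X : branch_dom eps phi p -> above p X ->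
  above (toric_sec eps (branch eps phi z p)) X.
Proof.
move=> hp oX; apply: toric_sec_period.
have [ha hb hc ht] := lift_ptE e BK (fun k => ang (phi k) (major_x eps p k) (major_y eps p k))
  (above_mu oX).
have eE := branch_eps hp.
have maj : major_arg (major_signs p) p (fun k => ang (phi k) (major_x eps p k) (major_y eps p
    k)).
  by rewrite eE; exact: branch_major.
by have := toric_sec_above BK oX ha hb hc maj ht; rewrite eE.
Qed.

Lemma mom_icone p k : mom_d p k != 0 -> in_icone (mom_a p k) (mom_b p k) (mom_c p k).
Proof.
move=> n0; have p2 : 0 < (2^-1 * mom_d p k) ^+ 2.
  by rewrite lt_neqAle eq_sym sqrf_eq0 mulf_neq0 // sqr_ge0.
have h : mom_b p k ^+ 2 + mom_c p k ^+ 2 < mom_a p k ^+ 2.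
  by rewrite -subr_gt0 opprD addrA mom_sqE.
split=> //; have [a0 _] := mom_cone p k; rewrite lt_neqAle a0 andbT eq_sym.
apply: contraTN h => /eqP ->; rewrite -leNgt expr0n /=.
by rewrite addr_ge0 ?sqr_ge0.
Qed.

Lemma branch_interior eps phi z p : MZ p -> branch_dom eps phi p ->
  interior_pts (branch eps phi z p).
Proof.
move=> hp h k; have [-> -> -> _] := branchE eps phi z hp.
apply: mom_icone; have [_] := h k; apply: contraTneq => ->.
by rewrite mulr0 ltxx.
Qed.

Lemma toric_sec_mom_d eps y k : interior_pts y -> 0 < sign_of R (eps k) * mom_d (toric_sec
    eps y) k.
Proof.
move=> cy; have [_ _ _ ->] := mom_polar_pt eps (face_t y) (icone_cone (cy k)).
have f0 : 0 < Num.sqrt (face_a y k ^+ 2 - face_b y k ^+ 2 - face_c y k ^+ 2).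
  by rewrite sqrtr_gt0; exact: icone_disc_gt0.
by rewrite mulrA pmulr_lgt0 // /sign_of; case: (eps k); lra.
Qed.

(** The arguments of [p] are those of the section shifted by an element of the
    Lie algebra of the torus; they serve as [phi], and the shift is then a period
    of [tau]. *)
Lemma branch_hit eps y p X : interior_pts y -> above (toric_sec eps y) X -> above p X ->
  exists phi z, branch_dom eps phi p /\ branch eps phi z p = y.
Proof.
move=> cy oy op; have [th hth E] := above_orbit oy op.
have [z' hz'] := torus_exp_eq1 hth.
pose phi k := face_t y k + th 0 k.
have r0 k : 0 < long_rad (face_a y k) (face_b y k) (face_c y k).
  by apply: long_rad_gt0; case: (cy k).
have Ep : p = polar_pt eps (face_a y) (face_b y) (face_c y) phi by rewrite E torus_act_polar.
have mE k : major_x eps p k = long_rad (face_a y k) (face_b y k) (face_c y k) * cos (phi k) /\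
    major_y eps p k = long_rad (face_a y k) (face_b y k) (face_c y k) * sin (phi k).
  rewrite /major_x /major_y Ep; have [-> -> -> ->] := polar_pt_entries eps (face_a y) (face_b
      y) (face_c y) phi k.
  by case: (eps k).
have inv k : [/\ mom_a p k = face_a y k, mom_b p k = face_b y k, mom_c p k = face_c y k &
    mom_d p k = mom_d (toric_sec eps y) k].
  have [ha hb hc hd] := mom_torus_act th (toric_sec eps y) k.
  have [ga gb gc _] := mom_polar_pt eps (face_t y) (icone_cone (cy k)).
  by rewrite E ha hb hc hd; split.
have hdom : branch_dom eps phi p.
  move=> k; have [hx hy] := mE k; have [h1 _] := ang_base (r0 k) hx hy.
  by split=> //; have [_ _ _ ->] := inv k; exact: toric_sec_mom_d.
exists phi, (- z'); split=> //.
have [ha hb hc ht] := branchE eps phi (- z') (above_mu op).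
have eqP (P : 'M[R]_(n, m)) (l : 'I_d -> R) w :
    (forall k, (bm *m (P *m w)) k 0 - l k = (bm *m (P *m y)) k 0 - l k) -> P *m w = P *m y.
  by move=> h; apply: (beta_mx_inj BK); apply/colP => k; have := h k => /addIr.
apply: coord_ext.
- apply: (eqP _ lam1) => k; have := congr1 (fun f => f k) ha; rewrite /face_a => ->.
  by have [-> _ _ _] := inv k.
- apply: (eqP _ lam2) => k; have := congr1 (fun f => f k) hb; rewrite /face_b => ->.
  by have [_ -> _ _] := inv k.
- apply: (eqP _ lam3) => k; have := congr1 (fun f => f k) hc; rewrite /face_c => ->.
  by have [_ _ -> _] := inv k.
rewrite ht.
have -> : \col_k ang (phi k) (major_x eps p k) (major_y eps p k) = B^T *m (pr_t R e *m y) +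
    th^T.
  apply/colP => k; rewrite !mxE; have [hx hy] := mE k.
  by have [_ ->] := ang_base (r0 k) hx hy; rewrite /phi /face_t mxE.
rewrite mulmxDr mulmxA -trmx_mul BK trmx1 mul1mx -trmx_mul.
have -> : th *m bm = beta u th by [].
rewrite hz' mul_mx_scalar linearZ /= map_mxN linearN /= scalerN.
by rewrite addrK.
Qed.

End LocalMap.

(** * The topology of the orbit space *)

Section QuotientTopology.
Local Open Scope ring_scope.
Variables (R : realType) (d n : nat) (u : 'I_d -> 'rV[int]_n).
Variables (lam1 lam2 lam3 : 'I_d -> R).
Notation MZ := (mu_zero u lam1 lam2 lam3).
Notation M := (hs_quotient u lam1 lam2 lam3).
Implicit Types (p : flat R d) (X : M) (O : set (flat R d)).

Lemma Ck_flat (V : normedModType R) l (A : set V) (F : V -> flat R d) : open A ->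
  (forall k, [/\ Ck_on l A (fun x => F x k 0), Ck_on l A (fun x => F x k 1),
    Ck_on l A (fun x => F x k 2%:R) & Ck_on l A (fun x => F x k 3%:R)]) ->
  Ck_on l A F.
Proof.
move=> oA h; apply: Ck_mx => // k j; have [h0 h1 h2 h3] := h k.
case: j => -[|[|[|[|//]]]] Hj.
- by rewrite (_ : Ordinal Hj = 0) //; apply/val_inj.
- by rewrite (_ : Ordinal Hj = 1) //; apply/val_inj.
- by rewrite (_ : Ordinal Hj = 2%:R) //; apply/val_inj.
- by rewrite (_ : Ordinal Hj = 3%:R) //; apply/val_inj.
Qed.

Lemma torus_act_continuous (th : 'rV[R]_d) :
  continuous (torus_act (torus_exp th) : flat R d -> flat R d).
Proof.
apply: Ck0_continuous; apply: (Ck_flat openT) => k.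
have E j : Ck_on 0 setT (fun p : flat R d => p k j) by exact: Ck_entry.
have C (c : R) : Ck_on 0 setT (fun _ : flat R d => c) by exact: Ck_cst.
have Mu (f g : flat R d -> R) : Ck_on 0 setT f -> Ck_on 0 setT g ->
    Ck_on 0 setT (fun x => f x * g x) by move=> cf cg; exact: (CkM openT).
have Ad (f g : flat R d -> R) : Ck_on 0 setT f -> Ck_on 0 setT g ->
    Ck_on 0 setT (fun x => f x + g x) by move=> cf cg; exact: (CkD _ _ openT).
have Ng (f : flat R d -> R) : Ck_on 0 setT f -> Ck_on 0 setT (fun x => - f x).
  by move=> cf; exact: (CkN openT).
split.
- rewrite (_ : (fun _ => _) = fun p : flat R d =>
    cos (th 0 k) * p k 0 + - (sin (th 0 k) * p k 1)).
    by apply: (Ad); [|apply: (Ng)]; apply: (Mu).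
  by apply/funext => p; have [] := torus_act_entries th p k.
- rewrite (_ : (fun _ => _) = fun p : flat R d =>
    cos (th 0 k) * p k 1 + sin (th 0 k) * p k 0).
    by apply: (Ad); apply: (Mu).
  by apply/funext => p; have [] := torus_act_entries th p k.
- rewrite (_ : (fun _ => _) = fun p : flat R d =>
    cos (th 0 k) * p k 2%:R + - (sin (th 0 k) * p k 3%:R)).
    by apply: (Ad); [|apply: (Ng)]; apply: (Mu).
  by apply/funext => p; have [] := torus_act_entries th p k.
- rewrite (_ : (fun _ => _) = fun p : flat R d =>
    cos (th 0 k) * p k 3%:R + sin (th 0 k) * p k 2%:R).
    by apply: (Ad); apply: (Mu).
  by apply/funext => p; have [] := torus_act_entries th p k.
Qed.

Definition orbit_image O : set M := [set X | exists2 p, O p & above p X].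

(** The group acts by homeomorphisms, so that translates of open sets are open. *)
Lemma open_orbit_image O : open O -> open (orbit_image O).
Proof.
move=> oO; rewrite /open /= /quotient_open openE => q [p Op op].
have oq : above (set_val q) (quotient_pi q) by exists q.
have [th hth E] := above_orbit oq op.
pose A := (torus_act (torus_exp th) : flat R d -> flat R d) @^-1` O.
have oA : open A by apply: open_comp => // x _; exact: torus_act_continuous.
have oA' : open ((set_val : MZ -> flat R d) @^-1` A) by exists A.
have : nbhs q ((set_val : MZ -> flat R d) @^-1` A).
  by apply: open_nbhs_nbhs; split=> //; rewrite /A /= -E.
apply: filterS => q' Aq'; exists (torus_act (torus_exp th) (set_val q')) => //.
by apply: above_act hth; exists q'.
Qed.

Lemma nbhs_above (W : set M) p X : open W -> W X -> above p X ->
  exists O, [/\ open O, O p & forall p' X', O p' -> above p' X' -> W X'].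
Proof.
move=> oW WX [q qp qX]; have [W0 oO EO] : open ((fun q : MZ => quotient_pi q) @^-1` W).
  exact: oW.
exists W0; split=> //.
  have : ((fun q : MZ => quotient_pi q) @^-1` W) q by rewrite /= qX.
  by rewrite -EO /= qp.
move=> p' X' Op' [q' qp' <-]; have : (set_val @^-1` W0) q' by rewrite /= qp'.
by rewrite EO.
Qed.

End QuotientTopology.

Section GoodLocus.
Local Open Scope ring_scope.
Variables (R : realType) (d n : nat) (u : 'I_d -> 'rV[int]_n).
Variables (lam1 lam2 lam3 : 'I_d -> R).
Variables (m : nat) (e : (n + n + (n + n))%N = m).
Variable B : 'M[R]_(n, d).
Hypothesis BK : B *m beta_mx R u = 1%:M.
Implicit Types (p : flat R d) (k : 'I_d) (y : 'cV[R]_m) (z : 'rV[int]_n).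
Implicit Types (eps : {ffun 'I_d -> bool}) (phi : 'I_d -> R).

Notation M := (hs_quotient u lam1 lam2 lam3).
Implicit Types (X : M).
Notation face_a := (face_a u lam1 e).
Notation face_b := (face_b u lam2 e).
Notation face_c := (face_c u lam3 e).
Notation face_t := (face_t e B).
Notation interior_pts := (interior_pts u lam1 lam2 lam3 e).
Notation toric_sec := (toric_sec u lam1 lam2 lam3 e B).
Notation goodset := (goodset u lam1 lam2 lam3 e).
Notation branch := (branch u lam1 lam2 lam3 e B).
Notation period := (period R e).

Lemma goodset_interior eps : goodset eps `<=` interior_pts. Proof. by move=> y []. Qed.

Lemma Ck_toric_sec l eps : Ck_on l interior_pts (toric_sec eps).
Proof.
have oc := @open_interior_pts R d n u lam1 lam2 lam3 m e.
have C (c : R) : Ck_on l interior_pts (fun=> c) by exact: Ck_cst.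
have Mu (f g : 'cV[R]_m -> R) : Ck_on l interior_pts f -> Ck_on l interior_pts g ->
    Ck_on l interior_pts (fun x => f x * g x) by move=> cf cg; exact: CkM.
have Ad (f g : 'cV[R]_m -> R) : Ck_on l interior_pts f -> Ck_on l interior_pts g ->
    Ck_on l interior_pts (fun x => f x + g x) by move=> cf cg; exact: CkD.
have Ng (f : 'cV[R]_m -> R) : Ck_on l interior_pts f -> Ck_on l interior_pts (fun x => - f x).
  by move=> cf; exact: CkN.
apply: Ck_flat => // k.
have ca : Ck_on l interior_pts (fun y => face_a y k) by exact: Ck_face_a.
have cb : Ck_on l interior_pts (fun y => face_b y k) by exact: Ck_face_b.
have cc : Ck_on l interior_pts (fun y => face_c y k) by exact: Ck_face_c.
have ct : Ck_on l interior_pts (fun y => face_t y k).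
  have := Ck_lin l (B^T *m pr_t R e) k 0 oc.
  by under eq_fun do rewrite -mulmxA subr0.
have [cs cC] := Ck_sincos oc ct.
have cr : Ck_on l interior_pts (fun y => long_rad (face_a y k) (face_b y k) (face_c y k)).
  apply: Ck_sqrt => //; last by apply: (Ad) => //; apply: Ck_face_f.
  by move=> y cy; rewrite addr_gt0 ?face_f_gt0 //; case: (cy k).
have ci : Ck_on l interior_pts (fun y => (long_rad (face_a y k) (face_b y k) (face_c y k))^-1).
  apply: CkV => // y cy; rewrite gt_eqF // long_rad_gt0 //; by case: (cy k).
have E j (F : 'cV[R]_m -> R) : (forall y, toric_sec eps y k j = F y) -> Ck_on l interior_pts
    F ->
    Ck_on l interior_pts (fun y => toric_sec eps y k j).
  by move=> h; rewrite (_ : (fun _ => _) = F) //; apply/funext.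
have pe y := polar_pt_entries eps (face_a y) (face_b y) (face_c y) (face_t y) k.
move: pe; case: (eps k) => pe; split.
- apply: (E) => [y|]; first by have [-> _ _ _] := pe y; reflexivity.
  by apply: (Mu).
- apply: (E) => [y|]; first by have [_ -> _ _] := pe y; reflexivity.
  by apply: (Mu).
- apply: (E) => [y|]; first by have [_ _ -> _] := pe y; reflexivity.
  by do ![assumption|apply: (Mu)|apply: (Ad)|apply: (Ng)].
- apply: (E) => [y|]; first by have [_ _ _ ->] := pe y; reflexivity.
  by do ![assumption|apply: (Mu)|apply: (Ad)|apply: (Ng)].
- apply: (E) => [y|]; first by have [-> _ _ _] := pe y; reflexivity.
  by do ![assumption|apply: (Mu)|apply: (Ad)|apply: (Ng)].
- apply: (E) => [y|]; first by have [_ -> _ _] := pe y; reflexivity.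
  by do ![assumption|apply: (Mu)|apply: (Ad)|apply: (Ng)].
- apply: (E) => [y|]; first by have [_ _ -> _] := pe y; reflexivity.
  by apply: (Mu).
- apply: (E) => [y|]; first by have [_ _ _ ->] := pe y; reflexivity.
  by apply: (Mu).
Qed.

Lemma toric_sec_above_ex eps y : interior_pts y -> exists X, above (toric_sec eps y) X.
Proof.
by move=> cy; apply: above_ex; apply: toric_sec_mu => k; exact: icone_cone (cy k).
Qed.

Definition branch_pre eps phi z (A : set 'cV[R]_m) : set (flat R d) :=
  [set p | branch_dom eps phi p /\ A (branch eps phi z p)].

Lemma open_branch_pre eps phi z A : open A -> open (branch_pre eps phi z A).
Proof.
move=> oA; rewrite openE => p [dp Ap].
have cb : {for p, continuous (branch eps phi z)}.
  exact: (@Ck_branch _ _ _ u lam1 lam2 lam3 _ e B 0 eps phi z).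
have n1 : \forall q \near p, branch_dom eps phi q.
  exact: open_nbhs_nbhs (conj (@open_branch_dom _ _ eps phi) dp).
have n2 : \forall q \near p, A (branch eps phi z q).
  by apply: cb; exact: open_nbhs_nbhs (conj oA Ap).
by apply: filterS2 n1 n2.
Qed.

Definition good_locus : set M :=
  [set X | exists eps y, goodset eps y /\ above (toric_sec eps y) X].

Lemma open_good_locus : open good_locus.
Proof.
rewrite openE => X [eps [y [gy oX]]].
have [phi [z [dp Ep]]] := branch_hit BK (goodset_interior gy) oX oX.
have oO : open (branch_pre eps phi z (goodset eps)).
  by apply: open_branch_pre; exact: open_goodset.
have : nbhs X (@orbit_image R d n u lam1 lam2 lam3 (branch_pre eps phi z (goodset eps))).
  apply: open_nbhs_nbhs; split; first exact: open_orbit_image.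
  by exists (toric_sec eps y) => //; split=> //; rewrite Ep.
apply: filterS => X' [p [dp' gp] oX']; exists eps, (branch eps phi z p).
by split=> //; exact: branch_above.
Qed.

Lemma toric_sec_inj_period eps eps' y y' X : interior_pts y -> interior_pts y' ->
  above (toric_sec eps y) X -> above (toric_sec eps' y') X ->
  eps = eps' /\ exists z, y' = y + period z.
Proof.
move=> cy cy' oy oy'; have [ee ha hb hc [z hz]] := toric_sec_inj BK cy cy' oy oy'.
split=> //; exists z; have [za zb zc zt] := pr_period R e z.
by apply: (@coord_ext R n m e); rewrite mulmxDr ?za ?zb ?zc ?zt ?addr0 //.
Qed.

Lemma toric_fields_period eps y z : [/\ toric_g u lam1 lam2 lam3 e eps (y + period z)
    = toric_g u lam1 lam2 lam3 e eps y,
  toric_I u lam1 lam2 lam3 e eps (y + period z) = toric_I u lam1 lam2 lam3 e eps y,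
  toric_S u lam1 lam2 lam3 e eps (y + period z) = toric_S u lam1 lam2 lam3 e eps y &
  toric_T u lam1 lam2 lam3 e eps (y + period z) = toric_T u lam1 lam2 lam3 e eps y].
Proof.
have [ea eb ec] := face_period u lam1 lam2 lam3 e y z.
have ef k : face_f u lam1 lam2 lam3 e (y + period z) k = face_f u lam1 lam2 lam3 e y k.
  by rewrite /face_f ea eb ec.
have ev k : face_V u lam1 lam2 lam3 e eps (y + period z) k = face_V u lam1 lam2 lam3 e eps y k.
  by rewrite /face_V ef.
have eq k : face_A u lam1 lam2 lam3 e eps (y + period z) k = face_A u lam1 lam2 lam3 e eps y k.
  by rewrite /face_A ef ev ea.
have eV : gh_V u lam1 lam2 lam3 e eps (y + period z) = gh_V u lam1 lam2 lam3 e eps y.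
  by rewrite /gh_V; congr (_ *m diag_mx _ *m _); apply/rowP => k; rewrite mxE [RHS]mxE ev.
have e1 : gh_Ab u lam1 lam2 lam3 e eps (y + period z) = gh_Ab u lam1 lam2 lam3 e eps y.
  by rewrite /gh_Ab; congr (_ *m diag_mx _ *m _); apply/rowP => k; rewrite mxE [RHS]mxE eq ec.
have e2 : gh_Ac u lam1 lam2 lam3 e eps (y + period z) = gh_Ac u lam1 lam2 lam3 e eps y.
  rewrite /gh_Ac (_ : \row_k _ = \row_k (face_A u lam1 lam2 lam3 e eps y k * face_b y k)) //.
  by apply/rowP => k; rewrite mxE [RHS]mxE eq eb.
by rewrite /toric_g /toric_I /toric_S /toric_T /hat_W /hat_V /hat_Ab /hat_Ac /nondeg eV e1 e2.
Qed.

End GoodLocus.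

(** * Charts of the good locus *)

Section Charts.
Local Open Scope ring_scope.
Variables (R : realType) (d n : nat) (u : 'I_d -> 'rV[int]_n).
Variables (lam1 lam2 lam3 : 'I_d -> R).
Variables (m : nat) (e : (n + n + (n + n))%N = m).
Variable B : 'M[R]_(n, d).
Hypothesis BK : B *m beta_mx R u = 1%:M.
Implicit Types (p : flat R d) (k : 'I_d) (y : 'cV[R]_m) (z : 'rV[int]_n).
Implicit Types (eps : {ffun 'I_d -> bool}) (phi : 'I_d -> R) (t : 'cV[R]_n).

Notation M := (hs_quotient u lam1 lam2 lam3).
Implicit Types (X : M).
Notation interior_pts := (interior_pts u lam1 lam2 lam3 e).
Notation toric_sec := (toric_sec u lam1 lam2 lam3 e B).
Notation goodset := (goodset u lam1 lam2 lam3 e).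
Notation branch := (branch u lam1 lam2 lam3 e B).
Notation branch_pre := (branch_pre u lam1 lam2 lam3 e B).
Notation period := (period R e).
Notation U := (@good_locus R d n u lam1 lam2 lam3 m e B).
Implicit Types x : U.

(** Of side [2 pi], hence without two points that differ by a period. *)
Definition angle_box t : set 'cV[R]_m :=
  [set y | forall j, `|(pr_t R e *m y) j 0 - t j 0| < pi].

Definition toric_cod eps t : set 'cV[R]_m := goodset eps `&` angle_box t.
Definition toric_dom eps t : set U :=
  [set x | exists2 y, toric_cod eps t y & above (toric_sec eps y) (set_val x)].

(** [x0] is the value where no point of [U] lies below the section. *)
Definition toric_inv (x0 : U) eps y : U :=
  xget x0 [set x : U | above (toric_sec eps y) (set_val x)].
Definition toric_map eps t (x : U) : 'cV[R]_m :=
  xget 0 [set y | toric_cod eps t y /\ above (toric_sec eps y) (set_val x)].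

Lemma open_angle_box t : open (angle_box t).
Proof.
rewrite openE => y hy.
apply: (@filter_forall _ _ (fun j y => `|(pr_t R e *m y) j 0 - t j 0| < pi) (nbhs y)) => j.
have cl : Ck_on 0 setT (fun y : 'cV[R]_m => (pr_t R e *m y) j 0 - t j 0).
  exact: Ck_lin openT.
have cy : {for y, continuous (fun y : 'cV[R]_m => (pr_t R e *m y) j 0 - t j 0)} by exact: cl.
have h := hy j; rewrite ltr_norml in h; have /andP[h1 h2] := h.
have n1 : \forall q \near y, - pi < (pr_t R e *m q) j 0 - t j 0.
  exact: (cvgr_gt _ cy _ h1).
have n2 : \forall q \near y, (pr_t R e *m q) j 0 - t j 0 < pi.
  exact: (cvgr_lt _ cy _ h2).
by apply: filterS2 n1 n2 => q q1 q2; rewrite ltr_norml q1 q2.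
Qed.

Lemma open_toric_cod eps t : open (toric_cod eps t).
Proof. by apply: openI; [exact: open_goodset|exact: open_angle_box]. Qed.

Lemma toric_cod_interior eps t y : toric_cod eps t y -> interior_pts y.
Proof. by move=> [] /goodset_interior. Qed.

Lemma toric_invP x0 eps y : goodset eps y -> above (toric_sec eps y) (set_val (toric_inv x0
    eps y)).
Proof.
move=> gy; have [X oX] := toric_sec_above_ex B eps (goodset_interior gy).
have UX : U X by exists eps, y.
pose x : U := exist _ X (mem_set UX).
apply: (@xgetPex _ x0 [set x : U | above (toric_sec eps y) (set_val x)]); exists x.
by rewrite /= set_valE.
Qed.

Lemma above_val_inj p x x' : above p (set_val x) -> above p (set_val x') -> x = x'.
Proof. by move=> h h'; apply: val_inj; exact: above_uniq h h'. Qed.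

Lemma angle_box_period t y z : angle_box t y -> angle_box t (y + period z) -> z = 0.
Proof.
move=> h1 h2; apply/rowP => j; rewrite [RHS]mxE.
have [_ _ _ zt] := pr_period R e z.
have := h2 j; have := h1 j; rewrite mulmxDr zt !mxE.
set a := (\sum__ _); set b := t j 0 => k1 k2.
have : `|2 * pi * (z 0 j)%:~R| < 2 * pi :> R.
  have -> : 2 * pi * (z 0 j)%:~R = (a + 2 * pi * (z 0 j)%:~R - b) - (a - b) by ring.
  by apply: le_lt_trans (ler_normB _ _) _; move: k1 k2; lra.
have p0 : 0 < 2 * pi :> R by rewrite mulr_gt0 // pi_gt0.
rewrite normrM (gtr0_norm p0) gtr_pMr // -intr_norm -[1]/(1%:~R) ltr_int.
by move=> h; apply/eqP; rewrite -normr_le0; move: h; case: (`|_|%R) => -[].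
Qed.

Lemma toric_cod_inj eps t y y' X : toric_cod eps t y -> toric_cod eps t y' ->
  above (toric_sec eps y) X -> above (toric_sec eps y') X -> y = y'.
Proof.
move=> cy cy' oy oy'.
have [_ [z E]] := toric_sec_inj_period BK (toric_cod_interior cy) (toric_cod_interior cy') oy
    oy'.
have z0 : z = 0 by apply: (@angle_box_period t y); [exact: cy.2|rewrite -E; exact: cy'.2].
have [za zb zc zt] := pr_period R e z.
apply: (@coord_ext R n m e); rewrite E mulmxDr ?za ?zb ?zc ?zt ?addr0 //.
by rewrite z0 map_mx0 trmx0 scaler0 addr0.
Qed.

Lemma toric_mapP eps t x : toric_dom eps t x ->
  toric_cod eps t (toric_map eps t x) /\ above (toric_sec eps (toric_map eps t x)) (set_val x).
Proof. move=> [y cy oy].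
apply: (@xgetPex _ 0 [set y | toric_cod eps t y /\ above (toric_sec eps y) (set_val x)]).
by exists y. Qed.

Lemma toric_map_eq eps t x y : toric_cod eps t y -> above (toric_sec eps y) (set_val x) ->
  toric_dom eps t x /\ toric_map eps t x = y.
Proof.
move=> cy oy; have dx : toric_dom eps t x by exists y.
by split=> //; have [c' o'] := toric_mapP dx; exact: toric_cod_inj c' cy o' oy.
Qed.

(** Near any point upstairs, the coordinates of the orbit are given by a branch,
    which is defined and smooth on an open set of flat space.  Continuity of the
    coordinates, openness of their domain and smoothness on the zero set of the
    moment map all follow. *)
Lemma toric_map_local eps t x p : toric_dom eps t x -> above p (set_val x) ->
  exists phi z, [/\ branch_pre eps phi z (toric_cod eps t) p,
    branch eps phi z p = toric_map eps t x &
    forall p' x', branch_pre eps phi z (toric_cod eps t) p' -> above p' (set_val x') ->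
      toric_dom eps t x' /\ toric_map eps t x' = branch eps phi z p'].
Proof.
move=> dx op; have [cc oc] := toric_mapP dx.
have [phi [z [dp E]]] := branch_hit BK (toric_cod_interior cc) oc op.
exists phi, z; split=> //; first by split=> //; rewrite E.
move=> p' x' [dp' cp'] op'; apply: toric_map_eq => //.
exact: branch_above.
Qed.

Lemma open_val (W : set M) : open W -> open ((set_val : U -> M) @^-1` W).
Proof. by move=> oW; exists W. Qed.

Lemma nbhs_branch eps phi z (A : set 'cV[R]_m) p x : open A ->
  branch_pre eps phi z A p -> above p (set_val x) ->
  nbhs x [set x' | exists2 p', branch_pre eps phi z A p' & above p' (set_val x')].
Proof.
move=> oA bp op.
apply: open_nbhs_nbhs; split; last by exists p.
have := @open_branch_pre R d n u lam1 lam2 lam3 m e B eps phi z A oA.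
by move=> /(@open_orbit_image R d n u lam1 lam2 lam3)/open_val.
Qed.

Lemma open_toric_dom eps t : open (toric_dom eps t).
Proof.
rewrite openE => x dx; have [p op] := above_surj (set_val x).
have [phi [z [bp _ H]]] := toric_map_local dx op.
apply: filterS (nbhs_branch (@open_toric_cod eps t) bp op) => x' [p' bp' op'].
by have [] := H p' x' bp' op'.
Qed.

Lemma toric_map_continuous eps t x : toric_dom eps t x -> {for x, continuous (toric_map eps t)}.
Proof.
move=> dx N0 nN; have [p op] := above_surj (set_val x).
have [phi [z [[dp cp] E H]]] := toric_map_local dx op.
pose A := toric_cod eps t `&` interior N0.
have oA : open A by apply: openI; [exact: open_toric_cod|exact: open_interior].
have Ap : branch_pre eps phi z A p by split=> //; split=> //; rewrite E; exact: nN.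
apply: filterS (nbhs_branch oA Ap op) => x' [p' [dp' [cp' ip']] op'].
have [_ E'] := H p' x' (conj dp' cp') op'.
by rewrite /= E'; exact: interior_subset ip'.
Qed.

Lemma toric_inv_continuous x0 eps t y : toric_cod eps t y -> {for y, continuous (toric_inv x0
    eps)}.
Proof.
move=> cy N0 nN; have oy := toric_invP x0 cy.1.
have [_ [[[W oW <-] Wx] WN]] : exists C, open_nbhs (toric_inv x0 eps y) C /\ C `<=` N0.
  by have := nN; rewrite nbhsE => -[C hC CN]; exists C.
have [W1 [oW1 W1p H]] := nbhs_above oW Wx oy.
have cs : {for y, continuous (toric_sec eps)} by exact: (@Ck_toric_sec _ _ _ u lam1 lam2 lam3
    _ e B 0 eps y (toric_cod_interior cy)).
have n1 : \forall q \near y, W1 (toric_sec eps q) by apply: cs; exact: open_nbhs_nbhs (conj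
    oW1 W1p).
have n2 : \forall q \near y, goodset eps q.
  exact: open_nbhs_nbhs (conj (@open_goodset _ _ _ u lam1 lam2 lam3 _ e eps) cy.1).
apply: filterS2 n1 n2 => q Wq gq; apply: WN.
exact: H Wq (toric_invP x0 gq).
Qed.

Lemma toric_map_cod eps t x : toric_dom eps t x -> toric_cod eps t (toric_map eps t x).
Proof. by move=> /toric_mapP[]. Qed.

Lemma toric_inv_dom x0 eps t y : toric_cod eps t y -> toric_dom eps t (toric_inv x0 eps y).
Proof. by move=> cy; exists y => //; exact: toric_invP cy.1. Qed.

Lemma toric_mapK x0 eps t x : toric_dom eps t x -> toric_inv x0 eps (toric_map eps t x) = x.
Proof.
move=> dx; have [[gy _] oy] := toric_mapP dx.
exact: above_val_inj (toric_invP x0 gy) oy.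
Qed.

Lemma toric_invK x0 eps t y : toric_cod eps t y -> toric_map eps t (toric_inv x0 eps y) = y.
Proof. by move=> cy; have [] := toric_map_eq cy (toric_invP x0 cy.1). Qed.

Definition toric_chart (x0 : U) eps t : chart R U m :=
  Chart (@open_toric_dom eps t) (@open_toric_cod eps t) (@toric_map_cod eps t)
    (@toric_inv_dom x0 eps t) (@toric_mapK x0 eps t) (@toric_invK x0 eps t)
    (@toric_map_continuous eps t) (@toric_inv_continuous x0 eps t).

(** The point of [U] serves only as the default value of [toric_inv]. *)
Notation index := (U * ({ffun 'I_d -> bool} * 'cV[R]_n))%type.

Definition toric_charts (i : index) : chart R U m := toric_chart i.1 i.2.1 i.2.2.

Lemma toric_cover x : exists i, chart_dom (toric_charts i) x.
Proof.
have [eps [y [gy oy]]] : U (set_val x) by exact: set_mem (valP x).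
exists (x, (eps, pr_t R e *m y)); exists y => //; split=> // j.
by rewrite subrr normr0 pi_gt0.
Qed.

(** Two sections over the same orbit have the same signs, and coordinates that
    differ by a period, which the section does not see; by continuity the period
    is locally constant. *)
Lemma transition_near (i j : index) y :
  transition_dom (toric_charts i) (toric_charts j) y ->
  i.2.1 = j.2.1 /\ exists z, \forall y' \near y,
    transition_dom (toric_charts i) (toric_charts j) y' /\
    transition (toric_charts i) (toric_charts j) y' = y' + period z.
Proof.
move: i j => [x0 [eps t]] [x1 [eps' t']] [/= cy dx].
have oy := toric_invP x0 cy.1; have [cy' oy'] := toric_mapP dx.
have [ee [z E]] := toric_sec_inj_period BK (toric_cod_interior cy) (toric_cod_interior cy')
    oy oy'.
split=> //; exists z; subst eps'.
have tr : {for y, continuous (fun y' => y' + period z)}.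
  have c0 : Ck_on 0 setT (fun y' : 'cV[R]_m => y' + period z).
    apply: CkD; [|exact: Ck_cst|exact: openT].
    by apply: Ck_mx; [exact: openT|move=> a b; exact: Ck_entry].
  exact: (c0 y I).
have n1 : \forall y' \near y, toric_cod eps t y' by exact: open_nbhs_nbhs (conj
    (@open_toric_cod eps t) cy).
have n2 : \forall y' \near y, toric_cod eps t' (y' + period z).
  apply: tr; apply: open_nbhs_nbhs; split; first exact: open_toric_cod.
  by rewrite -E.
apply: filterS2 n1 n2 => y' c1 c2.
have o2 := toric_sec_period BK z (toric_invP x0 c1.1).
have [d2 e2] := toric_map_eq c2 o2.
by [].
Qed.

Lemma toric_smooth (i j : index) :
  smooth_on (transition_dom (toric_charts i) (toric_charts j))
            (transition (toric_charts i) (toric_charts j)).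
Proof.
move=> l; apply: Ck_local => y dy; have [_ [z nz]] := transition_near dy.
exists (interior [set y' | transition (toric_charts i) (toric_charts j) y' = y' + period z]).
  by apply: filterS nz => y' [].
apply: (@Ck_ext _ _ _ l _ (fun y' => y' + period z)); first exact: open_interior.
  by move=> y' /set_mem /interior_subset.
apply: CkD; [|exact: Ck_cst|exact: open_interior].
by apply: Ck_mx; [exact: open_interior|move=> a b; exact: Ck_entry].
Qed.

Definition toric_atlas : atlas R U m := Atlas toric_cover toric_smooth.

Lemma derive_transition (i j : index) y v :
  transition_dom (toric_charts i) (toric_charts j) y ->
  'D_v (transition (toric_charts i) (toric_charts j)) y = v.
Proof.
move=> /transition_near[_ [z nz]].
rewrite (@near_eq_derive _ _ _ _ (fun y' => y' + period z)); last first.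
  by apply: filterS nz => y' [].
rewrite (@deriveD _ _ _ (fun y' : 'cV[R]_m => y') (fun=> period z)) //.
by rewrite derive_id (derive_cst (period z)) addr0.
Qed.

Lemma toric_quotient_chart (i : index) : quotient_chart (toric_charts i).
Proof.
move: i => [x0 [eps t]]; split=> [p x op dx|y cy].
  have [phi [z [bp _ H]]] := toric_map_local dx op.
  exists (branch_pre eps phi z (toric_cod eps t)), (branch eps phi z); split=> //.
  - exact: (@open_branch_pre R d n u lam1 lam2 lam3 m e B eps phi z _ (@open_toric_cod eps t)).
  - move=> l; apply: (@Ck_subset _ _ _ l (branch_dom eps phi)); first by move=> q [].
    exact: Ck_branch.
  - by move=> p' x' bp' op' _; have [_ E] := H p' x' bp' op'; exact: esym E.
exists (toric_cod eps t), (toric_sec eps); split=> //; split=> //.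
- exact: open_toric_cod.
- move=> l; apply: (@Ck_subset _ _ _ l interior_pts); first by move=> q; exact:
    toric_cod_interior.
  exact: Ck_toric_sec.
- by move=> q cq; exact: toric_invP cq.1.
Qed.

End Charts.

(** * Density *)

Section Density.
Local Open Scope ring_scope.
Variables (R : realType) (d n : nat) (u : 'I_d -> 'rV[int]_n).
Variables (lam1 lam2 lam3 : 'I_d -> R).
Variables (m : nat) (e : (n + n + (n + n))%N = m).
Variable B : 'M[R]_(n, d).
Hypothesis BK : B *m beta_mx R u = 1%:M.
Implicit Types (p : flat R d) (k : 'I_d) (y : 'cV[R]_m).
Implicit Types (eps : {ffun 'I_d -> bool}).

Notation MZ := (mu_zero u lam1 lam2 lam3).
Notation M := (hs_quotient u lam1 lam2 lam3).
Implicit Types (X : M).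
Notation face_a := (face_a u lam1 e).
Notation face_b := (face_b u lam2 e).
Notation face_c := (face_c u lam3 e).
Notation interior_pts := (interior_pts u lam1 lam2 lam3 e).
Notation toric_sec := (toric_sec u lam1 lam2 lam3 e B).
Notation nondeg := (nondeg u lam1 lam2 lam3 e).
Notation U := (@good_locus R d n u lam1 lam2 lam3 m e B).

Lemma interior_pts_nonempty : CInt u lam1 lam2 lam3 !=set0 -> interior_pts !=set0.
Proof.
move=> [x [Kx Wx]].
pose y : 'cV[R]_m := glue_coords e x.1^T (\col_j complex.Re (x.2 0 j))
  (\col_j complex.Im (x.2 0 j)) 0.
exists y => k; have [ya yb yc _] := glue_coordsE e x.1^T
  (\col_j complex.Re (x.2 0 j)) (\col_j complex.Im (x.2 0 j)) 0.
have ea : face_a y k = coord_a u lam1 x k.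
  rewrite /face_a ya mxE /coord_a; congr (_ - _); apply: eq_bigr => j _.
  by rewrite !mxE mulrC.
have ebc : coord_b u lam2 lam3 x k = (face_b y k +i* face_c y k)%C.
  rewrite /coord_b (eq_bigr (fun j => ((complex.Re (x.2 0 j) * (u k 0 j)%:~R)
    +i* (complex.Im (x.2 0 j) * (u k 0 j)%:~R))%C)); last first.
    move=> j _; have -> : (u k 0 j)%:~R = ((u k 0 j)%:~R +i* 0)%C :> R[i].
      by rewrite -[RHS]/((u k 0 j)%:~R%:C)%C rmorph_int.
    case: (x.2 0 j) => a b /=.
    by apply/eqP; rewrite eq_complex /=; apply/andP; split; apply/eqP; ring.
  rewrite complex_sum /face_b /face_c yb yc !mxE.
  apply/eqP; rewrite eq_complex /=; apply/andP; split; apply/eqP; congr (_ - _);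
    by apply: eq_bigr => j _; rewrite !mxE mulrC.
have lt : Normc.normc (coord_b u lam2 lam3 x k) < coord_a u lam1 x k.
  rewrite lt_neqAle; apply/andP; split; last exact: (Kx k I).
  by apply/eqP => E; apply: Wx; exists k.
rewrite ebc -ea in lt; have n0 : 0 <= Normc.normc (face_b y k +i* face_c y k)%C by exact:
    sqrtr_ge0.
split; first exact: le_lt_trans lt.
rewrite -normc_sq; rewrite ltr_pXn2r ?nnegrE //.
exact: ltW (le_lt_trans n0 lt).
Qed.

Section Path.
Variables (a b c : R -> R) (a0 a1 b0 b1 c0 c1 : R).
Hypothesis cone0 : in_cone a0 b0 c0.
Hypothesis cone1 : in_icone a1 b1 c1.
Hypothesis aE : forall s, a s = a0 + s * (a1 - a0).
Hypothesis bE : forall s, b s = b0 + s * (b1 - b0).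
Hypothesis cE : forall s, c s = c0 + s * (c1 - c0).

(** The sum of a point of the cone and an interior point is an interior point, by
    the Cauchy-Schwarz inequality. *)
Lemma path_icone s : 0 < s <= 1 -> in_icone (a s) (b s) (c s).
Proof.
move=> /andP[s0 s1]; have [a00 h0] := cone0; have [a10 h1] := cone1.
rewrite aE bE cE.
have -> : a0 + s * (a1 - a0) = (1 - s) * a0 + s * a1 by ring.
have -> : b0 + s * (b1 - b0) = (1 - s) * b0 + s * b1 by ring.
have -> : c0 + s * (c1 - c0) = (1 - s) * c0 + s * c1 by ring.
have t0 : 0 <= 1 - s by rewrite subr_ge0.
split; first by rewrite ltr_wpDl ?mulr_ge0 ?mulr_gt0.
have cs : b0 * b1 + c0 * c1 <= a0 * a1.
  have a01 : 0 <= a0 * a1 by rewrite mulr_ge0 // ltW.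
  have sq : (b0 * b1 + c0 * c1) ^+ 2 <= (a0 * a1) ^+ 2.
    apply: le_trans (_ : (b0 ^+ 2 + c0 ^+ 2) * (b1 ^+ 2 + c1 ^+ 2) <= _).
      rewrite -subr_ge0.
      have -> : (b0 ^+ 2 + c0 ^+ 2) * (b1 ^+ 2 + c1 ^+ 2) - (b0 * b1 + c0 * c1) ^+ 2
        = (b0 * c1 - c0 * b1) ^+ 2 by ring.
      exact: sqr_ge0.
    rewrite exprMn ler_pM ?addr_ge0 ?sqr_ge0 //; exact: ltW.
  apply: le_trans (ler_norm _) _.
  by rewrite -(@ler_pXn2r _ 2) ?nnegrE // real_normK ?num_real.
rewrite -subr_gt0.
have -> : ((1 - s) * a0 + s * a1) ^+ 2 -
    (((1 - s) * b0 + s * b1) ^+ 2 + ((1 - s) * c0 + s * c1) ^+ 2)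
  = (1 - s) ^+ 2 * (a0 ^+ 2 - (b0 ^+ 2 + c0 ^+ 2))
    + 2 * (1 - s) * s * (a0 * a1 - (b0 * b1 + c0 * c1))
    + s ^+ 2 * (a1 ^+ 2 - (b1 ^+ 2 + c1 ^+ 2)) by ring.
apply: ltr_wpDl; last by rewrite mulr_gt0 ?exprn_gt0 // subr_gt0.
rewrite addr_ge0 // ?mulr_ge0 ?sqr_ge0 ?subr_ge0 //; exact: ltW.
Qed.

Let aff_cvg (f : R -> R) f0 f1 : (forall s, f s = f0 + s * (f1 - f0)) ->
  {for 0, continuous f}.
Proof.
move=> fE; rewrite (_ : f = fun s => f0 + s * (f1 - f0)); last exact/funext.
apply: (@cvgD _ _ _ _ _ (fun=> f0) (fun s => s * (f1 - f0))); first exact: cvg_cst.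
by apply: (@cvgM _ _ _ _ (fun s => s) (fun=> f1 - f0)); [exact: cvg_id|exact: cvg_cst].
Qed.

Let ca : {for 0, continuous a}. Proof. exact: aff_cvg aE. Qed.
Let cb : {for 0, continuous b}. Proof. exact: aff_cvg bE. Qed.
Let cc : {for 0, continuous c}. Proof. exact: aff_cvg cE. Qed.

Lemma rad_cvg : {for 0, continuous (fun s => long_rad (a s) (b s) (c s))}.
Proof.
have sq (f : R -> R) : {for 0, continuous f} -> {for 0, continuous (fun s => f s ^+ 2)}.
  by move=> cf; exact: (cvgM cf cf).
have sqrt (f : R -> R) : {for 0, continuous f} -> {for 0, continuous (fun s => Num.sqrt (f s))}.
  move=> cf; apply: (@continuous_comp _ _ _ f Num.sqrt 0 cf).
  exact: sqrt_continuous.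
apply: (sqrt); apply: (cvgD ca); apply: (sqrt).
exact: (cvgB (cvgB (sq _ ca) (sq _ cb)) (sq _ cc)).
Qed.

(** The coordinate of smaller modulus.  If the segment starts at the vertex of the
    cone, the quotient is bounded by [sqrt (a s)], which tends to zero. *)
Lemma minor_cvg (C S : R) : C ^+ 2 + S ^+ 2 = 1 ->
  (c s * C + b s * S) / long_rad (a s) (b s) (c s) @[s --> 0^'+]
    --> (c 0 * C + b 0 * S) / long_rad (a 0) (b 0) (c 0).
Proof.
move=> CS; have a00 : a 0 = a0 by rewrite aE mul0r addr0.
have b00 : b 0 = b0 by rewrite bE mul0r addr0.
have c00 : c 0 = c0 by rewrite cE mul0r addr0.
have [a0z|a0n] := eqVneq a0 0; last first.
  have r0 : long_rad (a 0) (b 0) (c 0) != 0.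
    rewrite gt_eqF // long_rad_gt0 // a00 lt_neqAle eq_sym a0n.
    by case: cone0.
  apply: cvg_at_right_filter.
  have C' (x : R) : x @[s --> (0 : R)] --> x by exact: cvg_cst.
  exact: (cvgM (cvgD (cvgM cc (C' C)) (cvgM cb (C' S))) (cvgV r0 rad_cvg)).
have [b0z c0z] : b0 = 0 /\ c0 = 0.
  have [_] := cone0; rewrite a0z expr0n /= => h.
  have /eqP : b0 ^+ 2 + c0 ^+ 2 = 0 by apply/le_anti; rewrite h addr_ge0 ?sqr_ge0.
  by rewrite paddr_eq0 ?sqr_ge0 // !sqrf_eq0 => /andP[/eqP-> /eqP->].
rewrite c00 b00 b0z c0z !mul0r addr0 mul0r.
have sa : Num.sqrt (a s) @[s --> 0^'+] --> (0 : R).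
  have h : Num.sqrt (a 0) = 0 by rewrite a00 a0z sqrtr0.
  rewrite -[X in _ --> X]h; apply: cvg_at_right_filter.
  by apply: (@continuous_comp _ _ _ a Num.sqrt 0 ca); exact: sqrt_continuous.
have bnd : \forall s \near 0^'+,
    `|(c s * C + b s * S) / long_rad (a s) (b s) (c s)| <= Num.sqrt (a s).
  have n1 : \forall s \near (0 : R)^'+, 0 < s by exact: nbhs_right_gt.
  have n2 : \forall s \near (0 : R)^'+, s < 1 by exact: nbhs_right_lt.
  apply: filterS2 n1 n2 => s s0 s1.
  have ic : in_icone (a s) (b s) (c s) by apply: path_icone; rewrite s0 ltW.
  have [as0 h] := ic; have [r2 _] := long_radE (icone_cone ic).
  have r0 := long_rad_gt0 (b s) (c s) as0.
  rewrite -(@ler_pXn2r _ 2) ?nnegrE ?sqrtr_ge0 // real_normK ?num_real //.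
  rewrite sqr_sqrtr; last exact: ltW.
  rewrite expr_div_n ler_pdivrMr ?exprn_gt0 // r2.
  apply: le_trans (_ : b s ^+ 2 + c s ^+ 2 <= _).
    rewrite -subr_ge0.
    have -> : b s ^+ 2 + c s ^+ 2 - (c s * C + b s * S) ^+ 2
        = (c s * S - b s * C) ^+ 2.
      by rewrite -[X in X - _]mulr1 -CS; ring.
    exact: sqr_ge0.
  apply: le_trans (ltW h) _; rewrite expr2 ler_pM2l // lerDl sqrtr_ge0 //.
apply: (@norm_cvg0 _ _ _ _ _).
by apply: (@squeeze_cvgr _ _ _ _ (fun=> 0) (fun s => Num.sqrt (a s))) => //;
  [apply: filterS bnd => s ->; rewrite normr_ge0|exact: cvg_cst].
Qed.

End Path.

Let bm := beta_mx R u.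

(** Points upstairs over the combinatorial interior come close to any point [p]
    of the zero set of the moment map: with the arguments of [p] held fixed, the
    invariants are moved along the segment to those of [y1], which satisfies the
    affine equations and enters the interior at once. *)
Lemma lift_segment (O : set (flat R d)) p y1 : open O -> O p -> MZ p -> interior_pts y1 ->
  exists eps y X, [/\ interior_pts y, above (toric_sec eps y) X & exists2 q, O q & above q X].
Proof.
move=> oO Op hp c1; have [th mth] := major_arg_ex (major_signs p) p.
have [ea eb ec et] := lift_ptE e BK th hp; set y0 := lift_pt _ _ _ _ _ _ _ _ in ea eb ec et.
pose a s k := mom_a p k + s * (face_a y1 k - mom_a p k).
pose b s k := mom_b p k + s * (face_b y1 k - mom_b p k).
pose c s k := mom_c p k + s * (face_c y1 k - mom_c p k).
pose q s := polar_pt (major_signs p) (a s) (b s) (c s) th.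
have a0 : a 0 = mom_a p by apply/funext => k; rewrite /a mul0r addr0.
have b0 : b 0 = mom_b p by apply/funext => k; rewrite /b mul0r addr0.
have c0 : c 0 = mom_c p by apply/funext => k; rewrite /c mul0r addr0.
have q0 : q 0 = p by rewrite /q a0 b0 c0 polar_ptK.
have qcvg k j : q s k j @[s --> 0^'+] --> p k j.
  rewrite -q0.
  have cr : long_rad (a s k) (b s k) (c s k) @[s --> 0^'+]
      --> long_rad (a 0 k) (b 0 k) (c 0 k).
    exact: cvg_at_right_filter (@rad_cvg (a^~ k) (b^~ k) (c^~ k) _ _ _ _ _ _
      (fun=> erefl) (fun=> erefl) (fun=> erefl)).
  have mc := @minor_cvg (a^~ k) (b^~ k) (c^~ k) _ _ _ _ _ _ (mom_cone p k) (c1 k)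
    (fun=> erefl) (fun=> erefl) (fun=> erefl).
  have C (x : R) : x @[s --> (0 : R)^'+] --> x by exact: cvg_cst.
  have [h0 h1 h2 h3] : [/\ q s k 0 @[s --> 0^'+] --> q 0 k 0,
      q s k 1 @[s --> 0^'+] --> q 0 k 1, q s k 2%:R @[s --> 0^'+] --> q 0 k 2%:R &
      q s k 3%:R @[s --> 0^'+] --> q 0 k 3%:R].
    have E (f : R -> R) (g : R -> R) : g = f -> f s @[s --> 0^'+] --> f 0 ->
      g s @[s --> 0^'+] --> g 0 by move=> ->.
    have CS := cos2Dsin2 (th k).
    have pe s := polar_pt_entries (major_signs p) (a s) (b s) (c s) th k.
    move: pe; rewrite /=; case: (major_signs p k) => pe; split.
    - apply: (E (fun s => long_rad (a s k) (b s k) (c s k) * cos (th k))).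
        by apply/funext => s; have [-> _ _ _] := pe s.
      exact: cvgM cr (C _).
    - apply: (E (fun s => long_rad (a s k) (b s k) (c s k) * sin (th k))).
        by apply/funext => s; have [_ -> _ _] := pe s.
      exact: cvgM cr (C _).
    - apply: (E (fun s => (c s k * cos (th k) + b s k * sin (th k))
          / long_rad (a s k) (b s k) (c s k))).
        by apply/funext => s; have [_ _ -> _] := pe s.
      exact: mc CS.
    - apply: (E (fun s => (c s k * sin (th k) + b s k * - cos (th k))
          / long_rad (a s k) (b s k) (c s k))).
        by apply/funext => s; have [_ _ _ ->] := pe s; rewrite mulrN.
      by apply: mc; rewrite sqrrN addrC.
    - apply: (E (fun s => (c s k * cos (th k) + b s k * - sin (th k))
          / long_rad (a s k) (b s k) (c s k))).
        by apply/funext => s; have [-> _ _ _] := pe s; rewrite mulrN.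
      by apply: mc; rewrite sqrrN.
    - apply: (E (fun s => (c s k * sin (th k) + b s k * cos (th k))
          / long_rad (a s k) (b s k) (c s k))).
        by apply/funext => s; have [_ -> _ _] := pe s.
      by apply: mc; rewrite addrC.
    - apply: (E (fun s => long_rad (a s k) (b s k) (c s k) * cos (th k))).
        by apply/funext => s; have [_ _ -> _] := pe s.
      exact: cvgM cr (C _).
    - apply: (E (fun s => long_rad (a s k) (b s k) (c s k) * sin (th k))).
        by apply/funext => s; have [_ _ _ ->] := pe s.
      exact: cvgM cr (C _).
  case: j => -[|[|[|[|//]]]] Hj.
  - by rewrite (_ : Ordinal Hj = 0) //; apply/val_inj.
  - by rewrite (_ : Ordinal Hj = 1) //; apply/val_inj.
  - by rewrite (_ : Ordinal Hj = 2%:R) //; apply/val_inj.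
  - by rewrite (_ : Ordinal Hj = 3%:R) //; apply/val_inj.
have /nbhs_ballP[r r0 rO] : nbhs p O by exact: open_nbhs_nbhs.
have nO : \forall s \near 0^'+, O (q s).
  have : \forall s \near (0 : R)^'+, forall kj : 'I_d * 'I_4,
      `|p kj.1 kj.2 - q s kj.1 kj.2| < r.
    apply: filter_forall => kj.
    exact: (cvgrPdist_lt _ _).1 (qcvg kj.1 kj.2) r r0.
  apply: filterS => s h; apply: rO; split=> // k j; exact: h (k, j).
have n1 : \forall s \near (0 : R)^'+, s < 1 by exact: nbhs_right_lt.
have n0 : \forall s \near (0 : R)^'+, 0 < s by exact: nbhs_right_gt.
have [s [Os [s0 s1]]] := filter_ex (filterI nO (filterI n0 n1)).
pose mix (P : 'M[R]_(n, m)) := P *m y0 + s *: (P *m y1 - P *m y0).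
pose y := glue_coords e (mix (pr_a R e)) (mix (pr_b R e)) (mix (pr_c R e)) (pr_t R e *m y0).
have [ya yb yc yt] := glue_coordsE e (mix (pr_a R e)) (mix (pr_b R e))
  (mix (pr_c R e)) (pr_t R e *m y0).
have mixE (P : 'M[R]_(n, m)) (l : R) k : (bm *m mix P) k 0 - l =
    ((bm *m (P *m y0)) k 0 - l)
    + s * (((bm *m (P *m y1)) k 0 - l) - ((bm *m (P *m y0)) k 0 - l)).
  rewrite /mix mulmxDr -scalemxAr mulmxBr.
  move: (bm *m (P *m y0)) (bm *m (P *m y1)) => G0 G1.
  by rewrite !mxE; ring.
have eya : face_a y = a s.
  by apply/funext => k; rewrite /face_a ya mixE -/(face_a y0 k) -/(face_a y1 k) ea.
have eyb : face_b y = b s.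
  by apply/funext => k; rewrite /face_b yb mixE -/(face_b y0 k) -/(face_b y1 k) eb.
have eyc : face_c y = c s.
  by apply/funext => k; rewrite /face_c yc mixE -/(face_c y0 k) -/(face_c y1 k) ec.
have ic k : in_icone (a s k) (b s k) (c s k).
  apply: (@path_icone (a^~ k) (b^~ k) (c^~ k) _ _ _ _ _ _ (mom_cone p k) (c1 k)) => //.
  by rewrite s0 ltW.
have cy : interior_pts y by move=> k; rewrite eya eyb eyc.
have hq : MZ (q s).
  have : MZ (toric_sec (major_signs p) y) by apply: toric_sec_mu => k; exact: icone_cone (cy k).
  move=> /(mu_zero_act (\row_k (th k - face_t e B y k))).
  rewrite torus_act_polar eya eyb eyc.
  rewrite (_ : (fun k => _) = th) //.
  by apply/funext => k; rewrite mxE addrC subrK.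
have [X oX] := above_ex hq; exists (major_signs p), y, X; split=> //; last by exists (q s).
by apply: (toric_sec_above_polar BK (th := th)); [rewrite eya eyb eyc|rewrite yt et].
Qed.

(** Over the combinatorial interior, a point where [V] is singular is either
    interior to the set of such points, hence in the good locus, or a limit of
    points where [V] is invertible. *)
Lemma dense_good_locus : CInt u lam1 lam2 lam3 !=set0 -> dense U.
Proof.
move=> /interior_pts_nonempty[y1 c1] W [X WX] oW; have [p op] := above_surj X.
have [Q1 [oO Op OW]] := nbhs_above oW WX op.
have [eps [y [X' [cy oy [q Oq oq]]]]] := lift_segment oO Op (above_mu op) c1.
have WX' := OW _ _ Oq oq.
have [Q2 [oO2 Op2 OW2]] := nbhs_above oW WX' oy.
have [ny|ny] := pselect (\forall z \near y, ~~ nondeg eps z).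
  by exists X'; split=> //; exists eps, y; split=> //; split=> //; right.
have cs : {for y, continuous (toric_sec eps)}.
  exact: (@Ck_toric_sec _ _ _ u lam1 lam2 lam3 _ e B 0 eps y cy).
have n1 : \forall z \near y, Q2 (toric_sec eps z) by apply: cs; exact: open_nbhs_nbhs.
have n2 : \forall z \near y, interior_pts z.
  exact: open_nbhs_nbhs (conj (@open_interior_pts _ _ _ u lam1 lam2 lam3 _ e) cy).
have [z [Oz cz nz]] : exists z, [/\ Q2 (toric_sec eps z), interior_pts z & nondeg eps z].
  apply: contrapT => h; apply: ny; apply: filterS2 n1 n2 => z Oz cz.
  by apply/negP => nz; apply: h; exists z.
have [X2 o2] := toric_sec_above_ex B eps cz; exists X2; split; first exact: OW2 Oz o2.
by exists eps, z; split=> //; split=> //; left.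
Qed.

End Density.

(** * Separation and countability *)

Section Separation.
Local Open Scope ring_scope.
Variables (R : realType) (d n : nat) (u : 'I_d -> 'rV[int]_n).
Variables (lam1 lam2 lam3 : 'I_d -> R).
Variables (m : nat) (e : (n + n + (n + n))%N = m).
Variable B : 'M[R]_(n, d).
Hypothesis BK : B *m beta_mx R u = 1%:M.
Implicit Types (p : flat R d) (k : 'I_d) (y : 'cV[R]_m) (z : 'rV[int]_n).

Notation M := (hs_quotient u lam1 lam2 lam3).
Implicit Types (X : M).
Notation toric_sec := (toric_sec u lam1 lam2 lam3 e B).
Notation branch := (branch u lam1 lam2 lam3 e B).
Notation period := (period R e).
Notation U := (@good_locus R d n u lam1 lam2 lam3 m e B).
Implicit Types x : U.

(** The projection is open, so that [A] and [A'] have images that are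
    neighbourhoods of [x] and [x'], and these meet. *)
Lemma cluster_above x x' p p' (A A' : set (flat R d)) : cluster (nbhs x) x' ->
  above p (set_val x) -> above p' (set_val x') -> nbhs p A -> nbhs p' A' ->
  exists q q' X, [/\ A q, A' q', above q X & above q' X].
Proof.
move=> cl op op'; rewrite !nbhsE => -[W [oW Wp] WA] [W' [oW' Wp'] WA'].
pose P (V : set (flat R d)) : set U := set_val @^-1` @orbit_image R d n u lam1 lam2 lam3 V.
have nP (V : set (flat R d)) (q : flat R d) x1 :
    open V -> V q -> above q (set_val x1) -> nbhs x1 (P V).
  move=> oV Vq oz; apply: open_nbhs_nbhs; split; last by exists q.
  exact: (@open_val R d n u lam1 lam2 lam3 m e B _
    (@open_orbit_image R d n u lam1 lam2 lam3 _ oV)).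
have [x0 [[q Wq oq] [q' Wq' oq']]] := cl _ _ (nP _ _ _ oW Wp op) (nP _ _ _ oW' Wp' op').
by exists q, q', (set_val x0); split=> //; [exact: WA|exact: WA'].
Qed.

(** Points that cannot be separated have the same values of all continuous
    periodic functions of the coordinates; these values determine the
    coordinates up to a period, hence the point. *)
Lemma good_locus_hausdorff : hausdorff_space U.
Proof.
move=> x x' cl.
have [eps [y [gy oy]]] : U (set_val x) by exact: set_mem (valP x).
have [eps' [y' [gy' oy']]] : U (set_val x') by exact: set_mem (valP x').
have [phi [z [dp E]]] := branch_hit BK (goodset_interior gy) oy oy.
have [phi' [z' [dp' E']]] := branch_hit BK (goodset_interior gy') oy' oy'.
have nd eps0 phi0 p : branch_dom eps0 phi0 p -> nbhs p (branch_dom eps0 phi0).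
  by move=> h; exact: open_nbhs_nbhs (conj (@open_branch_dom _ _ eps0 phi0) h).
have cb eps0 phi0 z0 p : branch_dom eps0 phi0 p -> {for p, continuous (branch eps0 phi0 z0)}.
  by exact: (@Ck_branch _ _ _ u lam1 lam2 lam3 _ e B 0).
have per q q' X : branch_dom eps phi q -> branch_dom eps' phi' q' ->
    above q X -> above q' X -> eps = eps' /\
      exists z0, branch eps' phi' z' q' = branch eps phi z q + period z0.
  move=> d1 d2 o1 o2; apply: (toric_sec_inj_period BK (X := X)).
  - exact: branch_interior (above_mu o1) d1.
  - exact: branch_interior (above_mu o2) d2.
  - exact: branch_above.
  - exact: branch_above.
have ee : eps = eps'.
  have [q [q' [X [d1 d2 o1 o2]]]] := cluster_above cl oy oy' (nd _ _ _ dp) (nd _ _ _ dp').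
  by have [] := per q q' X d1 d2 o1 o2.
have inv (h : 'cV[R]_m -> R) : Ck_on 0 setT h ->
    (forall v z0, h (v + period z0) = h v) -> h y = h y'.
  move=> /Ck0_continuous ch hper; apply: (@Rhausdorff R) => A A' nA nA'.
  have n1 : \forall q \near toric_sec eps y, A (h (branch eps phi z q)).
    have : {for toric_sec eps y, continuous (h \o branch eps phi z)}.
      by apply: continuous_comp; [exact: cb|exact: ch].
    by apply; rewrite /= E.
  have n2 : \forall q \near toric_sec eps' y', A' (h (branch eps' phi' z' q)).
    have : {for toric_sec eps' y', continuous (h \o branch eps' phi' z')}.
      by apply: continuous_comp; [exact: cb|exact: ch].
    by apply; rewrite /= E'.
  have [q [q' [X [[d1 A1] [d2 A2] o1 o2]]]] := cluster_above cl oy oy'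
    (filterI (nd _ _ _ dp) n1) (filterI (nd _ _ _ dp') n2).
  have [_ [z0 Ez]] := per q q' X d1 d2 o1 o2.
  exists (h (branch eps phi z q)); split=> //.
  by rewrite -(hper _ z0) -Ez.
have lin (P : 'M[R]_(n, m)) i : Ck_on 0 setT (fun v : 'cV[R]_m => (P *m v) i 0).
  by have := Ck_lin 0 P i 0 openT; under eq_fun do rewrite subr0.
have abc (P : 'M[R]_(n, m)) : (forall z0, P *m period z0 = 0) -> P *m y = P *m y'.
  move=> hP; apply/colP => i; apply: (inv (fun v => (P *m v) i 0)); first exact: lin.
  by move=> v z0; rewrite mulmxDr hP addr0.
have pp := pr_period R e.
have [c1 s1] : (forall i, cos ((pr_t R e *m y) i 0) = cos ((pr_t R e *m y') i 0)) /\
    (forall i, sin ((pr_t R e *m y) i 0) = sin ((pr_t R e *m y') i 0)).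
  have tE v z0 i : (pr_t R e *m (v + period z0)) i 0
      = (pr_t R e *m v) i 0 + (z0 0 i)%:~R * (2 * pi).
    by rewrite mulmxDr; have [_ _ _ ->] := pp z0; rewrite !mxE; congr (_ + _); rewrite mulrC.
  split=> i; have [Cs Cc] := Ck_sincos openT (lin (pr_t R e) i).
    apply: (inv (fun v => cos ((pr_t R e *m v) i 0))) => // v z0.
    by rewrite tE; have [] := cos_sin_int ((pr_t R e *m v) i 0) (z0 0 i).
  apply: (inv (fun v => sin ((pr_t R e *m v) i 0))) => // v z0.
  by rewrite tE; have [] := cos_sin_int ((pr_t R e *m v) i 0) (z0 0 i).
have [z0 Ez] : exists z0, y' = y + period z0.
  have [z0 hz0] : exists z0 : 'rV[int]_n,
      (pr_t R e *m y' - pr_t R e *m y)^T = map_mx intr z0 *m (2 * pi)%:M.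
    apply: torus_exp_eq1; apply/rowP => i; rewrite !mxE cosD sinD cosN sinN.
    have := c1 i; have := s1 i; rewrite !mxE => -> ->.
    set t := (\sum_j _); have CS := cos2Dsin2 t.
    by apply/eqP; rewrite eq_complex /=; apply/andP; split; apply/eqP; rewrite -?CS; ring.
  exists z0; have := pp z0 => -[za zb zc zt].
  apply: (@coord_ext R n m e); rewrite mulmxDr.
  - by rewrite za addr0; apply/esym/abc => z1; have [] := pp z1.
  - by rewrite zb addr0; apply/esym/abc => z1; have [] := pp z1.
  - by rewrite zc addr0; apply/esym/abc => z1; have [] := pp z1.
  - rewrite zt; have := congr1 trmx hz0; rewrite trmxK mul_mx_scalar [RHS]linearZ /=.
    by move=> <-; rewrite addrC subrK.
apply: (@above_val_inj _ _ _ _ _ _ _ _ _ _ (toric_sec eps' y')) oy'; rewrite Ez -ee.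
exact: toric_sec_period.
Qed.

(** The projection is open, so that the images of rational balls of flat space
    form a basis. *)
Lemma good_locus_second_countable : @second_countable U.
Proof.
pose f (c : 'M[rat]_(d, 4) * nat) : set U := set_val @^-1`
  @orbit_image R d n u lam1 lam2 lam3 (ball (map_mx ratr c.1 : flat R d) c.2.+1%:R^-1).
exists (range f); first by apply: sub_countable (card_image_le f _) _; exact: countableP.
split=> [_ [c _ <-]|x W].
  by apply: open_val; apply: open_orbit_image; exact: ball_open.
rewrite nbhsE => -[_ [[W0 oW0 <-] W0x] W0W]; have [p op] := above_surj (set_val x).
have [V [oV Vp HV]] := nbhs_above oW0 W0x op.
have /nbhs_ballP[r /= r0 rV] : nbhs p V by exact: open_nbhs_nbhs.
have [k kr] : exists k : nat, k.+1%:R^-1 < r / 2.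
  exists (Num.trunc (r / 2)^-1); rewrite -[ltRHS]invrK ltf_pV2 ?posrE ?invr_gt0 ?divr_gt0 //.
  by apply: truncnS_gt.
have k0 : 0 < k.+1%:R^-1 :> R by rewrite invr_gt0.
have /choice[q hq] : forall ij : 'I_d * 'I_4, exists c : rat,
    `|ratr c - p ij.1 ij.2| < k.+1%:R^-1.
  move=> ij; have lt : p ij.1 ij.2 < p ij.1 ij.2 + k.+1%:R^-1 by rewrite ltrDl.
  have [c] := rat_in_itvoo lt; rewrite in_itv /= => /andP[lo hi]; exists c.
  move: lo hi; move: (ratr c) (p _ _) (_^-1) => t a b lo hi.
  by rewrite ger0_norm ?subr_ge0 1?ltW //; lra.
pose c := (\matrix_(i, j) q (i, j), k); exists (f c).
  split; first by exists c.
  by exists p => //; split=> // i j; rewrite !mxE; exact: (hq (i, j)).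
move=> x' [p' [_ cp'] op']; apply: W0W; apply: HV op'; apply: rV; split=> // i j.
have := cp' i j; have := hq (i, j); rewrite /= /ball /= !mxE.
set s := ratr _ => h1 h2.
rewrite (_ : p i j - p' i j = (s - p' i j) - (s - p i j)); last by ring.
apply: le_lt_trans (ler_normB _ _) _; rewrite (splitr r).
by apply: ltrD; [apply: lt_trans h2 kr|apply: lt_trans h1 kr].
Qed.

End Separation.

(** * The hypersymplectic structure *)

Section ToricStructure.
Local Open Scope ring_scope.
Variables (R : realType) (d n : nat) (u : 'I_d -> 'rV[int]_n).
Variables (lam1 lam2 lam3 : 'I_d -> R).
Notation m := (2 * n + 2 * n)%N.
Variables (ep : (n + n)%N = (2 * n)%N) (e : (n + n + (n + n))%N = m).
Variable B : 'M[R]_(n, d).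
Hypothesis BK : B *m beta_mx R u = 1%:M.

Notation A := (@toric_atlas R d n u lam1 lam2 lam3 m e B BK).
Notation gG := (toric_g u lam1 lam2 lam3 e).
Notation gI := (toric_I u lam1 lam2 lam3 e).
Notation gS := (toric_S u lam1 lam2 lam3 e).
Notation gT := (toric_T u lam1 lam2 lam3 e).
Notation goodset := (goodset u lam1 lam2 lam3 e).

Let in_charts (F : {ffun 'I_d -> bool} -> 'cV[R]_m -> 'M[R]_m) : field A :=
  fun j => F j.2.1.

Let smooth_in_charts F : (forall l eps, Ck_on l (goodset eps) (F eps)) ->
  smooth_field (in_charts F).
Proof.
move=> cF j l; apply: (@Ck_subset _ _ _ l (goodset j.2.1)); last exact: cF.
by move=> y [].
Qed.

Let bilinear_in_charts F :
  (forall eps y z, F eps (y + period R e z) = F eps y) ->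
  bilinear_field (in_charts F).
Proof.
move=> Fz i j y ty v w; rewrite !derive_transition //.
have [ee [z nz]] := transition_near ty.
have [_ ->] := nbhs_singleton nz.
by rewrite /in_charts Fz ee.
Qed.

Let endo_in_charts F :
  (forall eps y z, F eps (y + period R e z) = F eps y) ->
  endomorphism_field (in_charts F).
Proof.
move=> Fz i j y ty v; rewrite !derive_transition //.
have [ee [z nz]] := transition_near ty.
have [_ ->] := nbhs_singleton nz.
by rewrite /in_charts Fz ee.
Qed.

Let periodic := @toric_fields_period R d n u lam1 lam2 lam3 m e.

Let smoothG := smooth_in_charts (@Ck_toric_g R d n u lam1 lam2 lam3 m e).
Let smoothI := smooth_in_charts (@Ck_toric_I R d n u lam1 lam2 lam3 m e).
Let smoothS := smooth_in_charts (@Ck_toric_S R d n u lam1 lam2 lam3 m e).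
Let smoothT := smooth_in_charts (@Ck_toric_T R d n u lam1 lam2 lam3 m e).

Let tensorG : bilinear_field (in_charts gG).
Proof. by apply: bilinear_in_charts => eps y z; have [] := periodic eps y z. Qed.
Let tensorI : endomorphism_field (in_charts gI).
Proof. by apply: endo_in_charts => eps y z; have [] := periodic eps y z. Qed.
Let tensorS : endomorphism_field (in_charts gS).
Proof. by apply: endo_in_charts => eps y z; have [] := periodic eps y z. Qed.
Let tensorT : endomorphism_field (in_charts gT).
Proof. by apply: endo_in_charts => eps y z; have [] := periodic eps y z. Qed.

Let pointwise : forall j y, chart_cod (A j) y ->
  let g := in_charts gG j y in let I := in_charts gI j y in
  let S := in_charts gS j y in let T := in_charts gT j y in
  [/\ g^T = g /\ signature g,
      [/\ I *m I = - 1%:M, S *m S = 1%:M & T *m T = 1%:M],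
      I *m S = T /\ T = - (S *m I) &
      [/\ forall v w, bform g (I *m v) (I *m w) = bform g v w,
          forall v w, bform g (S *m v) (S *m w) = - bform g v w &
          forall v w, bform g (T *m v) (T *m w) = - bform g v w]].
Proof.
move=> j y _ /=; rewrite /in_charts.
have VW := hat_VW u lam1 lam2 lam3 e j.2.1 y.
have WV := hat_WV u lam1 lam2 lam3 e j.2.1 y.
have VT := hat_V_sym u lam1 lam2 lam3 e j.2.1 y.
split.
- by split; [exact: hsG_sym|exact: hsG_signature].
- by split; [exact: hsII|exact: hsSS|exact: hsTT].
- by split; [exact: hsIS|exact: hsSI].
- by split=> v w; [exact: bform_hsI|exact: bform_hsS|exact: bform_hsT].
Qed.

Let closed : forall j,
  [/\ closed_two_form (chart_cod (A j))
        (fun y => two_form (in_charts gG j y) (in_charts gI j y)),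
      closed_two_form (chart_cod (A j))
        (fun y => two_form (in_charts gG j y) (in_charts gS j y)) &
      closed_two_form (chart_cod (A j))
        (fun y => two_form (in_charts gG j y) (in_charts gT j y))].
Proof.
by move=> j; split=> y [gy _]; [exact: closed_I|exact: closed_S|exact: closed_T].
Qed.

Definition toric_structure : hypersymplectic A :=
  Hypersymplectic smoothG smoothI smoothS smoothT tensorG tensorI tensorS tensorT
    pointwise closed.

End ToricStructure.

(** * Comparison with the flat structure *)

Section Reduction.
Local Open Scope ring_scope.
Variables (R : realType) (d n : nat) (u : 'I_d -> 'rV[int]_n).
Variables (lam1 lam2 lam3 : 'I_d -> R).
Variables (m : nat) (e : (n + n + (n + n))%N = m).
Variable B : 'M[R]_(n, d).
Hypothesis BK : B *m beta_mx R u = 1%:M.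
Implicit Types (p : flat R d) (k : 'I_d) (y v w : 'cV[R]_m).
Implicit Types (eps : {ffun 'I_d -> bool}) (phi : 'I_d -> R).

Let bm := beta_mx R u.
Notation MZ := (mu_zero u lam1 lam2 lam3).
Notation face_a := (face_a u lam1 e).
Notation face_b := (face_b u lam2 e).
Notation face_c := (face_c u lam3 e).
Notation face_f := (face_f u lam1 lam2 lam3 e).
Notation face_V := (face_V u lam1 lam2 lam3 e).
Notation face_A := (face_A u lam1 lam2 lam3 e).
Notation gh_V := (gh_V u lam1 lam2 lam3 e).
Notation nondeg := (nondeg u lam1 lam2 lam3 e).
Notation interior_pts := (interior_pts u lam1 lam2 lam3 e).
Notation branch := (branch u lam1 lam2 lam3 e B).
Notation face_da := (face_da u e).
Notation face_db := (face_db u e).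
Notation face_dc := (face_dc u e).
Notation gG := (toric_g u lam1 lam2 lam3 e).
Notation gI := (toric_I u lam1 lam2 lam3 e).
Notation gS := (toric_S u lam1 lam2 lam3 e).
Notation gT := (toric_T u lam1 lam2 lam3 e).

Section AtPoint.
Variables (eps : {ffun 'I_d -> bool}) (phi : 'I_d -> R) (z : 'rV[int]_n).
Variables (p : flat R d) (y : 'cV[R]_m).
Hypotheses (hp : MZ p) (dp : branch_dom eps phi p) (py : branch eps phi z p = y).

Let pabc : [/\ face_a y = mom_a p, face_b y = mom_b p & face_c y = mom_c p].
Proof. by rewrite -py; have [-> -> -> _] := branchE e BK eps phi z hp. Qed.

(** In terms of a point of flat space above [y], the data of a face are those of
    [C^(1,1)]. *)
Lemma branch_potential k : [/\ face_V eps y k = (mom_d p k)^-1, mom_d p k != 0,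
  major_sq eps p k != 0 & face_A eps y k = (mom_d p k * major_sq eps p k)^-1].
Proof.
have [ea eb ec] := pabc; have [_ s0] := dp k.
have fE : face_f y k = 2^-1 * (sign_of R (eps k) * mom_d p k).
  rewrite /face_f ea eb ec mom_sqE sqrtr_sqr normrM gtr0_norm ?invr_gt0 //.
  congr (_ * _); move: s0; rewrite /sign_of; case: (eps k) => s0.
    by rewrite mul1r in s0 *; rewrite gtr0_norm.
  by rewrite mulN1r in s0 *; rewrite ltr0_norm // -oppr_gt0.
have d0 : mom_d p k != 0 by apply: contraTneq s0 => ->; rewrite mulr0 ltxx.
have vE : face_V eps y k = (mom_d p k)^-1.
  by rewrite /face_V fE; move: s0 {fE}; rewrite /sign_of; case: (eps k) => s0; field; rewrite
      ?d0.
have mE : major_sq eps p k = face_a y k + face_f y k.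
  by rewrite fE ea /major_sq /major_x /major_y /sign_of /mom_a /mom_d; case: (eps k); field.
have cy : interior_pts y by rewrite -py; exact: branch_interior.
have m0 : major_sq eps p k != 0.
  by rewrite mE gt_eqF // addr_gt0 ?face_f_gt0 //; case: (cy k).
by split=> //; rewrite /face_A vE -mE invfM.
Qed.

Lemma flat_g_fundamental (xi eta : 'rV[R]_d) :
  flat_g (fundamental_field xi p) (fundamental_field eta p)
  = \sum_k xi 0 k * eta 0 k * mom_d p k.
Proof.
have -> : flat_g (fundamental_field xi p) (fundamental_field eta p) =
    \sum_k complex.Re (zcoord (fundamental_field xi p) k
      * (zcoord (fundamental_field eta p) k)^* - wcoord (fundamental_field xi p) k
      * (wcoord (fundamental_field eta p) k)^*)%C.
  by rewrite /flat_g; elim/big_rec2: _ => // k x s _ <-; case: s.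
apply: eq_bigr => k _; rewrite /fundamental_field /zcoord /wcoord /flat_point !mxE /= /mom_d.
ring.
Qed.

(** A null vector of [V] is a null direction of the metric along the orbit. *)
Lemma nondegenerate_orbit_nondeg : nondegenerate_orbit u p -> nondeg eps y.
Proof.
move=> hno; apply/negP => /det0P[v v0 hv].
pose xi : 'rV[R]_d := v *m bm^T *m diag_mx (\row_k face_V eps y k).
have xiE k : xi 0 k = (v *m bm^T) 0 k * (mom_d p k)^-1.
  rewrite /xi mul_mx_diag [LHS]mxE; congr (_ * _); rewrite mxE.
  by have [-> _ _ _] := branch_potential k.
have xi0 : xi = 0.
  apply: hno; first by rewrite /beta /xi -!mulmxA -[RHS]hv /gh_V !mulmxA.
  move=> eta heta; rewrite flat_g_fundamental.
  have -> : \sum_k xi 0 k * eta 0 k * mom_d p k = (v *m bm^T *m eta^T) 0 0.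
    rewrite [RHS]mxE; apply: eq_bigr => k _; rewrite xiE [eta^T _ _]mxE.
    by have [_ d0 _ _] := branch_potential k; field.
  by rewrite -mulmxA -trmx_mul; move: heta; rewrite /beta => ->; rewrite trmx0 mulmx0 mxE.
have v1 : v *m bm^T = 0.
  apply/rowP => k; rewrite [RHS]mxE.
  have /eqP : xi 0 k = 0 by rewrite xi0 mxE.
  have [_ d0 _ _] := branch_potential k.
  by rewrite xiE mulf_eq0 invr_eq0 (negPf d0) orbF => /eqP.
by case/eqP: v0; rewrite -[v]mulmx1 -trmx1 -BK trmx_mul mulmxA v1 mul0mx.
Qed.

(** The reduced forms, in terms of tangent vectors [P v] of the zero set of the
    moment map that project to [v]. *)
Lemma reduced_forms (P : 'cV[R]_m -> flat R d) v w : nondeg eps y ->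
  (forall k x, [/\ mom_da p k (P x) = face_da k x, mom_db p k (P x) = face_db k x &
    mom_dc p k (P x) = face_dc k x]) ->
  (forall x, pr_t R e *m x = bm^T *m \col_k major_dt eps p k (P x)) ->
  [/\ bform (two_form (gG eps y) (gI eps y)) v w = \sum_k omI k (P v) (P w),
      bform (two_form (gG eps y) (gS eps y)) v w = \sum_k omS k (P v) (P w) &
      bform (two_form (gG eps y) (gT eps y)) v w = \sum_k omT k (P v) (P w)].
Proof.
move=> nd hD hT; have [ea eb ec] := pabc.
have hVE : hat_V u lam1 lam2 lam3 e eps y = gh_V eps y by rewrite /hat_V nd.
have hA1E : hat_Ab u lam1 lam2 lam3 e eps y = gh_Ab u lam1 lam2 lam3 e eps y by rewrite
    /hat_Ab nd.
have hA2E : hat_Ac u lam1 lam2 lam3 e eps y = gh_Ac u lam1 lam2 lam3 e eps y by rewrite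
    /hat_Ac nd.
have tE x (X : 'cV[R]_n) :
    ((pr_t R e *m x)^T *m X) 0 0 = \sum_k major_dt eps p k (P x) * (bm *m X) k 0.
  rewrite hT trmx_mul trmxK -mulmxA mxE; apply: eq_bigr => k _.
  by rewrite !mxE.
have tE' x (X : 'cV[R]_n) :
    (X^T *m (pr_t R e *m x)) 0 0 = \sum_k (bm *m X) k 0 * major_dt eps p k (P x).
  have -> : X^T *m (pr_t R e *m x) = ((pr_t R e *m x)^T *m X)^T.
    by rewrite [RHS]trmx_mul trmxK.
  by rewrite mxE tE; apply: eq_bigr => k _; rewrite mulrC.
have main (p1 p2 p3 : 'M[R]_(n, m)) (om : 'I_d -> flat R d -> flat R d -> R)
    (D1 D2 D3 : 'I_d -> flat R d -> R) :
    (forall k x, (bm *m (p1 *m x)) k 0 = D1 k (P x)) ->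
    (forall k x, (bm *m (p2 *m x)) k 0 = D2 k (P x)) ->
    (forall k x, (bm *m (p3 *m x)) k 0 = D3 k (P x)) ->
    (forall k x x', om k x x' = major_dt eps p k x * D1 k x' - D1 k x * major_dt eps p k x'
      + gh_summand ((mom_d p k * major_sq eps p k)^-1) (mom_d p k)^-1 (mom_b p k) (mom_c p k)
          (mom_db p k) (mom_dc p k) (D1 k) (D2 k) (D3 k) x x') ->
    bform ((connection e (gh_Ab u lam1 lam2 lam3 e eps y) (gh_Ac u lam1 lam2 lam3 e eps y))^T
        *m p1
      - p1^T *m connection e (gh_Ab u lam1 lam2 lam3 e eps y) (gh_Ac u lam1 lam2 lam3 e eps y)
      + (p2^T *m gh_V eps y *m p3 - p3^T *m gh_V eps y *m p2)) v w
    = \sum_k om k (P v) (P w).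
  move=> h1 h2 h3 hom; rewrite gh_formE tE tE' -sumrB -big_split /=.
  apply: eq_bigr => k _; rewrite hom /gh_summand !h1 !h2 !h3.
  have [-> _ _ ->] := branch_potential k.
  by rewrite eb ec; have [_ -> ->] := hD k v; have [_ -> ->] := hD k w.
have gh k x x' : [/\ _, _ & _] := flat_gibbons_hawking x x'
  (let: And4 _ _ a _ := branch_potential k in a)
  (let: And4 _ b _ _ := branch_potential k in b).
have ha k x : (bm *m (pr_a R e *m x)) k 0 = mom_da p k (P x) by have [-> _ _] := hD k x.
have hb k x : (bm *m (pr_b R e *m x)) k 0 = mom_db p k (P x) by have [_ -> _] := hD k x.
have hc k x : (bm *m (pr_c R e *m x)) k 0 = mom_dc p k (P x) by have [_ _ ->] := hD k x.
rewrite toric_I_form toric_S_form toric_T_form hVE hA1E hA2E; split.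
- by apply: main ha hc hb _ => k x x'; have [] := gh k x x'.
- by apply: main hb hc ha _ => k x x'; have [] := gh k x x'.
- by apply: main hc ha hb _ => k x x'; have [] := gh k x x'.
Qed.

End AtPoint.

(** Differentiating the identity that the coordinates of [s y] are [y]. *)
Lemma section_derive eps phi z (s : 'cV[R]_m -> flat R d) y :
  differentiable s y ->
  (\forall y' \near y, MZ (s y') /\ branch_dom eps phi (s y') /\
     branch eps phi z (s y') = y') ->
  (forall k v, [/\ mom_da (s y) k ('D_v s y) = face_da k v, mom_db (s y) k ('D_v s y) =
      face_db k v &
    mom_dc (s y) k ('D_v s y) = face_dc k v]) /\
  (forall v, pr_t R e *m v = bm^T *m \col_k major_dt eps (s y) k ('D_v s y)).
Proof.
move=> Ds near_s; have [hp [dp Ep]] := nbhs_singleton near_s.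
have Dc0 k j : differentiable (fun y' => s y' k j) y.
  apply: (@differentiable_comp _ _ _ _ s (fun X : flat R d => X k j)) => //.
  exact: differentiable_coord.
have iD k j v : is_derive y v (fun y' => s y' k j) ('D_v s y k j).
  apply: DeriveDef; first exact: diff_derivable.
  exact: derive_coord.
have uniq (f g : 'cV[R]_m -> R) v df dg : (\forall y' \near y, f y' = g y') ->
    is_derive y v f df -> is_derive y v g dg -> df = dg.
  move=> fg [_ <-] [_ <-]; exact: near_eq_derive.
have nE : \forall y' \near y, [/\ face_a y' = mom_a (s y'), face_b y' = mom_b (s y'), face_c
    y' = mom_c (s y') &
    pr_t R e *m y' = bm^T *m (\col_k ang (phi k) (major_x eps (s y') k) (major_y eps (s y') k))
        + (2 * pi) *: (map_mx intr z)^T].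
  apply: filterS near_s => y' [hp' [_ E]].
  by have := branchE e BK eps phi z hp'; rewrite E.
split=> [k v|v].
  have C (c : R) := isD_cst y v c.
  split.
  - apply: (@uniq (fun y' => mom_a (s y') k) (fun y' => face_a y' k) v).
    + by apply: filterS nE => y' [->].
    + rewrite /mom_a; under eq_fun do rewrite !expr2.
      apply: is_derive_eq (isD_mul (C 2^-1) (isD_add (isD_add (isD_add
        (isD_mul (iD k 0 v) (iD k 0 v)) (isD_mul (iD k 1 v) (iD k 1 v)))
        (isD_mul (iD k 2%:R v) (iD k 2%:R v))) (isD_mul (iD k 3%:R v) (iD k 3%:R v)))) _.
      by rewrite /mom_da; field.
    + exact: isD_face_a.
  - apply: (@uniq (fun y' => mom_b (s y') k) (fun y' => face_b y' k) v).
    + by apply: filterS nE => y' [_ ->].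
    + apply: is_derive_eq (isD_add (isD_mul (iD k 1 v) (iD k 2%:R v))
        (isD_opp (isD_mul (iD k 0 v) (iD k 3%:R v)))) _.
      by rewrite /mom_db; ring.
    + exact: isD_face_b.
  - apply: (@uniq (fun y' => mom_c (s y') k) (fun y' => face_c y' k) v).
    + by apply: filterS nE => y' [_ _ ->].
    + apply: is_derive_eq (isD_add (isD_mul (iD k 0 v) (iD k 2%:R v))
        (isD_mul (iD k 1 v) (iD k 3%:R v))) _.
      by rewrite /mom_dc; ring.
    + exact: isD_face_c.
apply/colP => i; pose c := ((2 * pi) *: (map_mx intr z)^T : 'cV[R]_n) i 0.
apply: (@uniq (fun y' => (pr_t R e *m y') i 0)
  (fun y' => \sum_k bm k i * ang (phi k) (major_x eps (s y') k) (major_y eps (s y') k) + c) v).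
- apply: filterS nE => y' [_ _ _ ->]; rewrite mxE mxE; congr (_ + _).
  by apply: eq_bigr => k _; rewrite !mxE.
- have -> : (fun y' => (pr_t R e *m y') i 0) = (fun y' => \sum_j pr_t R e i j * y' j 0).
    by apply/funext => y'; rewrite mxE.
  rewrite mxE; apply: isD_sum => j.
  have h : is_derive y v (fun y' : 'cV[R]_m => y' j 0) (v j 0).
    apply: DeriveDef; first exact/diff_derivable/differentiable_coord.
    by rewrite (@derive_coord _ _ _ _ (fun x => x)) // derive_id.
  apply: is_derive_eq (isD_mul (isD_cst y v (pr_t R e i j)) h) _.
  by rewrite mulr0 addr0.
have iE k : is_derive y v
    (fun y' => bm k i * ang (phi k) (major_x eps (s y') k) (major_y eps (s y') k))
    (bm k i * major_dt eps (s y) k ('D_v s y)).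
  have [pos _] := dp k.
  have h : is_derive y v (fun y' => ang (phi k) (major_x eps (s y') k) (major_y eps (s y') k))
      (major_dt eps (s y) k ('D_v s y)).
    by move: pos; rewrite /major_dt /major_sq /major_x /major_y; case: (eps k) => pos; exact:
        isD_ang.
  apply: is_derive_eq (isD_mul (isD_cst y v (bm k i)) h) _.
  by rewrite mulr0 addr0.
apply: is_derive_eq (isD_add (isD_sum (index_enum _) iE) (isD_cst y v c)) _.
by rewrite addr0 mxE; apply: eq_bigr => k _; rewrite !mxE.
Qed.

End Reduction.

Section Induced.
Local Open Scope ring_scope.
Variables (R : realType) (d n : nat) (u : 'I_d -> 'rV[int]_n).
Variables (lam1 lam2 lam3 : 'I_d -> R).
Notation m := (2 * n + 2 * n)%N.
Variables (ep : (n + n)%N = (2 * n)%N) (e : (n + n + (n + n))%N = m).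
Variable B : 'M[R]_(n, d).
Hypothesis BK : B *m beta_mx R u = 1%:M.

(** Following a local section by the branch of the coordinates that describes the
    chart near its value is the identity, which gives the hypothesis of
    [section_derive]. *)
Lemma toric_induced : induced_structure (@toric_structure R d n u lam1 lam2 lam3 ep e B BK).
Proof.
move=> [x0 [eps t]] Y s [oY subY ss hs] y Yy nd v w /=.
have sY y' : Y y' -> toric_cod u lam1 lam2 lam3 e eps t y' by exact: subY.
have oy y' : Y y' -> above (s y') (set_val (toric_inv x0 eps y')) by exact: hs.
have dx := toric_inv_dom x0 (sY y Yy).
have [phi [z [[dp cp] Ep H]]] := toric_map_local BK dx (oy y Yy).
rewrite (toric_invK BK) in Ep; last exact: sY.
have near_s : \forall y' \near y, mu_zero u lam1 lam2 lam3 (s y') /\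
    branch_dom eps phi (s y') /\ branch u lam1 lam2 lam3 e B eps phi z (s y') = y'.
  have n1 : \forall y' \near y, Y y' by exact: open_nbhs_nbhs.
  have cs : {for y, continuous s} := ss 0 y Yy.
  have n2 : \forall y' \near y, branch_pre u lam1 lam2 lam3 e B eps phi z (toric_cod u lam1
      lam2 lam3 e eps t) (s y').
    apply: cs; apply: open_nbhs_nbhs; split; last by split.
    exact: (@open_branch_pre R d n u lam1 lam2 lam3 m e B eps phi z _ (@open_toric_cod R d n
        u lam1 lam2 lam3 m e eps t)).
  apply: filterS2 n1 n2 => y' Yy' bp'; have o' := oy y' Yy'.
  have [_ E] := H _ _ bp' o'; split; first exact: above_mu o'.
  by split; [case: bp'|rewrite -E (toric_invK BK) //; exact: sY].
have Ds : differentiable s y by have [+ _] := ss 1%N; exact.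
have [hD hT] := section_derive BK Ds near_s.
have [hp _] := nbhs_singleton near_s.
have nd' := nondegenerate_orbit_nondeg BK hp dp Ep nd.
have [-> -> ->] := reduced_forms BK hp dp Ep (P := fun v => 'D_v s y) v w nd' hD hT.
by rewrite flat_omegaIE flat_omegaSTE.
Qed.

End Induced.

Theorem theorem6 (R : realType) (d n : nat) (u : 'I_d -> 'rV[int]_n)
    (lam1 lam2 lam3 : 'I_d -> R) :
  spanning R u ->
  (CInt u lam1 lam2 lam3 !=set0)%classic ->
  exists U : set (hs_quotient u lam1 lam2 lam3),
    [/\ open U, dense U, manifold_topology U &
        exists (A : atlas R U (2 * n + 2 * n)) (H : hypersymplectic A),
          (forall j, quotient_chart (A j)) /\ induced_structure H].
Proof.
move=> /row_fullP[B BK] ne.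
have ep : (n + n = 2 * n)%N by rewrite mul2n addnn.
have e : (n + n + (n + n) = 2 * n + 2 * n)%N by rewrite ep.
exists (@good_locus R d n u lam1 lam2 lam3 _ e B); split.
- exact: open_good_locus.
- exact: dense_good_locus.
- by split; [exact: good_locus_hausdorff|exact: good_locus_second_countable].
exists (@toric_atlas R d n u lam1 lam2 lam3 _ e B BK).
exists (@toric_structure R d n u lam1 lam2 lam3 ep e B BK); split.
  by move=> j; exact: toric_quotient_chart.
exact: toric_induced.
Qed.
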